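(* In the folk model structure on $\omega\mathbf{Cat}$, all $\omega$-categories are fibrant; that is, for every strict $\omega$-category $X$ the unique $\omega$-functor from $X$ to the terminal $\omega$-category is a fibration.
   Context: A strict $\omega$-category $X$ is a globular set (sets $X_n$ of $n$-cells, $n\ge 0$, with source and target maps satisfying the globular identities) endowed with compositions and units satisfying associativity, unit and interchange laws; $\omega$-functors preserve all this structure; $\omega\mathbf{Cat}$ is the category of small strict $\omega$-categories and $\omega$-functors. Two $n$-cells are parallel, $x\parallel y$, if $n=0$ or they have the same source and the same target; $u:x\to y$ denotes an $(n+1)$-cell with source $x$ and target $y$; $u*_n v$ is $n$-composition in diagrammatic order; $1_x$ is the unit on $x$. $\omega$-equivalence $\sim$ and reversibility are defined by mutual coinduction: for parallel $n$-cells $x,y$, $x\sim y$ iff there is a reversible $(n+1)$-cell $u:x\to y$; an $(n+1)$-cell $u:x\to y$ is reversible iff there is an $(n+1)$-cell $\overline u:y\to x$ with $u*_n\overline u\sim 1_x$ and $\overline u*_n u\sim 1_y$ (reversible cells form the largest class with this property). An $\omega$-functor $f:X\to Y$ is an $\omega$-weak equivalence (belongs to $\mathcal W$) if (i) for any $0$-cell $y$ of $Y$ there is a $0$-cell $x$ of $X$ with $fx\sim y$, and (ii) for any $n\ge0$, any parallel $n$-cells $x\parallel x'$ of $X$ and any $v:fx\to fx'$ in $Y$ there is $u:x\to x'$ in $X$ with $fu\sim v$. $\mathbf O^n$ is the free $\omega$-category on the representable globular set having exactly one $n$-cell, two $k$-cells for each $k<n$ and no cell of dimension $>n$; $\partial\mathbf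 O^n$ is the free $\omega$-category on the same globular set with the $n$-cell removed; $\mathbf i_n:\partial\mathbf O^n\to\mathbf O^n$ is the inclusion, and $I=\{\mathbf i_n: n\in\mathbb N\}$. For a class $K$ of morphisms, $K\text{-inj}$ is the class of morphisms with the right lifting property with respect to $K$, and $K\text{-cof}$ the class of morphisms with the left lifting property with respect to $K\text{-inj}$. The folk model structure on $\omega\mathbf{Cat}$ is the model structure with weak equivalences $\mathcal W$, cofibrations $I\text{-cof}$, and fibrations $(I\text{-cof}\cap\mathcal W)\text{-inj}$. *)

(* Defs.v *)
From mathcomp Require Import all_boot.

Set Implicit Arguments.
Unset Strict Implicit.
Unset Printing Implicit Defensive.

Record globSet := GlobSet {
  cell : nat -> Type;
  src : forall n, cell n.+1 -> cell n;
  tgt : forall n, cell n.+1 -> cell n;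
  src_globular : forall n (x : cell n.+2), src (src x) = src (tgt x);
  tgt_globular : forall n (x : cell n.+2), tgt (src x) = tgt (tgt x) }.

Arguments cell : clear implicits.
Arguments src {g n} x.
Arguments tgt {g n} x.

Record globMap (G H : globSet) := GlobMap {
  gmap :> forall n, cell G n -> cell H n;
  gmap_src : forall n (x : cell G n.+1), gmap (src x) = src (gmap x);
  gmap_tgt : forall n (x : cell G n.+1), gmap (tgt x) = tgt (gmap x) }.

Arguments gmap {G H} g {n} x.

Definition parallel (G : globSet) (n : nat) : cell G n -> cell G n -> Prop :=
  match n with
  | 0 => fun _ _ => True
  | _.+1 => fun x y => src x = src y /\ tgt x = tgt y
  end.

(** The strict order on dimensions, [dlt m n] meaning [m < n]. It lives in
    [Type] (each [dlt m n] has at most one element) so that iterated sources,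
    targets and units are defined by structural recursion, without transport
    along equations between dimensions. *)
Inductive dlt (m : nat) : nat -> Type :=
| dltS : dlt m m.+1
| dltW n : dlt m n -> dlt m n.+1.

Arguments dltS {m}.
Arguments dltW {m n} h.

Fixpoint dlt_trans l m n (h : dlt l m) (k : dlt m n) : dlt l n :=
  match k in dlt _ n return dlt l n with
  | dltS => dltW h
  | dltW _ k' => dltW (dlt_trans h k')
  end.

Fixpoint src_at (G : globSet) m n (h : dlt m n) : cell G n -> cell G m :=
  match h in dlt _ n return cell G n -> cell G m with
  | dltS => fun x => src x
  | dltW _ h' => fun x => src_at h' (src x)
  end.

Fixpoint tgt_at (G : globSet) m n (h : dlt m n) : cell G n -> cell G m :=
  match h in dlt _ n return cell G n -> cell G m with
  | dltS => fun x => tgt x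
  | dltW _ h' => fun x => tgt_at h' (tgt x)
  end.

Fixpoint unit_at (G : globSet) (u : forall n, cell G n -> cell G n.+1)
    m n (h : dlt m n) : cell G m -> cell G n :=
  match h in dlt _ n return cell G m -> cell G n with
  | dltS => fun x => u _ x
  | dltW _ h' => fun x => u _ (unit_at u h' x)
  end.

(** For [h : m < n], [comp h x y e] is the [m]-composite, in diagrammatic
    order, of the [n]-cells [x] and [y]; [e] witnesses that they are
    [m]-composable. Each law quantifies over the witnesses of all the
    composites it mentions; those of the nested or derived composites follow
    from the others and the source/target laws. *)
Record omegaCat := OmegaCat {
  glob :> globSet;
  unit1 : forall n, cell glob n -> cell glob n.+1;
  comp : forall m n (h : dlt m n) (x y : cell glob n),
    tgt_at h x = src_at h y -> cell glob n;
  src_unit : forall n (x : cell glob n), src (unit1 x) = x;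
  tgt_unit : forall n (x : cell glob n), tgt (unit1 x) = x;
  src_compS : forall n (x y : cell glob n.+1) (e : tgt x = src y),
    src (@comp n n.+1 dltS x y e) = src x;
  tgt_compS : forall n (x y : cell glob n.+1) (e : tgt x = src y),
    tgt (@comp n n.+1 dltS x y e) = tgt y;
  src_compW : forall m n (h : dlt m n) (x y : cell glob n.+1)
      (e : tgt_at (dltW h) x = src_at (dltW h) y)
      (e' : tgt_at h (src x) = src_at h (src y)),
    src (comp e) = comp e';
  tgt_compW : forall m n (h : dlt m n) (x y : cell glob n.+1)
      (e : tgt_at (dltW h) x = src_at (dltW h) y)
      (e' : tgt_at h (tgt x) = src_at h (tgt y)),
    tgt (comp e) = comp e';
  compA : forall m n (h : dlt m n) (x y z : cell glob n)
      (exy : tgt_at h x = src_at h y) (eyz : tgt_at h y = src_at h z)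
      (el : tgt_at h (comp exy) = src_at h z)
      (er : tgt_at h x = src_at h (comp eyz)),
    comp el = comp er;
  comp1l : forall m n (h : dlt m n) (x : cell glob n)
      (e : tgt_at h (unit_at unit1 h (src_at h x)) = src_at h x),
    comp e = x;
  comp1r : forall m n (h : dlt m n) (x : cell glob n)
      (e : tgt_at h x = src_at h (unit_at unit1 h (tgt_at h x))),
    comp e = x;
  unit_comp : forall m n (h : dlt m n) (x y : cell glob n)
      (e : tgt_at h x = src_at h y)
      (e' : tgt_at (dltW h) (unit1 x) = src_at (dltW h) (unit1 y)),
    unit1 (comp e) = comp e';
  interchange : forall l m n (h : dlt l m) (k : dlt m n)
      (x y z w : cell glob n)
      (exy : tgt_at k x = src_at k y) (ezw : tgt_at k z = src_at k w)
      (exz : tgt_at (dlt_trans h k) x = src_at (dlt_trans h k) z)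
      (eyw : tgt_at (dlt_trans h k) y = src_at (dlt_trans h k) w)
      (el : tgt_at (dlt_trans h k) (comp exy)
              = src_at (dlt_trans h k) (comp ezw))
      (er : tgt_at k (comp exz) = src_at k (comp eyw)),
    comp el = comp er }.

Arguments unit1 {o n} x.
Arguments comp {o m n} h x y e.

Record omegaFunctor (X Y : omegaCat) := OmegaFunctor {
  fmap :> globMap X Y;
  fmap_unit : forall n (x : cell X n),
    gmap fmap (unit1 x) = unit1 (gmap fmap x);
  fmap_comp : forall m n (h : dlt m n) (x y : cell X n)
      (e : tgt_at h x = src_at h y)
      (e' : tgt_at h (gmap fmap x) = src_at h (gmap fmap y)),
    gmap fmap (comp h x y e) = comp h (gmap fmap x) (gmap fmap y) e' }.

Definition joined (X : omegaCat) (P : forall n, cell X n.+1 -> Prop)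
    n (x y : cell X n) : Prop :=
  exists u : cell X n.+1, [/\ src u = x, tgt u = y & P n u].

(** The mutual coinduction between equivalence and reversibility is presented
    with equivalence, [joined reversible], inlined. *)
CoInductive reversible (X : omegaCat) (n : nat) (u : cell X n.+1) : Prop :=
| Reversible (v : cell X n.+1)
    (euv : tgt u = src v) (evu : tgt v = src u)
    (_ : joined (@reversible X) (comp dltS u v euv) (unit1 (src u)))
    (_ : joined (@reversible X) (comp dltS v u evu) (unit1 (tgt u))).

Definition omega_equiv (X : omegaCat) n (x y : cell X n) : Prop :=
  joined (@reversible X) x y.

Definition weak_equivalence (X Y : omegaCat) (f : omegaFunctor X Y) : Prop :=
  (forall y : cell Y 0, exists x : cell X 0, omega_equiv (gmap f x) y) /\
  (forall n (x x' : cell X n), parallel x x' ->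
     forall v : cell Y n.+1, src v = gmap f x -> tgt v = gmap f x' ->
     exists u : cell X n.+1,
       [/\ src u = x, tgt u = x' & omega_equiv (gmap f u) v]).

(** Below dimension [n], the [k]-cells are [false] (the source side) and
    [true] (the target side). *)
Definition sphere_cell (n k : nat) : Type := (bool * (k < n))%type.

Definition sphere_side (b : bool) n k (c : sphere_cell n k.+1) :
  sphere_cell n k := (b, ltnW c.2).

Lemma sphere_globular b n k (c d : sphere_cell n k.+1) :
  sphere_side b c = sphere_side b d.
Proof. by congr pair; apply: bool_irrelevance. Qed.

Definition sphere_glob (n : nat) : globSet :=
  @GlobSet (sphere_cell n) (@sphere_side false n) (@sphere_side true n)
    (fun _ _ => sphere_globular _ _ _) (fun _ _ => sphere_globular _ _ _).

(** The [n]-globe: one further cell, in dimension [k = n]. *)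
Definition globe_cell (n k : nat) : Type := (sphere_cell n k + (k = n))%type.

Definition eq_ltn k n (e : k.+1 = n) : k < n :=
  match e in _ = n return k < n with erefl => ltnSn k end.

Definition globe_side (b : bool) n k (c : globe_cell n k.+1) :
    globe_cell n k :=
  match c with
  | inl d => inl (sphere_side b d)
  | inr e => inl (b, eq_ltn e)
  end.

Lemma globe_globular b n k (c d : globe_cell n k.+1) :
  globe_side b c = globe_side b d.
Proof. by case: c => c; case: d => d; congr (inl (_, _)); apply: bool_irrelevance. Qed.

Definition globe_glob (n : nat) : globSet :=
  @GlobSet (globe_cell n) (@globe_side false n) (@globe_side true n)
    (fun _ _ => globe_globular _ _ _) (fun _ _ => globe_globular _ _ _).

Definition sphere_incl (n : nat) : globMap (sphere_glob n) (globe_glob n) :=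
  @GlobMap (sphere_glob n) (globe_glob n) (fun k c => inl c)
    (fun _ _ => erefl) (fun _ _ => erefl).

Definition is_free (G : globSet) (X : omegaCat) (eta : globMap G X) : Prop :=
  forall (Y : omegaCat) (phi : globMap G Y),
    (exists F : omegaFunctor X Y,
       forall n (c : cell G n), gmap F (gmap eta c) = gmap phi c) /\
    (forall F F' : omegaFunctor X Y,
       (forall n (c : cell G n),
          gmap F (gmap eta c) = gmap F' (gmap eta c)) ->
       forall n (x : cell X n), gmap F x = gmap F' x).

Definition morClass := forall X Y : omegaCat, omegaFunctor X Y -> Prop.

(** Free omega-categories being determined up to isomorphism, [genI] contains
    the inclusions [i_n : \partial O^n -> O^n] for all choices of the free
    omega-categories on the boundary and on the globe. *)
Definition genI : morClass := fun A B i =>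
  exists (n : nat) (eta : globMap (sphere_glob n) A)
    (theta : globMap (globe_glob n) B),
    [/\ is_free eta, is_free theta
      & forall k (c : cell (sphere_glob n) k),
          gmap i (gmap eta c) = gmap theta (gmap (sphere_incl n) c)].

(** Equality of omega-functors is stated cellwise. *)
Definition lifts (A B X Y : omegaCat)
    (i : omegaFunctor A B) (p : omegaFunctor X Y) : Prop :=
  forall (s : omegaFunctor A X) (t : omegaFunctor B Y),
    (forall n (a : cell A n), gmap p (gmap s a) = gmap t (gmap i a)) ->
    exists h : omegaFunctor B X,
      (forall n (a : cell A n), gmap h (gmap i a) = gmap s a) /\
      (forall n (b : cell B n), gmap p (gmap h b) = gmap t b).

Definition inj (K : morClass) : morClass := fun X Y p =>
  forall (A B : omegaCat) (i : omegaFunctor A B), K A B i -> lifts i p.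

Definition cof (K : morClass) : morClass := fun A B i =>
  forall (X Y : omegaCat) (p : omegaFunctor X Y), inj K p -> lifts i p.

Definition folk_cofibration : morClass := cof genI.

Definition folk_fibration : morClass :=
  inj (fun A B i => folk_cofibration i /\ weak_equivalence i).

Lemma unit_all_equal (a b : unit) : a = b.
Proof. by case: a; case: b. Qed.

Definition terminal_glob : globSet :=
  @GlobSet (fun _ => unit) (fun _ _ => tt) (fun _ _ => tt)
    (fun _ _ => erefl) (fun _ _ => erefl).

Definition terminal : omegaCat.
Proof.
by refine (@OmegaCat terminal_glob (fun _ _ => tt) (fun _ _ _ _ _ _ => tt)
  _ _ _ _ _ _ _ _ _ _ _); move=> *; apply: unit_all_equal.
Defined.

Definition to_terminal (X : omegaCat) : omegaFunctor X terminal :=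
  @OmegaFunctor X terminal
    (@GlobMap X terminal (fun _ _ => tt) (fun _ _ => erefl) (fun _ _ => erefl))
    (fun _ _ => erefl) (fun _ _ _ _ _ _ _ => erefl).

Lemma to_terminal_unique (X : omegaCat) (f : omegaFunctor X terminal)
  n (x : cell X n) : gmap f x = gmap (to_terminal X) x.
Proof. exact: unit_all_equal. Qed.

(* Main.v *)
(** It suffices to retract every trivial cofibration [i : A -> B].  Let [P] be
    the omega-category of pairs [(a, f)] of a cell [a] of [A] and a reversible
    cylinder [f] in [B] from [i a] to some cell [b].  The projection
    [(a, f) |-> b] is a trivial fibration: reversible cells can be divided by
    up to equivalence, so that the weak fullness of [i] lets one fill spheres of
    [P] over any cell of [B].  The cofibration [i] lifts against it: [id_B] and
    the trivial cylinders [A -> P] give [k : B -> P], and [k] followed by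
    [(a, f) |-> a] is a retraction of [i].

    Cylinders compose strictly.  A cylinder from [x] to [y] consists of
    1-dimensional sides [u : s_0 x -> s_0 y] and [u' : t_0 x -> t_0 y] and of a
    cylinder from [x *_0 u'] to [u *_0 y] one dimension higher, in the coproduct
    of all the hom omega-categories.  Composition along dimension 0 is
    [(x *_0 f') * (f *_0 y')], with [*] the concatenation of cylinders; all laws
    follow by coinduction from the functoriality of concatenation and of the
    action of cells on cylinders by whiskering. *)

From mathcomp Require Import all_boot zify.
From Stdlib Require Import ProofIrrelevance FunctionalExtensionality ClassicalEpsilon.
Require Import Defs.

Set Implicit Arguments.
Unset Strict Implicit.
Unset Printing Implicit Defensive.

(** * One-sorted omega-categories *)

(** A retraction [r] of [i] suffices because a map [s] on the source of [i] extends along [i] as [r]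
    followed by [s]; over the terminal object the other triangle is automatic. The obstacle is that
    [i] is full only up to equivalence, whereas a trivial fibration must lift cells on the nose. A
    cylinder reconciles the two: its bottom is prescribed exactly, its top is taken in the image of
    [i], and the discrepancy is stored in the side of highest dimension, which therefore has to be
    reversible. Lower sides get composed onto the top at each passage to the next hom, so filling
    needs division by them as well; hence all sides are reversible. A cylinder meets homs of every
    depth. With one carrier for all dimensions the depth is a mere number [d], passing to a hom
    leaves the carrier fixed, and equations between iterated composites need no transport between
    dimensions. *)

(** Cells of all dimensions share one carrier, an [n]-cell being a fixed point
    of [bd false n]; units disappear.  [bd false n] and [bd true n] are the
    [n]-source and the [n]-target.  Shifting all dimensions by one turns [C] into
    the coproduct of its homs.  Composition is total, and its laws are conditional
    on composability; otherwise its value is junk. *)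
Record osCat := OsCat {
  car :> Type;
  bd : bool -> nat -> car -> car;
  cmp : nat -> car -> car -> car;
  bd_lt : forall c c' i j x, i < j -> bd c i (bd c' j x) = bd c i x;
  bd_ge : forall c c' i j x, j <= i -> bd c i (bd c' j x) = bd c' j x;
  bd_cmp_lt : forall c i m x y, bd true m x = bd false m y -> i < m ->
    bd c i (cmp m x y) = bd c i x;
  src_cmp : forall m x y, bd true m x = bd false m y ->
    bd false m (cmp m x y) = bd false m x;
  tgt_cmp : forall m x y, bd true m x = bd false m y ->
    bd true m (cmp m x y) = bd true m y;
  bd_cmp_gt : forall c i m x y, bd true m x = bd false m y -> m < i ->
    bd c i (cmp m x y) = cmp m (bd c i x) (bd c i y);
  cmpA : forall m x y z, bd true m x = bd false m y -> bd true m y = bd false m z ->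
    cmp m (cmp m x y) z = cmp m x (cmp m y z);
  cmp1l : forall m x, cmp m (bd false m x) x = x;
  cmp1r : forall m x, cmp m x (bd true m x) = x;
  cmp_interchange : forall l m x y z w, l < m ->
    bd true m x = bd false m y -> bd true m z = bd false m w ->
    bd true l x = bd false l z ->
    cmp l (cmp m x y) (cmp m z w) = cmp m (cmp l x z) (cmp l y w) }.

Arguments bd {o} c i x.
Arguments cmp {o} m x y.

Lemma sig_eq (T : Type) (P : T -> Prop) (x y : {z | P z}) : sval x = sval y -> x = y.
Proof.
case: x => x px; case: y => y py /= e; subst y.
by rewrite (proof_irrelevance _ px py).
Qed.

(** * One-sorted omega-categories cut out by a predicate *)

Section SubOs.
Variables (D : Type) (ok : D -> Prop) (dbd : bool -> nat -> D -> D) (dcmp : nat -> D -> D -> D).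
Let dcomp m x y := dbd true m x = dbd false m y.
Hypothesis ok_bd : forall c i x, ok x -> ok (dbd c i x).
Hypothesis ok_cmp : forall m x y, ok x -> ok y -> dcomp m x y -> ok (dcmp m x y).
Hypothesis dbd_lt : forall c c' i j x, ok x -> i < j -> dbd c i (dbd c' j x) = dbd c i x.
Hypothesis dbd_ge : forall c c' i j x, ok x -> j <= i -> dbd c i (dbd c' j x) = dbd c' j x.
Hypothesis dbd_cmp_lt : forall c i m x y, ok x -> ok y -> dcomp m x y -> i < m ->
  dbd c i (dcmp m x y) = dbd c i x.
Hypothesis dsrc_cmp : forall m x y, ok x -> ok y -> dcomp m x y ->
  dbd false m (dcmp m x y) = dbd false m x.
Hypothesis dtgt_cmp : forall m x y, ok x -> ok y -> dcomp m x y ->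
  dbd true m (dcmp m x y) = dbd true m y.
Hypothesis dbd_cmp_gt : forall c i m x y, ok x -> ok y -> dcomp m x y -> m < i ->
  dbd c i (dcmp m x y) = dcmp m (dbd c i x) (dbd c i y).
Hypothesis dcmpA : forall m x y z, ok x -> ok y -> ok z -> dcomp m x y -> dcomp m y z ->
  dcmp m (dcmp m x y) z = dcmp m x (dcmp m y z).
Hypothesis dcmp1l : forall m x, ok x -> dcmp m (dbd false m x) x = x.
Hypothesis dcmp1r : forall m x, ok x -> dcmp m x (dbd true m x) = x.
Hypothesis dinterchange : forall l m x y z w, ok x -> ok y -> ok z -> ok w -> l < m ->
  dcomp m x y -> dcomp m z w -> dcomp l x z ->
  dcmp l (dcmp m x y) (dcmp m z w) = dcmp m (dcmp l x z) (dcmp l y w).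

Definition sub_bd c i (x : {z | ok z}) : {z | ok z} := exist ok _ (ok_bd c i (proj2_sig x)).

(** Composition has to be total, but a junk composite of two cells satisfying [ok] may violate [ok].
    Composability is therefore decided classically, with the first cell as default value. *)
Definition sub_cmp m (x y : {z | ok z}) : {z | ok z} :=
  match excluded_middle_informative (dcomp m (sval x) (sval y)) with
  | left e => exist ok _ (ok_cmp (proj2_sig x) (proj2_sig y) e)
  | right _ => x
  end.

Lemma sub_cmpE m x y : sub_bd true m x = sub_bd false m y ->
  sval (sub_cmp m x y) = dcmp m (sval x) (sval y).
Proof.
move=> /(congr1 sval) e; rewrite /sub_cmp.
by case: excluded_middle_informative.
Qed.

Lemma sub_cmp_val m x y : dbd true m (sval x) = dbd false m (sval y) ->
  sval (sub_cmp m x y) = dcmp m (sval x) (sval y).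
Proof. by move=> e; apply: sub_cmpE; apply: sig_eq. Qed.

(** The laws are assumed only on cells satisfying [ok]. This suits ambient types without such laws
    of their own: arbitrary families of cells, and pairs of a cell with an unconstrained
    cylinder. *)
Definition sub_os : osCat.
Proof.
refine (@OsCat {z | ok z} sub_bd sub_cmp _ _ _ _ _ _ _ _ _ _).
- by move=> c c' i j [x ox] h; apply: sig_eq; apply: dbd_lt.
- by move=> c c' i j [x ox] h; apply: sig_eq; apply: dbd_ge.
- move=> c i m [x ox] [y oy] e h; apply: sig_eq => /=; rewrite sub_cmpE //=.
  by apply: dbd_cmp_lt => //; apply: (congr1 sval e).
- move=> m [x ox] [y oy] e; apply: sig_eq => /=; rewrite sub_cmpE //=.
  by apply: dsrc_cmp => //; apply: (congr1 sval e).
- move=> m [x ox] [y oy] e; apply: sig_eq => /=; rewrite sub_cmpE //=.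
  by apply: dtgt_cmp => //; apply: (congr1 sval e).
- move=> c i m [x ox] [y oy] e h; have e' := congr1 sval e; rewrite /= in e'.
  apply: sig_eq; rewrite /= !sub_cmp_val //=; first exact: dbd_cmp_gt.
  by rewrite !dbd_lt.
- move=> m [x ox] [y oy] [z oz] /(congr1 sval)/= e /(congr1 sval)/= f.
  apply: sig_eq; rewrite !sub_cmp_val //= ?sub_cmp_val //=; first exact: dcmpA.
  + by rewrite dsrc_cmp.
  + by rewrite dtgt_cmp.
- by move=> m [x ox]; apply: sig_eq; rewrite sub_cmp_val //= ?dcmp1l // dbd_ge.
- by move=> m [x ox]; apply: sig_eq; rewrite sub_cmp_val //= ?dcmp1r // dbd_ge.
- move=> l m [x ox] [y oy] [z oz] [w ow] h /(congr1 sval)/= e /(congr1 sval)/= f /(congr1 sval)/= g.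
  (* Since [l < m], the [l]-boundary of [x] is that of its [m]-target, which is the [m]-source of
     [y]; likewise for [z] and [w]. So [y] and [w] inherit composability. *)
  have g' : dbd true l y = dbd false l w.
    rewrite -(dbd_lt true false oy h) -(dbd_lt false true ow h) -e dbd_lt // g.
    by rewrite dbd_lt // -(dbd_lt _ false ow h) -f dbd_lt.
  apply: sig_eq; rewrite !sub_cmp_val //= ?sub_cmp_val //=; first exact: dinterchange.
  + by rewrite !dbd_cmp_gt // e f.
  + by rewrite !dbd_cmp_lt.
Defined.

End SubOs.

Definition is_cell (C : osCat) n (x : C) := bd false n x = x.

(** * From one-sorted to many-sorted omega-categories *)

Section Typed.
Variable C : osCat.

Lemma is_cell_bd c n i (x : C) : i <= n -> is_cell n (bd c i x).
Proof. by move=> h; rewrite /is_cell bd_ge. Qed.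

Lemma is_cellE c n i (x : C) : is_cell n x -> n <= i -> bd c i x = x.
Proof. by move=> h le; rewrite -h bd_ge. Qed.

Lemma is_cell_le n i (x : C) : is_cell n x -> n <= i -> is_cell i x.
Proof. exact: is_cellE. Qed.

Definition tcell n := {x : C | is_cell n x}.

Definition typed_glob : globSet.
Proof.
refine (@GlobSet tcell
  (fun n x => exist _ (bd false n (sval x)) (is_cell_bd false (sval x) (leqnn n)))
  (fun n x => exist _ (bd true n (sval x)) (is_cell_bd true (sval x) (leqnn n))) _ _).
- by move=> n x; apply: sig_eq; rewrite /= !bd_lt.
- by move=> n x; apply: sig_eq; rewrite /= !bd_lt.
Defined.

Lemma dlt_lt m n : dlt m n -> m < n.
Proof. by elim=> [|k _ /leqW]. Qed.

Lemma val_src_at m n (h : dlt m n) (x : cell typed_glob n) :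
  sval (src_at h x) = bd false m (sval x).
Proof. by elim: h x => //= k h IH x; rewrite IH /= bd_lt // dlt_lt. Qed.

Lemma val_tgt_at m n (h : dlt m n) (x : cell typed_glob n) :
  sval (tgt_at h x) = bd true m (sval x).
Proof. by elim: h x => //= k h IH x; rewrite IH /= bd_lt // dlt_lt. Qed.

(** Units leave the underlying element unchanged, since an [n]-cell is also a fixed point in
    dimension [n.+1]. Each law of [typed] is thus a law of [C] once subset proofs are dropped by
    [sig_eq]. *)
Definition typed_unit n (x : cell typed_glob n) : cell typed_glob n.+1 :=
  exist _ (sval x) (is_cell_le (proj2_sig x) (leqnSn n)).

Lemma val_unit_at m n (h : dlt m n) (x : cell typed_glob m) :
  sval (unit_at typed_unit h x) = sval x.
Proof. by elim: h. Qed.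

Lemma typed_composable m n (h : dlt m n) (x y : cell typed_glob n) :
  tgt_at h x = src_at h y -> bd true m (sval x) = bd false m (sval y).
Proof. by move=> /(congr1 sval); rewrite val_src_at val_tgt_at. Qed.

Lemma is_cell_cmp m n (x y : C) : bd true m x = bd false m y -> m < n ->
  is_cell n x -> is_cell n y -> is_cell n (cmp m x y).
Proof. by move=> e h cx cy; rewrite /is_cell bd_cmp_gt // cx cy. Qed.

Definition typed_comp m n (h : dlt m n) (x y : cell typed_glob n)
    (e : tgt_at h x = src_at h y) : cell typed_glob n :=
  exist _ (cmp m (sval x) (sval y))
    (is_cell_cmp (typed_composable e) (dlt_lt h) (proj2_sig x) (proj2_sig y)).

Definition typed : omegaCat.
Proof.
refine (@OmegaCat typed_glob typed_unit typed_comp _ _ _ _ _ _ _ _ _ _ _).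
- by move=> n x; apply: sig_eq; apply: (is_cellE _ (proj2_sig x)).
- by move=> n x; apply: sig_eq; apply: (is_cellE _ (proj2_sig x)).
- by move=> n x y e; apply: sig_eq; apply: src_cmp; apply: (@typed_composable _ _ dltS).
- by move=> n x y e; apply: sig_eq; apply: tgt_cmp; apply: (@typed_composable _ _ dltS).
- by move=> m n h x y e e'; apply: sig_eq; apply: bd_cmp_gt (typed_composable e) (dlt_lt h).
- by move=> m n h x y e e'; apply: sig_eq; apply: bd_cmp_gt (typed_composable e) (dlt_lt h).
- by move=> m n h x y z e f el er; apply: sig_eq; apply: cmpA (typed_composable e) (typed_composable f).
- by move=> m n h x e; apply: sig_eq; rewrite /= val_unit_at val_src_at cmp1l.
- by move=> m n h x e; apply: sig_eq; rewrite /= val_unit_at val_tgt_at cmp1r.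
- by move=> m n h x y e e'; apply: sig_eq.
- move=> l m n h k x y z w exy ezw exz eyw el er; apply: sig_eq => /=.
  exact: cmp_interchange (dlt_lt h) (typed_composable exy) (typed_composable ezw)
    (typed_composable exz).
Defined.

End Typed.

(** * The one-sorted omega-category of an omega-category *)

(** Composites and iterated units take a witness of [dlt m n] as argument, and case analyses on
    dimensions produce different witnesses; uniqueness makes the results interchangeable. *)
Lemma dlt_irr m n (h k : dlt m n) : h = k.
Proof.
(* Inversion is phrased as a [match] on the upper dimension, so that it applies to a witness whose
   index is a successor; the equation [m = q] that remains is between naturals, hence
   proof-irrelevant. *)
have E p (l : dlt m p) : match p return dlt m p -> Prop with
    | 0 => fun _ => False
    | q.+1 => fun l => (exists e : m = q, l = ecast i (dlt m i.+1) e dltS) \/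
                       exists l' : dlt m q, l = dltW l'
    end l.
  by case: l => [|q l]; [left; exists erefl | right; exists l].
elim: h k => [|p h IH] k.
  case: (E _ k) => [[e ->]|[k' _]]; first by rewrite (eq_irrelevance e erefl).
  by have := dlt_lt k'; rewrite ltnn.
case: (E _ k) => [[e _]|[k' ->]]; last by rewrite (IH k').
by exfalso; subst p; have := dlt_lt h; rewrite ltnn.
Qed.


Lemma lt_dlt m n : m < n -> dlt m n.
Proof.
elim: n => // n IH; rewrite ltnS leq_eqVlt; case: (m =P n) => [-> _|_ h].
  exact: dltS.
exact: dltW (IH h).
Qed.

Definition dlt_or_ge m n : dlt m n + (n <= m) :=
  match ltnP m n with
  | LtnNotGeq h => inl (lt_dlt h)
  | GeqNotLtn h => inr h
  end.

Section OneSorted.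
Variable X : omegaCat.

(** A total composite keeps composability proofs out of rewriting. Under the composability
    hypotheses of the laws the default [x] is never reached. *)
Definition comp_or_left m n (h : dlt m n) (x y : cell X n) : cell X n :=
  match excluded_middle_informative (tgt_at h x = src_at h y) with
  | left e => comp h x y e
  | right _ => x
  end.

Lemma comp_or_leftE m n (h : dlt m n) (x y : cell X n) (e : tgt_at h x = src_at h y) :
  comp_or_left h x y = comp h x y e.
Proof.
rewrite /comp_or_left; case: excluded_middle_informative => // f.
by rewrite (proof_irrelevance _ e f).
Qed.

Lemma src_at_trans l m n (h : dlt l m) (k : dlt m n) (x : cell X n) :
  src_at (dlt_trans h k) x = src_at h (src_at k x).
Proof. by elim: k x => //= n' k IH x. Qed.

Lemma tgt_at_trans l m n (h : dlt l m) (k : dlt m n) (x : cell X n) :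
  tgt_at (dlt_trans h k) x = tgt_at h (tgt_at k x).
Proof. by elim: k x => //= n' k IH x. Qed.

Lemma unit_at_trans l m n (h : dlt l m) (k : dlt m n) (x : cell X l) :
  unit_at (@unit1 X) (dlt_trans h k) x = unit_at (@unit1 X) k (unit_at (@unit1 X) h x).
Proof. by elim: k => //= n' k ->. Qed.

Lemma src_at_unit_at m n (h : dlt m n) (x : cell X m) : src_at h (unit_at (@unit1 X) h x) = x.
Proof. by elim: h => /= [|n' h IH]; rewrite src_unit. Qed.

Lemma tgt_at_unit_at m n (h : dlt m n) (x : cell X m) : tgt_at h (unit_at (@unit1 X) h x) = x.
Proof. by elim: h => /= [|n' h IH]; rewrite tgt_unit. Qed.

Lemma src_at_dltW m n (h : dlt m n) (x : cell X n.+1) : src_at h (tgt x) = src_at h (src x).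
Proof. by case: h x => [|n' h] x /=; rewrite src_globular. Qed.

Lemma tgt_at_dltW m n (h : dlt m n) (x : cell X n.+1) : tgt_at h (tgt x) = tgt_at h (src x).
Proof. by case: h x => [|n' h] x /=; rewrite tgt_globular. Qed.

Lemma src_at_comp m n (h : dlt m n) (x y : cell X n) : tgt_at h x = src_at h y ->
  src_at h (comp_or_left h x y) = src_at h x.
Proof.
elim: h x y => [|n' h IH] x y e; rewrite comp_or_leftE /= ?src_compS //.
have e' : tgt_at h (src x) = src_at h (src y) by rewrite -tgt_at_dltW.
by rewrite (src_compW e e') -comp_or_leftE IH.
Qed.

Lemma tgt_at_comp m n (h : dlt m n) (x y : cell X n) : tgt_at h x = src_at h y ->
  tgt_at h (comp_or_left h x y) = tgt_at h y.
Proof.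
elim: h x y => [|n' h IH] x y e; rewrite comp_or_leftE /= ?tgt_compS //.
have e' : tgt_at h (tgt x) = src_at h (tgt y) by rewrite src_at_dltW.
by rewrite (tgt_compW e e') -comp_or_leftE IH.
Qed.

Lemma src_comp_or_left m n (h : dlt m n) (x y : cell X n.+1) :
  tgt_at (dltW h) x = src_at (dltW h) y ->
  src (comp_or_left (dltW h) x y) = comp_or_left h (src x) (src y).
Proof.
move=> e; have e' : tgt_at h (src x) = src_at h (src y) by rewrite -tgt_at_dltW.
by rewrite comp_or_leftE (src_compW e e') -comp_or_leftE.
Qed.

Lemma tgt_comp_or_left m n (h : dlt m n) (x y : cell X n.+1) :
  tgt_at (dltW h) x = src_at (dltW h) y ->
  tgt (comp_or_left (dltW h) x y) = comp_or_left h (tgt x) (tgt y).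
Proof.
move=> e; have e' : tgt_at h (tgt x) = src_at h (tgt y) by rewrite src_at_dltW.
by rewrite comp_or_leftE (tgt_compW e e') -comp_or_leftE.
Qed.

Lemma src_at_comp_trans l m n (h : dlt l m) (k : dlt m n) (x y : cell X n) :
  tgt_at (dlt_trans h k) x = src_at (dlt_trans h k) y ->
  src_at k (comp_or_left (dlt_trans h k) x y) = comp_or_left h (src_at k x) (src_at k y).
Proof.
elim: k x y => [|n' k IH] x y e /=; first by rewrite src_comp_or_left.
by rewrite src_comp_or_left // IH // -tgt_at_dltW.
Qed.

Lemma tgt_at_comp_trans l m n (h : dlt l m) (k : dlt m n) (x y : cell X n) :
  tgt_at (dlt_trans h k) x = src_at (dlt_trans h k) y ->
  tgt_at k (comp_or_left (dlt_trans h k) x y) = comp_or_left h (tgt_at k x) (tgt_at k y).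
Proof.
elim: k x y => [|n' k IH] x y e /=; first by rewrite tgt_comp_or_left.
by rewrite tgt_comp_or_left // IH // src_at_dltW.
Qed.

Lemma unit_at_comp l m n (h : dlt l m) (k : dlt m n) (x y : cell X m) :
  tgt_at h x = src_at h y ->
  unit_at (@unit1 X) k (comp_or_left h x y) =
  comp_or_left (dlt_trans h k) (unit_at (@unit1 X) k x) (unit_at (@unit1 X) k y).
Proof.
have U p (g : dlt l p) (x' y' : cell X p) : tgt_at g x' = src_at g y' ->
    unit1 (comp_or_left g x' y') = comp_or_left (dltW g) (unit1 x') (unit1 y').
  move=> e; have e' : tgt_at (dltW g) (unit1 x') = src_at (dltW g) (unit1 y').
    by rewrite /= tgt_unit src_unit.
  by rewrite (comp_or_leftE e) (comp_or_leftE e') unit_comp.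
move=> e; elim: k => [|n' k IH] /=; first exact: U.
by rewrite IH U // tgt_at_trans src_at_trans tgt_at_unit_at src_at_unit_at.
Qed.

(** A one-sorted cell is an infinite-dimensional globe: [F k false] and
    [F k true] are its [k]-source and its [k]-target.  An [n]-cell is represented
    by its iterated sources and targets below [n] and by its units above [n]. *)
Definition family := forall k, bool -> cell X k.

Definition globular (F : family) := forall k b,
  src (F k.+1 b) = F k false /\ tgt (F k.+1 b) = F k true.

(** The result must again be a globe and represent an [m]-cell, which forces both sides in dimension
    [m] to coincide and only units above; the lower boundaries of a source or target are those of
    the cell itself. *)
Definition fam_bd c m (F : family) : family := fun k b =>
  match dlt_or_ge m k with
  | inl h => unit_at (@unit1 X) h (F m c)
  | inr _ => if k == m then F k c else F k b
  end.

(** Up to dimension [m] a composite has the sources of its first factor and the targets of its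
    second. Strictly below [m] composable families agree, so the choice of factor matters only for
    [k = m]. *)
Definition fam_cmp m (F G : family) : family := fun k b =>
  match dlt_or_ge m k with
  | inl h => comp_or_left h (F k b) (G k b)
  | inr _ => if b then G k b else F k b
  end.

Lemma fam_bdE c m F k b (h : dlt m k) : fam_bd c m F k b = unit_at (@unit1 X) h (F m c).
Proof.
rewrite /fam_bd; case: dlt_or_ge => [h'|le]; first by rewrite (dlt_irr h' h).
by have := dlt_lt h; lia.
Qed.

Lemma fam_bd_eq c m F b : fam_bd c m F m b = F m c.
Proof.
rewrite /fam_bd; case: dlt_or_ge => [h|]; last by rewrite eqxx.
by have := dlt_lt h; lia.
Qed.

Lemma fam_bd_lt c m F k b : k < m -> fam_bd c m F k b = F k b.
Proof.
rewrite /fam_bd => lt; case: dlt_or_ge => [h|_]; first by have := dlt_lt h; lia.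
by case: eqP lt => // ->; rewrite ltnn.
Qed.

Lemma fam_cmpE m F G k b (h : dlt m k) : fam_cmp m F G k b = comp_or_left h (F k b) (G k b).
Proof.
rewrite /fam_cmp; case: dlt_or_ge => [h'|le]; first by rewrite (dlt_irr h' h).
by have := dlt_lt h; lia.
Qed.

Lemma fam_cmp_le m F G k b : k <= m -> fam_cmp m F G k b = if b then G k b else F k b.
Proof.
rewrite /fam_cmp => le; case: dlt_or_ge => // h.
by have := dlt_lt h; lia.
Qed.

Lemma fam_eq (F G : family) : (forall k b, F k b = G k b) -> F = G.
Proof.
by move=> e; apply: functional_extensionality_dep => k; apply: functional_extensionality.
Qed.

Lemma fam_composable m F G : fam_bd true m F = fam_bd false m G ->
  F m true = G m false /\ (forall k b, k < m -> F k b = G k b).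
Proof.
move=> e; split=> [|k b lt].
  by have := congr1 (fun H : family => H m true) e; rewrite !fam_bd_eq.
by have := congr1 (fun H : family => H k b) e; rewrite !fam_bd_lt.
Qed.

Lemma globular_src_at F m k b (h : dlt m k) : globular F -> src_at h (F k b) = F m false.
Proof. by move=> g; elim: h b => [|k' h IH] b /=; rewrite (g _ _).1 // IH. Qed.

Lemma globular_tgt_at F m k b (h : dlt m k) : globular F -> tgt_at h (F k b) = F m true.
Proof. by move=> g; elim: h b => [|k' h IH] b /=; rewrite (g _ _).2 // IH. Qed.

Lemma fam_composable_at m F G k b b' (h : dlt m k) : globular F -> globular G ->
  fam_bd true m F = fam_bd false m G -> tgt_at h (F k b) = src_at h (G k b').
Proof.
move=> gF gG /fam_composable[e _].
by rewrite globular_src_at // globular_tgt_at.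
Qed.

Lemma globular_bd c m F : globular F -> globular (fam_bd c m F).
Proof.
move=> g k b; case: (ltngtP k.+1 m) => [lt|gt|e].
- by rewrite !fam_bd_lt ?(ltnW lt) //; apply: g.
- move: gt; rewrite ltnS leq_eqVlt => /orP[/eqP e|lt].
    by subst k; rewrite (fam_bdE _ _ _ dltS) !fam_bd_eq /= src_unit tgt_unit.
  by rewrite (fam_bdE _ _ _ (dltW (lt_dlt lt))) !(fam_bdE _ _ _ (lt_dlt lt)) /= src_unit tgt_unit.
- by subst m; rewrite fam_bd_eq !fam_bd_lt //; apply: g.
Qed.

Lemma globular_cmp m F G : globular F -> globular G ->
  fam_bd true m F = fam_bd false m G -> globular (fam_cmp m F G).
Proof.
move=> gF gG eFG k b; have [e elt] := fam_composable eFG.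
case: (ltngtP k m) => [lt|gt|ek].
- rewrite !fam_cmp_le ?(ltnW lt) //= -(elt k true) //.
  by case: b; rewrite ?(gG _ _).1 ?(gG _ _).2 ?(gF _ _).1 ?(gF _ _).2 ?(elt k).
- rewrite (fam_cmpE _ _ _ (dltW (lt_dlt gt))) !(fam_cmpE _ _ _ (lt_dlt gt)).
  have c := fam_composable_at b b (dltW (lt_dlt gt)) gF gG eFG.
  by rewrite src_comp_or_left // tgt_comp_or_left // !(gF _ _).1 !(gF _ _).2 !(gG _ _).1 !(gG _ _).2.
- subst k; rewrite (fam_cmpE _ _ _ dltS) !fam_cmp_le //=.
  have c := fam_composable_at b b dltS gF gG eFG.
  by rewrite (comp_or_leftE c) src_compS tgt_compS (gF _ _).1 (gG _ _).2.
Qed.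


Lemma fam_bd_bd_lt c c' i j F : i < j -> fam_bd c i (fam_bd c' j F) = fam_bd c i F.
Proof.
move=> lt; apply: fam_eq => k b; case: (ltngtP k i) => [ki|ik|->].
- by rewrite !fam_bd_lt // (ltn_trans ki).
- by rewrite !(fam_bdE _ _ _ (lt_dlt ik)) fam_bd_lt.
- by rewrite !fam_bd_eq fam_bd_lt.
Qed.

Lemma fam_bd_bd_ge c c' i j F : j <= i -> fam_bd c i (fam_bd c' j F) = fam_bd c' j F.
Proof.
move=> le; apply: fam_eq => k b; case: (ltngtP k i) => [ki|ik|->].
- by rewrite fam_bd_lt.
- rewrite (fam_bdE _ _ _ (lt_dlt ik)); move: le; rewrite leq_eqVlt => /orP[/eqP ->|lt].
    by rewrite fam_bd_eq (fam_bdE _ _ _ (lt_dlt ik)).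
  rewrite (fam_bdE _ _ _ (lt_dlt lt)) (fam_bdE _ _ _ (lt_dlt (ltn_trans lt ik))).
  by rewrite -unit_at_trans; congr unit_at; apply: dlt_irr.
- rewrite fam_bd_eq; move: le; rewrite leq_eqVlt => /orP[/eqP ->|lt].
    by rewrite !fam_bd_eq.
  by rewrite !(fam_bdE _ _ _ (lt_dlt lt)).
Qed.

Lemma fam_bd_cmp_lt c i m F G : fam_bd true m F = fam_bd false m G -> i < m ->
  fam_bd c i (fam_cmp m F G) = fam_bd c i F.
Proof.
move=> /fam_composable[_ e] lt.
have E k b : k < m -> fam_cmp m F G k b = F k b.
  by move=> lt'; rewrite fam_cmp_le ?(ltnW lt') // e //; case: b.
apply: fam_eq => k b; case: (ltngtP k i) => [ki|ik|->].
- by rewrite !fam_bd_lt // E // (ltn_trans ki).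
- by rewrite !(fam_bdE _ _ _ (lt_dlt ik)) E.
- by rewrite !fam_bd_eq E.
Qed.

Lemma fam_bd_cmp_eq c m F G : fam_bd true m F = fam_bd false m G ->
  fam_bd c m (fam_cmp m F G) = if c then fam_bd c m G else fam_bd c m F.
Proof.
move=> /fam_composable[_ e].
apply: fam_eq => k b; case: (ltngtP k m) => [lt|gt|->].
- by rewrite fam_bd_lt // fam_cmp_le ?(ltnW lt) // e // if_same; case: c;
    rewrite !fam_bd_lt // e.
- by rewrite (fam_bdE _ _ _ (lt_dlt gt)) fam_cmp_le //; case: c; rewrite (fam_bdE _ _ _ (lt_dlt gt)).
- by rewrite fam_bd_eq fam_cmp_le //; case: c; rewrite fam_bd_eq.
Qed.

Lemma fam_bd_cmp_gt c i m F G : globular F -> globular G ->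
  fam_bd true m F = fam_bd false m G -> m < i ->
  fam_bd c i (fam_cmp m F G) = fam_cmp m (fam_bd c i F) (fam_bd c i G).
Proof.
move=> gF gG e lt; apply: fam_eq => k b; case: (ltngtP k i) => [ki|ik|->].
- rewrite fam_bd_lt // /fam_cmp !fam_bd_lt //.
- rewrite (fam_bdE _ _ _ (lt_dlt ik)) (fam_cmpE _ _ _ (lt_dlt lt)).
  rewrite (fam_cmpE _ _ _ (dlt_trans (lt_dlt lt) (lt_dlt ik))) !(fam_bdE _ _ _ (lt_dlt ik)).
  by rewrite unit_at_comp //; apply: fam_composable_at.
- by rewrite fam_bd_eq !(fam_cmpE _ _ _ (lt_dlt lt)) !fam_bd_eq.
Qed.

Lemma fam_cmpA m F G H : globular F -> globular G -> globular H ->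
  fam_bd true m F = fam_bd false m G -> fam_bd true m G = fam_bd false m H ->
  fam_cmp m (fam_cmp m F G) H = fam_cmp m F (fam_cmp m G H).
Proof.
move=> gF gG gH eFG eGH; apply: fam_eq => k b; case: (leqP k m) => [le|lt].
  by rewrite !fam_cmp_le //; case: b.
rewrite !(fam_cmpE _ _ _ (lt_dlt lt)).
have e := fam_composable_at b b (lt_dlt lt) gF gG eFG.
have f := fam_composable_at b b (lt_dlt lt) gG gH eGH.
have e' := e; rewrite -(src_at_comp f) in e'.
have f' := f; rewrite -(tgt_at_comp e) in f'.
rewrite (comp_or_leftE e') (comp_or_leftE f').
move: e' f'; rewrite (comp_or_leftE e) (comp_or_leftE f) => e' f'.
exact: compA.
Qed.

Lemma fam_cmp1l m F : globular F -> fam_cmp m (fam_bd false m F) F = F.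
Proof.
move=> gF; apply: fam_eq => k b; case: (ltngtP k m) => [lt|gt|->].
- by rewrite fam_cmp_le ?(ltnW lt) // fam_bd_lt // if_same.
- rewrite (fam_cmpE _ _ _ (lt_dlt gt)) (fam_bdE _ _ _ (lt_dlt gt)).
  rewrite -(globular_src_at b (lt_dlt gt) gF) comp_or_leftE ?tgt_at_unit_at // => e.
  exact: comp1l.
- by rewrite fam_cmp_le // fam_bd_eq; case: b.
Qed.

Lemma fam_cmp1r m F : globular F -> fam_cmp m F (fam_bd true m F) = F.
Proof.
move=> gF; apply: fam_eq => k b; case: (ltngtP k m) => [lt|gt|->].
- by rewrite fam_cmp_le ?(ltnW lt) // fam_bd_lt // if_same.
- rewrite (fam_cmpE _ _ _ (lt_dlt gt)) (fam_bdE _ _ _ (lt_dlt gt)).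
  rewrite -(globular_tgt_at b (lt_dlt gt) gF) comp_or_leftE ?src_at_unit_at // => e.
  exact: comp1r.
- by rewrite fam_cmp_le // fam_bd_eq; case: b.
Qed.

Lemma fam_interchange l m F G H K : globular F -> globular G -> globular H -> globular K ->
  l < m -> fam_bd true m F = fam_bd false m G -> fam_bd true m H = fam_bd false m K ->
  fam_bd true l F = fam_bd false l H ->
  fam_cmp l (fam_cmp m F G) (fam_cmp m H K) = fam_cmp m (fam_cmp l F H) (fam_cmp l G K).
Proof.
move=> gF gG gH gK lm eFG eHK eFH.
have eGK : fam_bd true l G = fam_bd false l K.
  rewrite -(fam_bd_bd_lt true false _ lm) -eFG fam_bd_bd_lt // eFH.
  by rewrite -(fam_bd_bd_lt false true _ lm) eHK fam_bd_bd_lt.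
(* Only the components above [m] use the interchange law of [X]; up to [m] the [m]-compositions
   merely select a factor. *)
apply: fam_eq => k b; case: (leqP k m) => [km|mk].
  rewrite [RHS]fam_cmp_le //; case: (leqP k l) => [kl|lk].
    by rewrite !fam_cmp_le //; case: b.
  by rewrite !(fam_cmpE _ _ _ (lt_dlt lk)) !fam_cmp_le //; case: b.
have lk := ltn_trans lm mk.
set h := lt_dlt lm; set k' := lt_dlt mk.
rewrite (fam_cmpE _ _ _ (dlt_trans h k')) !(fam_cmpE _ _ _ k') !(fam_cmpE _ _ _ (dlt_trans h k')).
have fg := fam_composable_at b b k' gF gG eFG.
have hk := fam_composable_at b b k' gH gK eHK.
have fh := fam_composable_at b b (dlt_trans h k') gF gH eFH.
have gk := fam_composable_at b b (dlt_trans h k') gG gK eGK.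
have e1 : tgt_at (dlt_trans h k') (comp k' _ _ fg) = src_at (dlt_trans h k') (comp k' _ _ hk).
  rewrite tgt_at_trans src_at_trans -!comp_or_leftE tgt_at_comp // src_at_comp //.
  rewrite -tgt_at_trans -src_at_trans globular_tgt_at // globular_src_at //.
  by rewrite -((fam_composable eFG).2 _ _ lm) (fam_composable eFH).1.
have e2 : tgt_at k' (comp (dlt_trans h k') _ _ fh) = src_at k' (comp (dlt_trans h k') _ _ gk).
  by rewrite -!comp_or_leftE tgt_at_comp_trans // src_at_comp_trans // fg hk.
rewrite (comp_or_leftE fg) (comp_or_leftE hk) (comp_or_leftE fh) (comp_or_leftE gk).
by rewrite (comp_or_leftE e1) (comp_or_leftE e2) interchange.
Qed.

Definition one_sorted : osCat :=
  sub_os (@globular_bd) (@globular_cmp) (fun c c' i j x _ => @fam_bd_bd_lt c c' i j x)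
    (fun c c' i j x _ => @fam_bd_bd_ge c c' i j x)
    (fun c i m x y _ _ => @fam_bd_cmp_lt c i m x y)
    (fun m x y _ _ => @fam_bd_cmp_eq false m x y)
    (fun m x y _ _ => @fam_bd_cmp_eq true m x y)
    (@fam_bd_cmp_gt) (@fam_cmpA) (@fam_cmp1l) (@fam_cmp1r) (@fam_interchange).

End OneSorted.

(** * Reversible cells *)

Section Reversible.
Variable C : osCat.
Implicit Types (x y u v a b : C) (Q : nat -> C -> Prop).

(** As for [reversible], the index [k] of a reversible cell is the dimension of
    its source and target. *)
Definition linked Q k x y := exists a, [/\ Q k a, bd false k a = x & bd true k a = y].

Definition rev_step Q k u := is_cell k.+1 u /\ exists v,
  [/\ is_cell k.+1 v, bd true k u = bd false k v, bd true k v = bd false k u,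
      linked Q k.+1 (cmp k u v) (bd false k u) & linked Q k.+1 (cmp k v u) (bd true k u)].

CoInductive rev k u : Prop := Rev of rev_step rev k u.

Lemma linked_mono Q Q' k x y : (forall a, Q k a -> Q' k a) -> linked Q k x y -> linked Q' k x y.
Proof. by move=> QQ' [a [qa ea fa]]; exists a; split; auto. Qed.

(** The recursive occurrences of [rev] sit under the existentials of [linked]; unpacking these
    before the corecursive calls keeps [cofix] guarded. Later proofs only exhibit a class [Q]. *)
Lemma rev_coind Q : (forall k u, Q k u -> rev_step Q k u) -> forall k u, Q k u -> rev k u.
Proof.
move=> H; cofix CH => k u /H[cu [v [cv e f [a [qa ea fa]] [b [qb eb fb]]]]].
constructor; split=> //; exists v; split=> //.
  by exists a; split=> //; apply: CH.
by exists b; split=> //; apply: CH.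
Qed.

(** A [k]-cell is its own unit in dimension [k.+1], so [closed_unit] says that units belong to [Q].
    The class is left arbitrary because the consequences for [linked] serve twice: for
    [rev_closure], and then for [rev]. *)
Record rev_closed Q : Prop := RevClosed {
  closed_cell : forall k u, Q k u -> is_cell k.+1 u;
  closed_unit : forall k x, is_cell k x -> Q k x;
  closed_cmp : forall m k u v, m <= k -> bd true m u = bd false m v ->
    Q k u -> Q k v -> Q k (cmp m u v) }.

Section Closed.
Variables (Q : nat -> C -> Prop) (cQ : rev_closed Q).

Lemma linked_refl k x : is_cell k x -> linked Q k x x.
Proof.
by move=> cx; exists x; split; [exact: closed_unit | exact: is_cellE cx _ | exact: is_cellE cx _].
Qed.

Lemma linked_trans k x y z : linked Q k x y -> linked Q k y z -> linked Q k x z.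
Proof.
move=> [a [qa ea fa]] [b [qb eb fb]]; have e : bd true k a = bd false k b by rewrite fa.
by exists (cmp k a b); split; [exact: closed_cmp | rewrite src_cmp | rewrite tgt_cmp].
Qed.

Lemma linked_cmp m k x y x' y' : m < k -> bd true m x = bd false m x' ->
  linked Q k x y -> linked Q k x' y' -> linked Q k (cmp m x x') (cmp m y y').
Proof.
move=> lt e [a [qa ea fa]] [b [qb eb fb]].
have e' : bd true m a = bd false m b by rewrite -(bd_lt true false a lt) ea e -eb bd_lt.
by exists (cmp m a b); split; [apply: closed_cmp => //; apply: ltnW|rewrite bd_cmp_gt // ea eb|
  rewrite bd_cmp_gt // fa fb].
Qed.

End Closed.

(** Closure of [rev] under composition is proved by coinduction up to this
    closure, whose generators of composite form have the evident inverses. *)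
Inductive rev_closure : nat -> C -> Prop :=
| closure_rev k u : rev k u -> rev_closure k u
| closure_unit k x : is_cell k x -> rev_closure k x
| closure_cmp m k u v : m <= k -> bd true m u = bd false m v ->
    rev_closure k u -> rev_closure k v -> rev_closure k (cmp m u v).

Lemma rev_closure_closed : rev_closed rev_closure.
Proof.
split; [|exact: closure_unit|exact: closure_cmp].
move=> k u; elim=> {k u} [k u [[]] //|k x cx|m k u v le e _ IHu _ IHv].
  exact: is_cell_le cx _.
exact: is_cell_cmp.
Qed.

Lemma rev_closure_step k u : rev_closure k u -> rev_step rev_closure k u.
Proof.
have cl := rev_closure_closed.
elim=> {k u} [k u [[cu [v [cv e f l r]]]]|k x cx|m k u v le e _ IHu _ IHv].
- by split=> //; exists v; split=> //; apply: linked_mono; first [exact: l | exact: r |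
    move=> a; apply: closure_rev].
- have E c : bd c k x = x by apply: is_cellE cx _.
  have cx' : is_cell k.+1 x by apply: is_cell_le cx _.
  split=> //; exists x; rewrite !E; split=> //.
    by rewrite -[X in cmp _ X _](E false) cmp1l; apply: linked_refl.
  by rewrite -[X in cmp _ X _](E false) cmp1l; apply: linked_refl.
case: IHu => cu [u' [cu' e1 e2 lu ru]]; case: IHv => cv [v' [cv' f1 f2 lv rv]].
split; first exact: is_cell_cmp.
move: le; rewrite leq_eqVlt => /orP[/eqP ?|lt].
  (* For [m = k] the inverse is the reversed composite, and [u * v * v' * u'] contracts from the
     inside: first [v * v'], then [u * u']. The links compose because the closure is closed. *)
  subst m; have g : bd true k v' = bd false k u' by rewrite f2 -e.
  exists (cmp k v' u'); rewrite !src_cmp // !tgt_cmp //; split=> //.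
  - exact: is_cell_cmp.
  - apply: (linked_trans cl) lu; rewrite cmpA //; last by rewrite src_cmp.
    rewrite -(cmpA f1) //.
    apply: (linked_cmp cl) => //; first by rewrite src_cmp ?src_cmp // tgt_cmp.
      exact: linked_refl.
    rewrite -[X in linked _ _ _ X](cmp1l k u'); apply: (linked_cmp cl) => //.
    + by rewrite tgt_cmp.
    + by rewrite -e1 e.
    + exact: linked_refl.
  - apply: (linked_trans cl) rv; rewrite cmpA //; last by rewrite src_cmp.
    rewrite -(cmpA e2) //.
    apply: (linked_cmp cl) => //; first by rewrite src_cmp ?src_cmp // tgt_cmp.
      exact: linked_refl.
    rewrite -[X in linked _ _ _ X](cmp1l k v); apply: (linked_cmp cl) => //.
    + by rewrite tgt_cmp.
    + by rewrite -e.
    + exact: linked_refl.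
(* For [m < k] inverses are taken factorwise: interchange turns the [k]-composite of [u *_m v] and
   [u' *_m v'] into the [m]-composite of [u *_k u'] and [v *_k v']. *)
have g : bd true m u' = bd false m v'.
  by rewrite -(bd_lt true true u' lt) e2 bd_lt // e -(bd_lt false true v' lt) f2 bd_lt.
exists (cmp m u' v'); rewrite !bd_cmp_gt // e1 f1 e2 f2; split=> //.
- by apply: is_cell_cmp => //; apply: ltnW.
- rewrite -cmp_interchange //; apply: (linked_cmp cl) => //; first exact: ltnW.
  by rewrite !bd_cmp_lt.
- rewrite -cmp_interchange // -e1 -f1; apply: (linked_cmp cl) => //; first exact: ltnW.
  by rewrite !bd_cmp_lt.
Qed.

Lemma rev_closureP k u : rev_closure k u -> rev k u.
Proof. exact: (rev_coind (@rev_closure_step)). Qed.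

Lemma rev_closedP : rev_closed rev.
Proof.
split=> [k u [[]] // |k x cx|m k u v le e ru rv].
  exact/rev_closureP/closure_unit.
by apply/rev_closureP/closure_cmp => //; apply: closure_rev.
Qed.

Definition equiv := linked rev.

Lemma equiv_refl k x : is_cell k x -> equiv k x x.
Proof. exact: linked_refl rev_closedP _ _. Qed.

Lemma equiv_trans k x y z : equiv k x y -> equiv k y z -> equiv k x z.
Proof. exact: linked_trans rev_closedP _ _ _ _. Qed.

Lemma equiv_cmp m k x y x' y' : m < k -> bd true m x = bd false m x' ->
  equiv k x y -> equiv k x' y' -> equiv k (cmp m x x') (cmp m y y').
Proof. exact: linked_cmp rev_closedP _ _ _ _ _ _. Qed.

(** The coinductive definition records only that the inverse is a cell, but the conditions are
    symmetric in a cell and its inverse, so the inverse is reversible too. *)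
Lemma rev_inv k u : rev k u -> exists v, [/\ rev k v, bd true k u = bd false k v,
  bd true k v = bd false k u, equiv k.+1 (cmp k u v) (bd false k u)
  & equiv k.+1 (cmp k v u) (bd true k u)].
Proof.
move=> [[cu [v [cv e f l r]]]]; exists v; split=> //.
by constructor; split=> //; exists u; split; rewrite -?e ?f.
Qed.

Lemma equiv_sym k x y : equiv k x y -> equiv k y x.
Proof.
by move=> [a [/rev_inv[b [rb e f _ _]] <- <-]]; exists b; split.
Qed.

End Reversible.

(** * Opposites; cancellation and division by reversible cells *)

Lemma bd_le (C : osCat) c i j (x : C) : i <= j -> bd c i (bd c j x) = bd c i x.
Proof. by rewrite leq_eqVlt => /orP[/eqP ->|lt]; [rewrite bd_ge | rewrite bd_lt]. Qed.

(** All dimensions are reversed at once. Cancellation and division switch between right and left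
    each time the depth grows, and this duality lets one statement serve both sides. *)
Definition op (C : osCat) : osCat.
Proof.
refine (@OsCat C (fun c => bd (~~ c)) (fun m x y => cmp m y x) _ _ _ _ _ _ _ _ _ _).
- by move=> c c' i j x; apply: bd_lt.
- by move=> c c' i j x; apply: bd_ge.
- move=> c i m x y /= e lt; rewrite bd_cmp_lt //.
  by rewrite -(bd_lt _ true y lt) -e bd_lt.
- by move=> m x y /= e; apply: tgt_cmp.
- by move=> m x y /= e; apply: src_cmp.
- by move=> c i m x y /= e lt; rewrite bd_cmp_gt.
- by move=> m x y z /= e f; rewrite cmpA.
- by move=> m x; apply: cmp1r.
- by move=> m x; apply: cmp1l.
- move=> l m x y z w lt /= e f g; apply: cmp_interchange => //.
  rewrite -(bd_lt true true w lt) -f bd_lt // -g.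
  by rewrite -(bd_lt false true y lt) -e bd_lt.
Defined.

Lemma is_cell_op (C : osCat) n (x : C) : @is_cell (op C) n x <-> is_cell n x.
Proof. by rewrite /is_cell /=; split=> e; rewrite -e bd_ge. Qed.

Lemma rev_op (C : osCat) k (u : C) : rev k u -> @rev (op C) k u.
Proof.
move: k u; apply: (@rev_coind (op C) (@rev C)) => k u ru.
have [v [rv e f l r]] := rev_inv ru.
have [a [ra ea fa]] := equiv_sym l; have [b [rb eb fb]] := equiv_sym r.
split; first exact/is_cell_op/(closed_cell (rev_closedP C)).
exists v; split=> //=; first exact/is_cell_op/(closed_cell (rev_closedP C)).
  by exists b.
by exists a.
Qed.

Lemma rev_op_inv (C : osCat) k (u : C) : @rev (op C) k u -> rev k u.
Proof.
move: k u; apply: (@rev_coind C (@rev (op C))) => k u ru.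
have [v [rv e f l r]] := rev_inv ru.
have [a [ra ea fa]] := equiv_sym l; have [b [rb eb fb]] := equiv_sym r.
split; first exact/is_cell_op/(closed_cell (rev_closedP (op C))).
exists v; split=> //=; first exact/is_cell_op/(closed_cell (rev_closedP (op C))).
  by exists b.
by exists a.
Qed.

(** The order of [x] and [y] is kept because equivalence is symmetric. *)
Lemma equiv_op (C : osCat) k (x y : C) : @equiv (op C) k x y <-> equiv k x y.
Proof.
split=> [[a [ra ea fa]]|/equiv_sym[a [ra ea fa]]].
  by apply: equiv_sym; exists a; split=> //; apply: rev_op_inv.
by exists a; split=> //; apply: rev_op.
Qed.

(** Naturality of whiskering by [a : u *_d v -> 1]: it trades whiskering by
    [u *_d v] for composition with reversible cells one dimension higher, on which
    cancellation and division proceed by induction. *)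
Lemma whisker_natural (C : osCat) d (a f : C) :
  is_cell d (bd true d.+1 a) -> bd true d f = bd true d.+1 a ->
  cmp d.+1 (cmp d f (bd false d.+1 a)) (cmp d (bd true d.+1 f) a) =
  cmp d.+1 (cmp d (bd false d.+1 f) a) f.
Proof.
move=> ce e.
have sa : bd false d a = bd true d f.
  by rewrite e -(bd_lt false true a (ltnSn d)) (is_cellE _ ce).
have ta : bd false d (bd true d.+1 a) = bd true d f by rewrite e (is_cellE _ ce).
have E : f = cmp d f (bd true d.+1 a) by rewrite -e cmp1r.
rewrite -cmp_interchange ?(bd_lt _ _ _ (ltnSn d)) ?(bd_ge _ _ _ (leqnn d.+1)) // ?sa //.
rewrite cmp1r cmp1l {3}E.
by rewrite -cmp_interchange ?(bd_lt _ _ _ (ltnSn d)) ?(bd_ge _ _ _ (leqnn d.+1)) // ?sa // cmp1l cmp1r.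
Qed.

Lemma whisker_composable (C : osCat) d (a h : C) : bd true d h = bd false d a ->
  bd true d.+1 (cmp d h (bd false d.+1 a)) = bd false d.+1 (cmp d (bd true d.+1 h) a).
Proof.
by move=> e; rewrite !bd_cmp_gt // ?(bd_lt _ _ _ (ltnSn d)) // !(bd_ge _ _ _ (leqnn d.+1)).
Qed.

(** In the lowest dimension, compose with an inverse [v] and contract [u *_d v]. Above it,
    naturality of [a : u *_d v -> 1] shows that [f *_d u *_d v] followed by a reversible cell equals
    a reversible [B] followed by [f], and similarly for [g] with the same two cells. It remains to
    cancel [B] on the left along [d.+1], which is the induction hypothesis in the opposite. *)
Lemma cancel_right p (C : osCat) d (u f g : C) :
  rev d u -> is_cell (p + d).+1 f -> is_cell (p + d).+1 g ->
  (forall c, bd c (p + d) f = bd c (p + d) g) -> bd true d f = bd false d u ->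
  equiv (p + d).+1 (cmp d f u) (cmp d g u) -> equiv (p + d).+1 f g.
Proof.
elim: p C d u f g => [|p IH] C d u f g ru cf cg par e fu_gu.
  rewrite !add0n in cf cg par fu_gu *.
  have [v [rv uv vu [a [ra ea fa]] _]] := rev_inv ru.
  have cv := closed_cell (rev_closedP C) rv.
  have eg : bd true d g = bd false d u by rewrite -par.
  have K h : is_cell d.+1 h -> bd true d h = bd false d u ->
      equiv d.+1 (cmp d (cmp d h u) v) h.
    move=> ch eh; rewrite cmpA // -[X in equiv _ _ X](cmp1r d h) eh.
    apply: equiv_cmp => //; first by rewrite src_cmp.
      exact: equiv_refl.
    by exists a.
  apply: equiv_trans (K g cg eg); apply: equiv_trans (equiv_sym (K f cf e)) _.
  apply: equiv_cmp => //; first by rewrite tgt_cmp.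
  exact: equiv_refl.
(* The depth rises by one and [p] drops by one, so the dimension of [f] and [g] is unchanged. *)
have left (B : C) : rev d.+1 B -> bd true d.+1 B = bd false d.+1 f ->
    equiv (p.+1 + d).+1 (cmp d.+1 B f) (cmp d.+1 B g) -> equiv (p.+1 + d).+1 f g.
  move=> rB eB /equiv_op Bfg; apply/equiv_op.
  rewrite addSnnS in cf cg par Bfg *.
  apply: (IH (op C) d.+1 B) => //=; first exact: rev_op.
  - exact/is_cell_op.
  - exact/is_cell_op.
have [v [rv uv vu [a [ra ea fa]] _]] := rev_inv ru.
have cv := closed_cell (rev_closedP C) rv; have ca := closed_cell (rev_closedP C) ra.
have cu := closed_cell (rev_closedP C) ru.
have sp : bd false d.+1 f = bd false d.+1 g.
  have := par false; case: (posnP p) => [->|p0]; first by rewrite add1n.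
  have lt : d.+1 < p.+1 + d by lia.
  by move=> /(congr1 (bd false d.+1)); rewrite !bd_lt.
have tp : bd true d.+1 f = bd true d.+1 g.
  have := par true; case: (posnP p) => [->|p0]; first by rewrite add1n.
  have lt : d.+1 < p.+1 + d by lia.
  by move=> /(congr1 (bd true d.+1)); rewrite !bd_lt.
have eg : bd true d g = bd false d u.
  by rewrite -(bd_lt true true g (ltnSn d)) -tp bd_lt.
have sa : bd false d a = bd false d u by rewrite -(bd_lt false false a (ltnSn d)) ea src_cmp.
have N h : bd true d h = bd false d u ->
    cmp d.+1 (cmp d (cmp d h u) v) (cmp d (bd true d.+1 h) a) = cmp d.+1 (cmp d (bd false d.+1 h) a) h.
  move=> eh; rewrite cmpA // -ea whisker_natural // fa //.
  by rewrite /is_cell bd_ge.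
have ctf c : is_cell d.+2 (bd c d.+1 f) by exact: is_cell_bd.
apply: (left (cmp d (bd false d.+1 f) a)).
- apply: (closed_cmp (rev_closedP C)) => //; first by rewrite bd_lt // e.
  by apply: closed_unit (rev_closedP C) _ _ _; exact: is_cell_bd.
- rewrite bd_cmp_gt // ?fa; last by rewrite bd_lt // e sa.
  by rewrite bd_ge // -e -(bd_lt true false f (ltnSn d)) cmp1r.
- rewrite -N // sp -N // tp.
  apply: equiv_cmp => //; first lia.
  + by rewrite -tp cmpA // -ea whisker_composable // sa.
  + apply: equiv_cmp => //; first lia.
      by rewrite tgt_cmp.
    by apply: equiv_refl; apply: is_cell_le cv _; lia.
  + apply: equiv_refl; apply: is_cell_cmp; rewrite ?bd_lt ?eg //; first lia.
      by apply: is_cell_bd; lia.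
    by apply: is_cell_le ca _; lia.
Qed.

(** Whiskering [w] by an inverse [v] and correcting its target by [A] gives [g]. A cell [w0] such
    that [B] followed by [w0] is equivalent to [g] is a quotient: by naturality [B] followed by [w0]
    is [w0 *_d u *_d v] followed by [A], after which [A] and [v] are cancelled. Finding [w0] is a
    division of [g] by [B] on the left, at depth [d.+1]. *)
Lemma divide_right p (C : osCat) d (u x x' w : C) :
  rev d u -> is_cell (p.+1 + d) x -> is_cell (p.+1 + d) x' ->
  (forall c, bd c (p + d) x = bd c (p + d) x') -> bd true d x = bd false d u ->
  is_cell (p.+1 + d).+1 w -> bd false (p.+1 + d) w = cmp d x u ->
  bd true (p.+1 + d) w = cmp d x' u ->
  exists w0, [/\ is_cell (p.+1 + d).+1 w0, bd false (p.+1 + d) w0 = x,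
    bd true (p.+1 + d) w0 = x' & equiv (p.+1 + d).+1 (cmp d w0 u) w].
Proof.
elim/ltn_ind: p C d u x x' w => p IH C d u x x' w ru cx cx' par e cw sw tw.
have [v [rv uv vu [a [ra ea fa]] _]] := rev_inv ru.
have cv := closed_cell (rev_closedP C) rv; have ca := closed_cell (rev_closedP C) ra.
have cu := closed_cell (rev_closedP C) ru.
have e' : bd true d x' = bd false d u.
  by rewrite -(bd_le true x' (leq_addl p d)) -par bd_le ?leq_addl.
have sa : bd false d a = bd false d u by rewrite -(bd_lt false false a (ltnSn d)) ea src_cmp.
have ta : bd true d a = bd false d u by rewrite -(bd_lt true true a (ltnSn d)) fa bd_ge.
have cta : is_cell d (bd true d.+1 a) by rewrite fa; apply: is_cell_bd.
have edw : bd true d w = bd true d u.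
  by rewrite -(bd_le true w (j := p.+1 + d)) ?tw ?tgt_cmp //; lia.
(* Whiskerings of [a : u *_d v -> 1]: [A] contracts [u *_d v] next to the target of [x'], and [B]
   next to the source of [x]. *)
pose A := cmp d (bd true d.+1 x') a; pose B := cmp d (bd false d.+1 x) a.
have edx : bd true d (bd false d.+1 x) = bd false d a by rewrite bd_lt // e.
have edx' : bd true d (bd true d.+1 x') = bd false d a by rewrite bd_lt // e'.
have sA : bd false d.+1 A = cmp d (bd true d.+1 x') (cmp d u v).
  by rewrite bd_cmp_gt // ea bd_ge.
have sB : bd false d.+1 B = cmp d (bd false d.+1 x) (cmp d u v).
  by rewrite bd_cmp_gt // ea bd_ge.
have tA : bd true d.+1 A = bd true d.+1 x'.
  by rewrite bd_cmp_gt // bd_ge // fa -e' -(bd_lt true true x' (ltnSn d)) cmp1r.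
have tB : bd true d.+1 B = bd false d.+1 x.
  by rewrite bd_cmp_gt // bd_ge // fa -e -(bd_lt true false x (ltnSn d)) cmp1r.
have rA : rev d.+1 A.
  apply: (closed_cmp (rev_closedP C)) => //.
  by apply: closed_unit (rev_closedP C) _ _ _; exact: is_cell_bd.
have rB : rev d.+1 B.
  apply: (closed_cmp (rev_closedP C)) => //.
  by apply: closed_unit (rev_closedP C) _ _ _; exact: is_cell_bd.
have cA := closed_cell (rev_closedP C) rA; have cB := closed_cell (rev_closedP C) rB.
have cmpg : bd true d.+1 (cmp d w v) = bd false d.+1 A.
  rewrite bd_cmp_gt ?edw // sA (is_cellE _ cv) // -(bd_le true w (j := p.+1 + d)); last lia.
  rewrite tw bd_cmp_gt // (is_cellE _ cu) // cmpA //.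
  by rewrite bd_lt // e'.
pose g := cmp d.+1 (cmp d w v) A.
have cwv : is_cell (p.+1 + d).+1 (cmp d w v).
  by apply: is_cell_cmp => //; rewrite ?edw //; [lia|apply: is_cell_le cv _; lia].
have cg : is_cell (p.+1 + d).+1 g.
  by apply: is_cell_cmp => //; [lia|apply: is_cell_le cA _; lia].
have swv c : bd c (p.+1 + d) (cmp d w v) = cmp d (cmp d (if c then x' else x) u) v.
  by rewrite bd_cmp_gt ?edw //; [case: c; rewrite ?sw ?tw (is_cellE _ cv) //; lia|lia].
suff [w0 [cw0 sw0 tw0 /equiv_sym w0g]] : exists w0, [/\ is_cell (p.+1 + d).+1 w0, bd false (p.+1 + d) w0 = x,
    bd true (p.+1 + d) w0 = x' & equiv (p.+1 + d).+1 (cmp d.+1 B w0) g].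
  exists w0; split=> //.
  have s0 : bd false d.+1 w0 = bd false d.+1 x.
    by rewrite -sw0 bd_le //; lia.
  have t0 : bd true d.+1 w0 = bd true d.+1 x'.
    by rewrite -tw0 bd_le //; lia.
  have t0' : bd true d w0 = bd false d u by rewrite -(bd_lt true true w0 (ltnSn d)) t0 bd_lt.
  have cw0u : is_cell (p.+1 + d).+1 (cmp d w0 u).
    by apply: is_cell_cmp => //; [lia|apply: is_cell_le cu _; lia].
  have bw0u c : bd c (p.+1 + d) (cmp d w0 u) = cmp d (if c then x' else x) u.
    by rewrite bd_cmp_gt //; [case: c; rewrite ?sw0 ?tw0 (is_cellE _ cu) //; lia|lia].
  apply: (@cancel_right p.+1 C d v) => //.
  - by move=> c; rewrite bw0u; case: c; rewrite ?sw ?tw.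
  - by rewrite tgt_cmp.
  rewrite addSnnS in cw cw0u cwv cw0 w0g bw0u swv *.
  apply: (@cancel_right p C d.+1 A) => //.
  - by apply: is_cell_cmp => //; rewrite ?tgt_cmp //; [lia|apply: is_cell_le cv _; lia].
  - move=> c; rewrite swv bd_cmp_gt ?tgt_cmp //; last lia.
    by rewrite bw0u (is_cellE _ cv) //; lia.
  - by rewrite cmpA // -ea whisker_composable ?sa // t0.
  - apply: equiv_sym; apply: (equiv_trans w0g).
    rewrite cmpA // -ea {1}/A -t0 whisker_natural ?t0' -?fa //.
    rewrite s0; apply: equiv_refl; apply: is_cell_cmp => //; first by rewrite tB s0.
      lia.
    by apply: is_cell_le cB _; lia.
(* For [p = 0] the cell [x] is its own [d.+1]-source, so [B] goes from [x *_d u *_d v] to [x], and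
   an inverse of [B] followed by [g] is the required [w0]. *)
have [p0|p0] := posnP p.
  subst p; rewrite add1n in cx cx' cw cg sw tw swv *.
  have [V [rV BV VB lBV _]] := rev_inv rB.
  have E : bd true d.+1 V = bd false d.+1 g by rewrite src_cmp // VB sB swv cmpA // (is_cellE _ cx).
  exists (cmp d.+1 V g); rewrite src_cmp // tgt_cmp // tgt_cmp // -BV tB tA; split.
  - by apply: is_cell_cmp => //; apply: closed_cell (rev_closedP C) _ _ rV.
  - exact: is_cellE cx _.
  - exact: is_cellE cx' _.
  - rewrite -cmpA // -[X in equiv _ _ X](cmp1l d.+1 g) -E VB.
    apply: equiv_cmp => //; first by rewrite tgt_cmp.
    exact: equiv_refl.
have par' c : bd c d.+1 x = bd c d.+1 x'.
  by rewrite -(bd_le c x (j := p + d)) ?par ?bd_le //; lia.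
(* By naturality the boundaries of [g] are [B] followed by [x] and [B] followed by [x']: the shape
   required for dividing by [B]. *)
have bg c : bd c (p.+1 + d) g = cmp d.+1 B (if c then x' else x).
  rewrite bd_cmp_gt // ?swv; last lia.
  rewrite (is_cellE _ cA); last lia.
  have [ey ny] : bd true d (if c then x' else x) = bd true d.+1 a /\
      bd true d.+1 (if c then x' else x) = bd true d.+1 x'.
    by rewrite fa; case: c; rewrite ?par'.
  rewrite cmpA ?fa ?ey ?fa // -ea /A -ny whisker_natural // /B.
  by case: (c); rewrite ?par'.
have lt : p.-1 < p by rewrite prednK.
have E : p.+1 + d = p.-1.+1 + d.+1 by rewrite prednK // addnS.
rewrite E in cx cx' cg bg *.
(* The opposite exchanges source and target, hence [x'] comes before [x]. *)
have [||||||||w0 [cw0 sw0 tw0 /equiv_op w0g]] := IH p.-1 lt (op C) d.+1 B x' x g.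
- exact: rev_op.
- exact/is_cell_op.
- exact/is_cell_op.
- by move=> c /=; rewrite -addSnnS prednK // par.
- by rewrite /= -par'.
- exact/is_cell_op.
- exact: bg.
- exact: bg.
by exists w0; split=> //; apply/is_cell_op.
Qed.

(** * Cylinders *)

Section Cylinders.
Variable C : osCat.
Implicit Types x y z : C.

(** [lev f j] is the pair of source and target sides in dimension [d + j.+1] of
    a cylinder at depth [d], that is, in the [d]-fold hom. *)
Record cyl := Cyl { top : C; bot : C; lev : nat -> C * C }.
Implicit Types f g h k : cyl.

Definition lo f := (lev f 0).1.
Definition hi f := (lev f 0).2.
Definition tail d f := Cyl (cmp d (top f) (hi f)) (cmp d (lo f) (bot f)) (fun j => lev f j.+1).

Definition head_ok d f :=
  [/\ rev d (lo f), rev d (hi f),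
      bd false d (lo f) = bd false d (top f) /\ bd true d (lo f) = bd false d (bot f)
    & bd false d (hi f) = bd true d (top f) /\ bd true d (hi f) = bd true d (bot f)].

(** Validity is coinductive in nature. As the conjunction of its finite approximations it satisfies
    the coinduction principle [valid_coind] by plain induction. *)
Fixpoint valid_upto n d f : Prop :=
  if n is m.+1 then head_ok d f /\ valid_upto m d.+1 (tail d f) else True.

Definition valid d f := forall n, valid_upto n d f.

Lemma valid_coind (Q : nat -> cyl -> Prop) :
  (forall d f, Q d f -> head_ok d f /\ Q d.+1 (tail d f)) -> forall d f, Q d f -> valid d f.
Proof. by move=> H d f q n; elim: n d f q => //= n IH d f /H[hd /IH]. Qed.

Lemma valid_head d f : valid d f -> head_ok d f.
Proof. by case/(_ 1). Qed.

Lemma valid_tail d f : valid d f -> valid d.+1 (tail d f).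
Proof. by move=> v n; case: (v n.+1). Qed.

Lemma cyl_eq f g : top f = top g -> bot f = bot g -> (forall j, lev f j = lev g j) -> f = g.
Proof.
case: f g => [x y l] [x' y' l'] /= -> -> e; congr Cyl.
exact: functional_extensionality.
Qed.

(** A cylinder is determined by its ends and by the first sides of its iterated tails. Usually [E]
    is the law to be proved, at every depth, possibly joined with plain equality for the depths past
    the dimension of composition. *)
Lemma cyl_bisim (E : nat -> cyl -> cyl -> Prop) :
  (forall d f g, E d f g -> [/\ top f = top g, bot f = bot g, lev f 0 = lev g 0
                             & E d.+1 (tail d f) (tail d g)]) ->
  forall d f g, E d f g -> f = g.
Proof.
move=> H d f g efg; have [et eb _ _] := H _ _ _ efg; apply: cyl_eq => // j.
by elim: j d f g efg {et eb} => [|j IH] d f g /H[_ _ e0 et] //; apply: IH et.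
Qed.

Lemma head_bd d f c i : head_ok d f -> i < d ->
  [/\ bd c i (bot f) = bd c i (top f), bd c i (lo f) = bd c i (top f)
    & bd c i (hi f) = bd c i (top f)].
Proof.
move=> [_ _ [e1 e2] [e3 e4]] lt.
have b : bd c i (lo f) = bd c i (top f) by rewrite -(bd_lt c false _ lt) e1 bd_lt.
split=> //; last by rewrite -(bd_lt c false _ lt) e3 bd_lt.
by rewrite -b -[RHS](bd_lt c true _ lt) e2 bd_lt.
Qed.

Lemma head_top_hi d f : head_ok d f -> bd true d (top f) = bd false d (hi f).
Proof. by case=> _ _ _ []. Qed.

Lemma head_lo_bot d f : head_ok d f -> bd true d (lo f) = bd false d (bot f).
Proof. by case=> _ _ []. Qed.

Lemma tail_top_bd d f c i : head_ok d f -> i < d -> bd c i (top (tail d f)) = bd c i (top f).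
Proof. by move=> hf lt; rewrite /= bd_cmp_lt // (head_top_hi hf). Qed.

Lemma lev_bd d f c i j : valid d f -> i < d ->
  bd c i (lev f j).1 = bd c i (top f) /\ bd c i (lev f j).2 = bd c i (top f).
Proof.
elim: j d f => [|j IH] d f vf lt; have hf := valid_head vf; first by case: (head_bd c hf lt).
by have := IH _ _ (valid_tail vf) (leqW lt); rewrite tail_top_bd.
Qed.

Lemma bot_bd d f c i : valid d f -> i < d -> bd c i (bot f) = bd c i (top f).
Proof. by move=> /valid_head hf lt; case: (head_bd c hf lt). Qed.

(** The image of a pair of cylinders under the functor [cmp e], for [e] below
    the depth. *)
Definition star e f g := Cyl (cmp e (top f) (top g)) (cmp e (bot f) (bot g))
  (fun j => (cmp e (lev f j).1 (lev g j).1, cmp e (lev f j).2 (lev g j).2)).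

(** The identity cylinder: its sides are the iterated sources and targets of [x], read as units one
    dimension higher. *)
Definition idc d x := Cyl x x (fun j => (bd false (d + j) x, bd true (d + j) x)).

Lemma tail_idc d x : tail d (idc d x) = idc d.+1 x.
Proof.
by apply: cyl_eq => [||j] /=; rewrite /lo /hi /= ?addn0 ?cmp1r ?cmp1l ?addSnnS.
Qed.

Lemma valid_idc d x : valid d (idc d x).
Proof.
pose Q d f := f = idc d x; have : Q d (idc d x) by [].
apply: valid_coind => {}d f ->; rewrite /Q tail_idc; split=> //.
have r c : rev d (bd c d x) by apply: closed_unit (rev_closedP C) _ _ _; exact: is_cell_bd.
by split; rewrite /lo /hi /= addn0 // !bd_ge.
Qed.

Definition scomp e f g := bd true e (top f) = bd false e (top g).

Lemma scomp_bot d e f g : valid d f -> valid d g -> e < d -> scomp e f g ->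
  bd true e (bot f) = bd false e (bot g).
Proof. by move=> vf vg lt s; rewrite (bot_bd _ vf lt) (bot_bd _ vg lt). Qed.

Lemma scomp_lev d e f g j : valid d f -> valid d g -> e < d -> scomp e f g ->
  bd true e (lev f j).1 = bd false e (lev g j).1 /\
  bd true e (lev f j).2 = bd false e (lev g j).2.
Proof.
move=> vf vg lt s; have [a b] := lev_bd true j vf lt; have [a' b'] := lev_bd false j vg lt.
by rewrite a b a' b'.
Qed.

Lemma scomp_tail d e f g : valid d f -> valid d g -> e < d -> scomp e f g ->
  scomp e (tail d f) (tail d g).
Proof.
move=> vf vg lt s; rewrite /scomp !tail_top_bd //; exact: valid_head.
Qed.

Lemma tail_star d e f g : valid d f -> valid d g -> e < d -> scomp e f g ->
  tail d (star e f g) = star e (tail d f) (tail d g).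
Proof.
move=> vf vg lt s.
have [l h] := scomp_lev 0 vf vg lt s.
have hf := valid_head vf; have hg := valid_head vg.
apply: cyl_eq => //=; rewrite cmp_interchange //.
- exact: head_top_hi.
- exact: head_top_hi.
- exact: head_lo_bot.
- exact: head_lo_bot.
Qed.

Lemma valid_star d e f g : valid d f -> valid d g -> e < d -> scomp e f g ->
  valid d (star e f g).
Proof.
move=> vf vg lt s.
pose Q d h := exists f g, [/\ h = star e f g, valid d f, valid d g, e < d & scomp e f g].
have : Q d (star e f g) by exists f, g.
apply: valid_coind => {f g vf vg lt s}d _ [f [g [-> vf vg lt s]]]; split; last first.
  exists (tail d f), (tail d g); rewrite tail_star //; split=> //; try exact: valid_tail.
    exact: leqW.
  exact: scomp_tail vf vg lt s.
have [l h] := scomp_lev 0 vf vg lt s; have b := scomp_bot vf vg lt s.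
have [r1 r2 [e1 e2] [e3 e4]] := valid_head vf.
have [q1 q2 [f1 f2] [f3 f4]] := valid_head vg.
split.
- by apply: (closed_cmp (rev_closedP C)) => //; apply: ltnW.
- by apply: (closed_cmp (rev_closedP C)) => //; apply: ltnW.
- by rewrite /= !bd_cmp_gt // e1 e2 f1 f2.
- by rewrite /= !bd_cmp_gt // e3 e4 f3 f4.
Qed.

Lemma star_idc d e x y : e < d -> bd true e x = bd false e y ->
  star e (idc d x) (idc d y) = idc d (cmp e x y).
Proof.
by move=> lt s; apply: cyl_eq => //= j; rewrite !bd_cmp_gt //; lia.
Qed.

Lemma star_assoc d e f g h : valid d f -> valid d g -> valid d h -> e < d ->
  scomp e f g -> scomp e g h -> star e (star e f g) h = star e f (star e g h).
Proof.
move=> vf vg vh lt s t.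
apply: cyl_eq => [||j] /=.
- exact: cmpA.
- by rewrite cmpA //; [exact: scomp_bot vf vg lt s | exact: scomp_bot vg vh lt t].
have [a1 a2] := scomp_lev j vf vg lt s; have [b1 b2] := scomp_lev j vg vh lt t.
by rewrite (cmpA a1 b1) (cmpA a2 b2).
Qed.

Lemma star_interchange d l m f g h k : valid d f -> valid d g -> valid d h -> valid d k ->
  l < m -> m < d -> scomp m f g -> scomp m h k -> scomp l f h ->
  star l (star m f g) (star m h k) = star m (star l f h) (star l g k).
Proof.
move=> vf vg vh vk lm md sfg shk sfh; have ld := ltn_trans lm md.
apply: cyl_eq => [||j] /=.
- exact: cmp_interchange.
- apply: cmp_interchange => //; first exact: scomp_bot vf vg md sfg.
    exact: scomp_bot vh vk md shk.
  exact: scomp_bot vf vh ld sfh.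
have [a1 a2] := scomp_lev j vf vg md sfg; have [b1 b2] := scomp_lev j vh vk md shk.
have [c1 c2] := scomp_lev j vf vh ld sfh.
by rewrite (cmp_interchange lm a1 b1 c1) (cmp_interchange lm a2 b2 c2).
Qed.

Lemma star1l d e f x : valid d f -> e < d -> x = bd false e (top f) ->
  star e (idc d x) f = f.
Proof.
move=> vf lt ->; apply: cyl_eq => [||j] /=; rewrite ?cmp1l //.
  by rewrite -(bot_bd false vf lt) cmp1l.
have [a b] := lev_bd false j vf lt; have le : e <= d + j by lia.
by rewrite !bd_ge // -[in X in (X, _)]a -[in X in (_, X)]b !cmp1l; case: (lev f j).
Qed.

Lemma star1r d e f x : valid d f -> e < d -> x = bd true e (top f) ->
  star e f (idc d x) = f.
Proof.
move=> vf lt ->; apply: cyl_eq => [||j] /=; rewrite ?cmp1r //.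
  by rewrite -(bot_bd true vf lt) cmp1r.
have [a b] := lev_bd true j vf lt; have le : e <= d + j by lia.
by rewrite !bd_ge // -[in X in (X, _)]a -[in X in (_, X)]b !cmp1r; case: (lev f j).
Qed.

(** When [bot f = top g], the tail of the concatenation goes from [top f *_d hi f *_d hi g] to
    [lo f *_d lo g *_d bot g]. It passes through [lo f *_d bot f *_d hi g]: first the tail of [f]
    whiskered by [hi g], then the tail of [g] whiskered by [lo f]. *)
Definition whisk_hi d f g := star d (tail d f) (idc d.+1 (hi g)).
Definition whisk_lo d f g := star d (idc d.+1 (lo f)) (tail d g).

Fixpoint cat_lev j d f g : C * C :=
  match j with
  | 0 => (cmp d (lo f) (lo g), cmp d (hi f) (hi g))
  | i.+1 => cat_lev i d.+1 (whisk_hi d f g) (whisk_lo d f g)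
  end.

Definition cat d f g := Cyl (top f) (bot g) (fun j => cat_lev j d f g).

Definition ccomp d f g := [/\ valid d f, valid d g & bot f = top g].

Lemma ccomp_lo d f g : ccomp d f g -> bd true d (lo f) = bd false d (lo g).
Proof.
by move=> [/valid_head[_ _ [_ e] _] /valid_head[_ _ [e' _] _] b]; rewrite e e' b.
Qed.

Lemma ccomp_hi d f g : ccomp d f g -> bd true d (hi f) = bd false d (hi g).
Proof.
by move=> [/valid_head[_ _ _ [_ e]] /valid_head[_ _ _ [e' _]] b]; rewrite e e' b.
Qed.

Lemma ccomp_left d f g : ccomp d f g ->
  valid d.+1 (whisk_hi d f g) /\
  scomp d (tail d f) (idc d.+1 (hi g)).
Proof.
move=> cc; have [vf vg b] := cc.
have s : scomp d (tail d f) (idc d.+1 (hi g)).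
  by rewrite /scomp /= tgt_cmp ?(ccomp_hi cc) //; apply: head_top_hi; apply: valid_head.
by split=> //; apply: valid_star => //; [apply: valid_tail|apply: valid_idc].
Qed.

Lemma ccomp_right d f g : ccomp d f g ->
  valid d.+1 (whisk_lo d f g) /\
  scomp d (idc d.+1 (lo f)) (tail d g).
Proof.
move=> cc; have [vf vg b] := cc.
have hg := valid_head vg.
have s : scomp d (idc d.+1 (lo f)) (tail d g).
  rewrite /scomp /= src_cmp ?(head_top_hi hg) // (ccomp_lo cc).
  by case: hg => _ _ [].
by split=> //; apply: valid_star => //; [apply: valid_idc|apply: valid_tail].
Qed.

Lemma tail_cat d f g : ccomp d f g ->
  tail d (cat d f g) = cat d.+1 (whisk_hi d f g) (whisk_lo d f g).
Proof.
move=> cc; have [vf vg b] := cc; apply: cyl_eq => //=; rewrite /lo /hi /=.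
  by rewrite cmpA // ?(ccomp_hi cc) //; apply: head_top_hi; apply: valid_head.
by rewrite cmpA // ?(ccomp_lo cc) //; apply: head_lo_bot; apply: valid_head.
Qed.

Lemma ccomp_tail d f g : ccomp d f g ->
  ccomp d.+1 (whisk_hi d f g) (whisk_lo d f g).
Proof.
move=> cc; have [vf vg b] := cc.
have [v1 _] := ccomp_left cc; have [v2 _] := ccomp_right cc; split=> //=.
rewrite cmpA // b //; first by rewrite (head_lo_bot (valid_head vf)) b.
exact: head_top_hi (valid_head vg).
Qed.

Lemma valid_cat d f g : ccomp d f g -> valid d (cat d f g).
Proof.
pose Q d h := exists f g, h = cat d f g /\ ccomp d f g.
move=> cc; have : Q d (cat d f g) by exists f, g.
apply: valid_coind => {f g cc}d _ [f [g [-> cc]]]; rewrite tail_cat //; split; last first.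
  by do 2!eexists; split; [reflexivity | exact: ccomp_tail].
have [vf vg b] := cc.
have [r1 r2 [e1 e2] [e3 e4]] := valid_head vf.
have [q1 q2 [f1 f2] [f3 f4]] := valid_head vg.
have cl := ccomp_lo cc; have ch := ccomp_hi cc; rewrite /lo /hi in cl ch.
split.
- exact: (closed_cmp (rev_closedP C)).
- exact: (closed_cmp (rev_closedP C)).
- by rewrite /lo /= src_cmp // tgt_cmp // -f2 -e1.
- by rewrite /hi /= src_cmp // tgt_cmp // -e3 -f4.
Qed.

Lemma ccomp_star d e f f' g g' : e < d -> ccomp d f g -> ccomp d f' g' -> scomp e f f' ->
  scomp e g g' /\ ccomp d (star e f f') (star e g g').
Proof.
move=> lt [vf vg b] [vf' vg' b'] s.
have s' : scomp e g g' by rewrite /scomp -b -b'; apply: scomp_bot s.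
by split=> //; split; [apply: valid_star..|rewrite /= b b'].
Qed.

Lemma whisk_hi_bd d f g c e : ccomp d f g -> e < d ->
  bd c e (top (whisk_hi d f g)) = bd c e (top f).
Proof.
move=> cc lt; have [_ s] := ccomp_left cc; have [vf _ _] := cc.
rewrite -(tail_top_bd c (valid_head vf) lt); exact: bd_cmp_lt s lt.
Qed.

Lemma whisk_hi_star d e f f' g g' : e < d -> ccomp d f g -> ccomp d f' g' -> scomp e f f' ->
  whisk_hi d (star e f f') (star e g g') = star e (whisk_hi d f g) (whisk_hi d f' g').
Proof.
move=> lt c1 c2 s; have [s' cs] := ccomp_star lt c1 c2 s.
have [vf vg b] := c1; have [vf' vg' b'] := c2.
have [_ sh] := scomp_lev 0 vg vg' lt s'.
have [_ t1] := ccomp_left c1; have [_ t2] := ccomp_left c2.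
rewrite /whisk_hi tail_star // -star_idc //; last exact: leqW.
rewrite -(@star_interchange d.+1) //; first [exact: valid_tail | exact: valid_idc | idtac].
exact: scomp_tail vf vf' lt s.
Qed.

Lemma whisk_lo_star d e f f' g g' : e < d -> ccomp d f g -> ccomp d f' g' -> scomp e f f' ->
  whisk_lo d (star e f f') (star e g g') = star e (whisk_lo d f g) (whisk_lo d f' g').
Proof.
move=> lt c1 c2 s; have [s' cs] := ccomp_star lt c1 c2 s.
have [vf vg b] := c1; have [vf' vg' b'] := c2.
have [sl _] := scomp_lev 0 vf vf' lt s.
have [_ t1] := ccomp_right c1; have [_ t2] := ccomp_right c2.
rewrite /whisk_lo tail_star // -star_idc //; last exact: leqW.
by rewrite -(@star_interchange d.+1) //; first [exact: valid_tail | exact: valid_idc | idtac].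
Qed.

(** The sides agree by interchange, and both whiskerings commute with [star], so the tails form
    another instance of the same equation one level deeper. *)
Lemma cat_star d e f f' g g' : e < d -> ccomp d f g -> ccomp d f' g' -> scomp e f f' ->
  cat d (star e f f') (star e g g') = star e (cat d f g) (cat d f' g').
Proof.
pose E d h k := exists e f f' g g', [/\ h = cat d (star e f f') (star e g g'),
  k = star e (cat d f g) (cat d f' g'), e < d, (ccomp d f g /\ ccomp d f' g') & scomp e f f'].
move=> lt c1 c2 s; apply: (@cyl_bisim E _ d); last by exists e, f, f', g, g'.
move=> {e f f' g g' lt c1 c2 s}d _ _ [e [f [f' [g [g' [-> -> lt [c1 c2] s]]]]]].
have [s' cs] := ccomp_star lt c1 c2 s.
have [vf vg b] := c1; have [vf' vg' b'] := c2.
have [sl1 sh1] := scomp_lev 0 vf vf' lt s; have [sl2 sh2] := scomp_lev 0 vg vg' lt s'.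
split=> //.
  by congr pair; symmetry; apply: cmp_interchange => //;
    [exact: ccomp_lo c1 | exact: ccomp_lo c2 | exact: ccomp_hi c1 | exact: ccomp_hi c2].
exists e, (whisk_hi d f g), (whisk_hi d f' g'), (whisk_lo d f g), (whisk_lo d f' g').
split; last 1 first.
- by rewrite /scomp !whisk_hi_bd.
- by rewrite tail_cat // whisk_hi_star // whisk_lo_star.
- rewrite (tail_star (valid_cat c1) (valid_cat c2) lt s) !tail_cat //.
- exact: leqW.
- by split; apply: ccomp_tail.
Qed.

Lemma tail_top_src d f : valid d f -> bd false d (top (tail d f)) = bd false d (top f).
Proof. by move=> /valid_head/head_top_hi e; apply: src_cmp. Qed.

Lemma tail_top_tgt d f : valid d f -> bd true d (top (tail d f)) = bd true d (bot f).
Proof.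
move=> /valid_head hf; rewrite tgt_cmp; last exact: head_top_hi.
by case: hf => _ _ _ [].
Qed.

Lemma ccomp_idl d f : valid d f -> ccomp d (idc d (top f)) f.
Proof. by move=> vf; split=> //; apply: valid_idc. Qed.

Lemma ccomp_idr d f : valid d f -> ccomp d f (idc d (bot f)).
Proof. by move=> vf; split=> //; apply: valid_idc. Qed.

Lemma cat_idl d f x : valid d f -> x = top f -> cat d (idc d x) f = f.
Proof.
move=> vf ->.
pose E d h k := h = cat d (idc d (top k)) k /\ valid d k.
apply: (@cyl_bisim E _ d) => // {vf}d _ {}f [-> vf].
have [_ _ [e1 e2] [e3 e4]] := valid_head vf.
split=> //.
  rewrite /= /lo /hi /= !addn0 -e1 -e3 !cmp1l.
  by rewrite /lo /hi; case: (lev f 0).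
rewrite tail_cat; last exact: ccomp_idl.
split; last exact: valid_tail.
rewrite /whisk_hi /whisk_lo tail_idc star_idc //.
congr cat; rewrite {1}/lo /= addn0; apply: star1l => //; first exact: valid_tail.
by rewrite tail_top_src.
Qed.

Lemma cat_idr d f x : valid d f -> x = bot f -> cat d f (idc d x) = f.
Proof.
move=> vf ->.
pose E d h k := h = cat d k (idc d (bot k)) /\ valid d k.
apply: (@cyl_bisim E _ d) => // {vf}d _ {}f [-> vf].
have [_ _ [e1 e2] [e3 e4]] := valid_head vf.
split=> //.
  rewrite /= /lo /hi /= !addn0 -e2 -e4 !cmp1r.
  by rewrite /lo /hi; case: (lev f 0).
rewrite tail_cat; last exact: ccomp_idr.
split; last exact: valid_tail.
rewrite /whisk_hi /whisk_lo tail_idc star_idc //.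
congr cat; rewrite {1}/hi /= addn0; apply: star1r => //; first exact: valid_tail.
by rewrite tail_top_tgt.
Qed.

Lemma cat_idc d x : cat d (idc d x) (idc d x) = idc d x.
Proof. by apply: cat_idl => //; apply: valid_idc. Qed.

Lemma star_cat_idr D e f g h x : e < D -> ccomp D f g -> bd true e (top f) = bd false e x ->
  h = idc D x -> star e (cat D f g) h = cat D (star e f h) (star e g h).
Proof.
move=> lt cc s ->; rewrite cat_star ?cat_idc //.
by apply: ccomp_idr; apply: valid_idc.
Qed.

Lemma star_cat_idl D e f g h x : e < D -> ccomp D f g -> bd true e x = bd false e (top f) ->
  h = idc D x -> star e h (cat D f g) = cat D (star e h f) (star e h g).
Proof.
move=> lt cc s ->; rewrite cat_star ?cat_idc //.
by apply: ccomp_idr; apply: valid_idc.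
Qed.

(** With [star_split_lo], the two ways round a square: a [star] is the concatenation of its
    one-sided whiskerings in either order. This is what allows middle terms of long concatenations
    to be swapped. *)
Lemma star_split_hi D e f g : valid D f -> valid D g -> e < D -> scomp e f g ->
  cat D (star e f (idc D (top g))) (star e (idc D (bot f)) g) = star e f g.
Proof.
move=> vf vg lt s; rewrite cat_star //; first by rewrite cat_idr // cat_idl.
  exact: ccomp_idr.
exact: ccomp_idl.
Qed.

Lemma star_split_lo D e f g : valid D f -> valid D g -> e < D -> scomp e f g ->
  cat D (star e (idc D (top f)) g) (star e f (idc D (bot g))) = star e f g.
Proof.
move=> vf vg lt s; rewrite cat_star //; first by rewrite cat_idl // cat_idr.
  exact: ccomp_idl.
exact: ccomp_idr.
Qed.

Lemma ccomp_catl d f g h : ccomp d f g -> ccomp d g h -> ccomp d (cat d f g) h.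
Proof. by move=> c1 c2; have [_ vh b] := c2; split=> //; apply: valid_cat. Qed.

Lemma ccomp_catr d f g h : ccomp d f g -> ccomp d g h -> ccomp d f (cat d g h).
Proof. by move=> c1 c2; have [vf _ b] := c1; split=> //; apply: valid_cat. Qed.

Lemma ccomp_star_idr D e f g h x : e < D -> ccomp D f g -> bd true e (top f) = bd false e x ->
  h = idc D x -> ccomp D (star e f h) (star e g h).
Proof.
move=> lt cc s ->; apply: (ccomp_star lt cc _ _).2 => //.
by apply: ccomp_idr; apply: valid_idc.
Qed.

Lemma ccomp_star_idl D e f g h x : e < D -> ccomp D f g -> bd true e x = bd false e (top f) ->
  h = idc D x -> ccomp D (star e h f) (star e h g).
Proof.
move=> lt cc s ->; apply: (ccomp_star lt _ cc _).2 => //.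
by apply: ccomp_idr; apply: valid_idc.
Qed.

Lemma cat_assoc d f g h : ccomp d f g -> ccomp d g h ->
  cat d (cat d f g) h = cat d f (cat d g h).
Proof.
pose E d k l := exists f g h, [/\ k = cat d (cat d f g) h, l = cat d f (cat d g h),
  ccomp d f g & ccomp d g h].
move=> c1 c2; apply: (@cyl_bisim E _ d); last by exists f, g, h.
move=> {f g h c1 c2}d _ _ [f [g [h [-> -> c1 c2]]]].
have [vf vg b] := c1; have [_ vh b'] := c2.
have cl1 := ccomp_lo c1; have ch1 := ccomp_hi c1; have cl2 := ccomp_lo c2; have ch2 := ccomp_hi c2.
split=> //; first by rewrite /= /lo /hi /= !cmpA.
have [vA sA] := ccomp_left c1; have [vB sB] := ccomp_right c1.
have [vA' sA'] := ccomp_left c2; have [vB' sB'] := ccomp_right c2.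
have ct1 := ccomp_tail c1; have ct2 := ccomp_tail c2.
have lt : d < d.+1 by [].
have tA : bd true d (top (whisk_hi d f g)) = bd false d (hi h).
  exact: etrans (tgt_cmp sA) ch2.
have tB : bd true d (lo f) = bd false d (top (whisk_hi d g h)).
  rewrite cl1 (src_cmp sA') tail_top_src //.
  by case: (valid_head vg) => _ _ [].
(* Both tails concatenate the same three cylinders: the tail of [f] whiskered by [hi g] and [hi h],
   that of [g] between [lo f] and [hi h], and that of [h] whiskered by [lo f] and [lo g]. *)
exists (whisk_hi d f (cat d g h)), (star d (whisk_lo d f g) (idc d.+1 (hi h))),
  (whisk_lo d (cat d f g) h).
have E1 : whisk_hi d f (cat d g h) = star d (whisk_hi d f g) (idc d.+1 (hi h)).
  rewrite /whisk_hi (@star_assoc d.+1) //; try exact: valid_idc; last exact: valid_tail.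
  by rewrite star_idc.
have E2 : whisk_lo d (cat d f g) h = star d (idc d.+1 (lo f)) (whisk_lo d g h).
  rewrite /whisk_lo -(@star_assoc d.+1) //; try exact: valid_idc; last exact: valid_tail.
  by rewrite star_idc.
have E3 : star d (whisk_lo d f g) (idc d.+1 (hi h)) = star d (idc d.+1 (lo f)) (whisk_hi d g h).
  by rewrite /whisk_lo (@star_assoc d.+1) //; first [exact: valid_idc | exact: valid_tail].
split.
- rewrite tail_cat; last exact: ccomp_catl.
  congr cat; rewrite E1 /whisk_hi -/(whisk_hi d f g).
  by rewrite tail_cat // (star_cat_idr (x := hi h)).
- rewrite tail_cat; last exact: ccomp_catr.
  congr cat; rewrite E2 E3 {1}/whisk_lo.
  by rewrite tail_cat // (star_cat_idl (x := lo f)).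
- by rewrite E1; apply: (@ccomp_star_idr _ _ _ _ _ (hi h)).
- by rewrite E3 E2; apply: (@ccomp_star_idl _ _ _ _ _ (lo f)).
Qed.

End Cylinders.

(** * Boundaries of cylinders *)

Section CylinderOps.
Variable C : osCat.
Implicit Types (x y z : C) (f g h k : cyl C).

Definition side (c : bool) f := if c then hi f else lo f.

(** The [m]-boundary of a cylinder joins [m]-cells, so its last proper side has dimension [m.+1]:
    sides of dimension at most [m] are kept, and from [m.+1] on the side chosen by [c] is repeated
    as a unit. The intended range is [d <= m]; for [m < d] the test never succeeds. *)
Fixpoint bd_lev c m d (l : nat -> C * C) j : C * C :=
  if d == m then let u := if c then (l 0).2 else (l 0).1 in (u, u)
  else if j is i.+1 then bd_lev c m d.+1 (fun n => l n.+1) i else l 0.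

Definition bdc c m d f := Cyl (bd c m (top f)) (bd c m (bot f)) (bd_lev c m d (lev f)).

Lemma bd_lev_eq c d l j : bd_lev c d d l j = let u := if c then (l 0).2 else (l 0).1 in (u, u).
Proof. by case: j => [|j] /=; rewrite eqxx. Qed.

Lemma bd_lev_lt c m d l j : d < m ->
  bd_lev c m d l j = if j is i.+1 then bd_lev c m d.+1 (fun n => l n.+1) i else l 0.
Proof. by case: j => [|j] /= lt; rewrite ltn_eqF. Qed.

Lemma lev0_bdc_eq c d f : lev (bdc c d d f) 0 = (side c f, side c f).
Proof. by rewrite /= eqxx; case: c. Qed.

Lemma lev0_bdc_lt c m d f : d < m -> lev (bdc c m d f) 0 = lev f 0.
Proof. by move=> lt; rewrite /= ltn_eqF. Qed.

Lemma side_ok c d f : head_ok d f ->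
  [/\ rev d (side c f), bd false d (side c f) = bd c d (top f)
    & bd true d (side c f) = bd c d (bot f)].
Proof. by case: c => -[r1 r2 [e1 e2] [e3 e4]]. Qed.

Lemma tail_bdc_eq c d f : head_ok d f -> tail d (bdc c d d f) = idc d.+1 (side c f).
Proof.
move=> /(side_ok c)[r e1 e2].
have cs := closed_cell (rev_closedP C) r.
have E j b : bd b (d.+1 + j) (side c f) = side c f by apply: is_cellE cs _; lia.
apply: cyl_eq => [||j].
- rewrite /= /hi lev0_bdc_eq /= -e1; exact: cmp1l.
- rewrite /= /lo lev0_bdc_eq /= -e2; exact: cmp1r.
- by rewrite [LHS](bd_lev_eq c d (lev f) j.+1) /= !E /side /lo /hi; case: c {r e1 e2 cs E}.
Qed.

Lemma tail_bdc_lt c m d f : head_ok d f -> d < m -> tail d (bdc c m d f) = bdc c m d.+1 (tail d f).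
Proof.
move=> hf lt; have [r1 r2 _ _] := hf.
have c1 := closed_cell (rev_closedP C) r1; have c2 := closed_cell (rev_closedP C) r2.
have el : lo (bdc c m d f) = lo f by rewrite /lo lev0_bdc_lt.
have eh : hi (bdc c m d f) = hi f by rewrite /hi lev0_bdc_lt.
apply: cyl_eq => [||j] /=.
- by rewrite eh bd_cmp_gt ?(is_cellE c c2 lt) //; apply: head_top_hi.
- by rewrite el bd_cmp_gt ?(is_cellE c c1 lt) //; apply: head_lo_bot.
- by rewrite ltn_eqF.
Qed.

Lemma head_bdc c m d f : head_ok d f -> d <= m -> head_ok d (bdc c m d f).
Proof.
move=> hf; rewrite leq_eqVlt => /orP[/eqP <-|lt].
  have [r e1 e2] := side_ok c hf.
  by split; rewrite /lo /hi lev0_bdc_eq //= !bd_ge.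
have [r1 r2 [e1 e2] [e3 e4]] := hf.
by split; rewrite /lo /hi lev0_bdc_lt //= !bd_lt.
Qed.

Lemma valid_bdc c m d f : valid d f -> d <= m -> valid d (bdc c m d f).
Proof.
(* The first alternative takes over past depth [m], where the tail is an identity cylinder. *)
move=> vf le; pose Q d g := valid d g \/ exists f, [/\ g = bdc c m d f, valid d f & d <= m].
have : Q d (bdc c m d f) by right; exists f.
apply: valid_coind => {f vf le}d g [vf|[f [-> vf le]]].
  by split; [exact: valid_head | left; exact: valid_tail].
have hf := valid_head vf; split; first exact: head_bdc.
move: le; rewrite leq_eqVlt => /orP[/eqP <-|lt].
  by left; rewrite tail_bdc_eq //; apply: valid_idc.
by right; exists (tail d f); rewrite tail_bdc_lt //; split=> //; apply: valid_tail.
Qed.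

Lemma bdc_bdc_lt c c' i j d f : d <= i -> i < j -> bdc c i d (bdc c' j d f) = bdc c i d f.
Proof.
move=> di ij; apply: cyl_eq => [||k] /=; rewrite ?bd_lt //.
elim: k d (lev f) di => [|k IH] d l di.
  move: di; rewrite leq_eqVlt => /orP[/eqP ?|lt].
    by subst i; rewrite !bd_lev_eq bd_lev_lt.
  by have lt' := ltn_trans lt ij; rewrite !bd_lev_lt.
move: di; rewrite leq_eqVlt => /orP[/eqP ?|lt].
  by subst i; rewrite !bd_lev_eq bd_lev_lt.
rewrite !(bd_lev_lt _ _ _ lt) -[RHS](IH d.+1) //; congr bd_lev.
by apply: functional_extensionality => n; rewrite bd_lev_lt // (ltn_trans lt ij).
Qed.

Lemma bdc_bdc_ge c c' i j d f : d <= j -> j <= i -> bdc c i d (bdc c' j d f) = bdc c' j d f.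
Proof.
move=> dj ji; apply: cyl_eq => [||k] /=; rewrite ?bd_ge //.
have const i' d' u n' : bd_lev c i' d' (fun _ => (u, u)) n' = (u, u).
  by elim: n' d' => [|n' IH] d' /=; rewrite ?IH ?if_same //; case: ifP => //; rewrite if_same.
have E d' l : bd_lev c' d' d' l = fun _ => let u := if c' then (l 0).2 else (l 0).1 in (u, u).
  by apply: functional_extensionality => n; rewrite bd_lev_eq.
elim: k d (lev f) dj => [|k IH] d l dj.
  move: dj; rewrite leq_eqVlt => /orP[/eqP ?|lt]; first by subst j; rewrite E const.
  by have lt' := leq_trans lt ji; rewrite !bd_lev_lt.
move: dj; rewrite leq_eqVlt => /orP[/eqP ?|lt]; first by subst j; rewrite E const.
rewrite (bd_lev_lt _ _ _ (leq_trans lt ji)) (bd_lev_lt _ _ _ lt) -[RHS](IH d.+1) //.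
by congr bd_lev; apply: functional_extensionality => n; rewrite bd_lev_lt.
Qed.

Lemma bdc_idc c m d x : d <= m -> bdc c m d (idc d x) = idc d (bd c m x).
Proof.
pose E d f g := exists x, [/\ f = bdc c m d (idc d x), g = idc d (bd c m x) & d <= m] \/ f = g.
move=> le; apply: (@cyl_bisim C E _ d); last by exists x; left.
move=> {x le}d f g [x [[-> -> le]|->]]; last by split=> //; exists x; right.
move: le; rewrite leq_eqVlt => /orP[/eqP ?|lt].
  subst m; split=> //.
    by rewrite lev0_bdc_eq /side /lo /hi /= addn0 !bd_ge //; case: c {E}.
  exists x; right; rewrite tail_bdc_eq ?tail_idc; last exact: valid_head (valid_idc _ _).
  by rewrite /side /lo /hi /= addn0; case: c {E}.
split=> //; first by rewrite lev0_bdc_lt //= addn0 !bd_lt.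
exists x; left; rewrite tail_bdc_lt ?tail_idc //; exact: valid_head (valid_idc _ _).
Qed.

Lemma bdc_star c m d e f g : valid d f -> valid d g -> e < d -> d <= m -> scomp e f g ->
  bdc c m d (star e f g) = star e (bdc c m d f) (bdc c m d g).
Proof.
move=> vf vg ed dm s.
apply: cyl_eq => [||j] /=.
- by rewrite bd_cmp_gt // (leq_trans ed).
- by rewrite bd_cmp_gt ?(leq_trans ed) //; apply: scomp_bot s.
elim: j d (lev f) (lev g) dm {vf vg ed s} => [|j IH] d l l' dm.
  move: dm; rewrite leq_eqVlt => /orP[/eqP ?|lt]; last by rewrite !bd_lev_lt.
  by subst d; rewrite !bd_lev_eq /=; case: c.
move: dm; rewrite leq_eqVlt => /orP[/eqP ?|lt]; last first.
  by rewrite !(bd_lev_lt _ _ _ lt); apply: (IH d.+1 (fun n => l n.+1) (fun n => l' n.+1)).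
by subst d; rewrite !bd_lev_eq /=; case: c IH.
Qed.

Lemma ccomp_bdc c m d f g : d <= m -> ccomp d f g -> ccomp d (bdc c m d f) (bdc c m d g).
Proof. by move=> le [vf vg b]; split; [exact: valid_bdc..|rewrite /= b]. Qed.

Lemma side_cat c d f g : side c (cat d f g) = cmp d (side c f) (side c g).
Proof. by case: c. Qed.

Lemma bdc_cat c m d f g : ccomp d f g -> d <= m ->
  bdc c m d (cat d f g) = cat d (bdc c m d f) (bdc c m d g).
Proof.
pose E d k l := k = l \/ exists f g,
  [/\ k = bdc c m d (cat d f g), l = cat d (bdc c m d f) (bdc c m d g), ccomp d f g & d <= m].
move=> cc le; apply: (@cyl_bisim C E _ d); last by right; exists f, g.
move=> {f g cc le}d k l [->|[f [g [-> -> cc le]]]]; first by split=> //; left.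
have [vf vg b] := cc; have hf := valid_head vf; have hg := valid_head vg.
have hc := valid_head (valid_cat cc).
have cb := ccomp_bdc c le cc.
move: le; rewrite leq_eqVlt => /orP[/eqP ?|lt].
  subst m; split=> //; first by rewrite lev0_bdc_eq side_cat [RHS]/= /lo /hi !lev0_bdc_eq.
  left; rewrite tail_bdc_eq // side_cat tail_cat // /whisk_hi /whisk_lo !tail_bdc_eq //.
  rewrite /lo /hi !lev0_bdc_eq /= !star_idc ?cat_idc //.
  have := ccomp_lo cc; have := ccomp_hi cc; by case: (c).
have el h : lo (bdc c m d h) = lo h by rewrite /lo lev0_bdc_lt.
have eh h : hi (bdc c m d h) = hi h by rewrite /hi lev0_bdc_lt.
split=> //; first by rewrite lev0_bdc_lt //= el el eh eh.
have [_ s1] := ccomp_left cc; have [_ s2] := ccomp_right cc.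
have [r1 _ _ _] := hf; have [_ r2 _ _] := hg.
have c1 := closed_cell (rev_closedP C) r1; have c2 := closed_cell (rev_closedP C) r2.
right; exists (whisk_hi d f g), (whisk_lo d f g); split=> //; last exact: ccomp_tail.
  by rewrite tail_bdc_lt // tail_cat.
rewrite tail_cat // /whisk_hi /whisk_lo el eh !tail_bdc_lt //; congr cat.
  by rewrite (bdc_star _ _ _ _ _ s1) //; [rewrite bdc_idc // (is_cellE c c2 lt)|exact: valid_tail|exact: valid_idc].
by rewrite (bdc_star _ _ _ _ _ s2) //; [rewrite bdc_idc // (is_cellE c c1 lt)|exact: valid_idc|exact: valid_tail].
Qed.

End CylinderOps.

(** * Composition of cylinders *)

Section CylinderComp.
Variable C : osCat.
Implicit Types (x y z : C) (f g h k : cyl C).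

Definition act_top d f g := star d (idc d.+1 (top f)) (tail d g).
Definition act_bot d f g := star d (tail d f) (idc d.+1 (bot g)).

(** Before the depth reaches [m], composable cylinders share their sides and only the tails are
    composed; at depth [m] the formula for composition along the lowest dimension applies. *)
Fixpoint comp_lev j m d f g : C * C :=
  match j with
  | 0 => if d == m then (lo f, hi g) else lev f 0
  | i.+1 => if d == m then cat_lev i d.+1 (act_top d f g) (act_bot d f g)
            else comp_lev i m d.+1 (tail d f) (tail d g)
  end.

Definition compc m d f g :=
  Cyl (cmp m (top f) (top g)) (cmp m (bot f) (bot g)) (fun j => comp_lev j m d f g).

Definition mcomp m d f g := [/\ valid d f, valid d g & bdc true m d f = bdc false m d g].

Lemma mcomp_top m d f g : mcomp m d f g -> bd true m (top f) = bd false m (top g).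
Proof. by case=> _ _ /(congr1 (@top C)). Qed.

Lemma mcomp_bot m d f g : mcomp m d f g -> bd true m (bot f) = bd false m (bot g).
Proof. by case=> _ _ /(congr1 (@bot C)). Qed.

Lemma mcomp_side d f g : mcomp d d f g -> hi f = lo g.
Proof. by case=> _ _ /(congr1 (@lo C)); rewrite /lo !lev0_bdc_eq. Qed.

Lemma mcomp_lev0 m d f g : d < m -> mcomp m d f g -> lev f 0 = lev g 0.
Proof. by move=> lt [_ _ /(congr1 (fun h => lev h 0))]; rewrite !lev0_bdc_lt. Qed.

Lemma mcomp_tail m d f g : d < m -> mcomp m d f g -> mcomp m d.+1 (tail d f) (tail d g).
Proof.
move=> lt [vf vg /(congr1 (tail d))]; rewrite !tail_bdc_lt //; try exact: valid_head.
by move=> e; split=> //; apply: valid_tail.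
Qed.

Lemma mcomp_below m d f g c e : mcomp m d f g -> e < m -> bd c e (top f) = bd c e (top g).
Proof. by move=> /mcomp_top mc lt; rewrite -(bd_lt c true _ lt) mc bd_lt. Qed.

Lemma comp_act d f g : mcomp d d f g ->
  [/\ valid d.+1 (act_top d f g), valid d.+1 (act_bot d f g),
      scomp d (idc d.+1 (top f)) (tail d g), scomp d (tail d f) (idc d.+1 (bot g))
    & ccomp d.+1 (act_top d f g) (act_bot d f g)].
Proof.
move=> mc; have [vf vg _] := mc.
have s1 : scomp d (idc d.+1 (top f)) (tail d g).
  by rewrite /scomp tail_top_src // -(mcomp_top mc).
have s2 : scomp d (tail d f) (idc d.+1 (bot g)).
  by rewrite /scomp tail_top_tgt // (mcomp_bot mc).
have v1 : valid d.+1 (act_top d f g).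
  by apply: valid_star => //; [exact: valid_idc | exact: valid_tail].
have v2 : valid d.+1 (act_bot d f g).
  by apply: valid_star => //; [exact: valid_tail | exact: valid_idc].
split=> //; split=> //=; rewrite (mcomp_side mc) cmpA //.
  by rewrite -(mcomp_side mc); apply: head_top_hi; apply: valid_head.
by apply: head_lo_bot; apply: valid_head.
Qed.

Lemma lev0_compc_eq d f g : lev (compc d d f g) 0 = (lo f, hi g).
Proof. by rewrite /= eqxx. Qed.

Lemma lev0_compc_lt m d f g : d < m -> lev (compc m d f g) 0 = lev f 0.
Proof. by move=> lt; rewrite /= ltn_eqF. Qed.

Lemma tail_compc_eq d f g : mcomp d d f g ->
  tail d (compc d d f g) = cat d.+1 (act_top d f g) (act_bot d f g).
Proof.
move=> mc; have [vf vg _] := mc.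
apply: cyl_eq => [||j].
- rewrite /= /hi lev0_compc_eq cmpA //; first exact: mcomp_top mc.
  exact: head_top_hi (valid_head vg).
- rewrite /= /lo lev0_compc_eq -cmpA //; last exact: mcomp_bot mc.
  exact: head_lo_bot (valid_head vf).
- by rewrite /= eqxx.
Qed.

Lemma tail_compc_lt m d f g : d < m -> mcomp m d f g ->
  tail d (compc m d f g) = compc m d.+1 (tail d f) (tail d g).
Proof.
move=> lt mc; have [vf vg _] := mc.
have e0 := mcomp_lev0 lt mc.
have [r1 r2 _ _] := valid_head vf.
have c1 := closed_cell (rev_closedP C) r1; have c2 := closed_cell (rev_closedP C) r2.
have E1 c := is_cellE c c1 lt; have E2 c := is_cellE c c2 lt.
(* A side is a [d.+1]-cell, hence idempotent for composition along [m > d]; interchange then lets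
   the shared sides be composed onto the composite itself. *)
have I1 : cmp m (lo f) (lo f) = lo f by rewrite -{1}(E1 false) cmp1l.
have I2 : cmp m (hi f) (hi f) = hi f by rewrite -{1}(E2 false) cmp1l.
have el : lo g = lo f by rewrite /lo e0.
have eh : hi g = hi f by rewrite /hi e0.
apply: cyl_eq => [||j].
- rewrite /= /hi lev0_compc_lt // -/(hi f) -/(hi g) eh.
  rewrite -cmp_interchange //; last exact: head_top_hi (valid_head vf).
  + by rewrite I2.
  + exact: mcomp_top mc.
  + by rewrite !E2.
- rewrite /= /lo lev0_compc_lt // -/(lo f) -/(lo g) el.
  rewrite -cmp_interchange //; last exact: head_lo_bot (valid_head vf).
  + by rewrite I1.
  + by rewrite !E1.
  + exact: mcomp_bot mc.
- by rewrite /= ltn_eqF.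
Qed.

Lemma head_compc m d f g : d <= m -> mcomp m d f g -> head_ok d (compc m d f g).
Proof.
move=> le mc; have [vf vg _] := mc.
have [r1 r2 [e1 e2] [e3 e4]] := valid_head vf; have [q1 q2 [f1 f2] [f3 f4]] := valid_head vg.
have mt := mcomp_top mc; have mb := mcomp_bot mc.
move: le; rewrite leq_eqVlt => /orP[/eqP ?|lt].
  subst m; split; rewrite /lo /hi lev0_compc_eq //=.
    by rewrite !src_cmp.
  by rewrite !tgt_cmp.
by split; rewrite /lo /hi lev0_compc_lt //= !bd_cmp_lt.
Qed.

Lemma valid_compc m d f g : d <= m -> mcomp m d f g -> valid d (compc m d f g).
Proof.
move=> le mc; pose Q d h := valid d h \/ exists f g, [/\ h = compc m d f g, d <= m & mcomp m d f g].
have : Q d (compc m d f g) by right; exists f, g.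
apply: valid_coind => {f g mc le}d h [vh|[f [g [-> le mc]]]].
  by split; [exact: valid_head | left; exact: valid_tail].
split; first exact: head_compc.
move: le; rewrite leq_eqVlt => /orP[/eqP ?|lt].
  subst m; left; rewrite tail_compc_eq //.
  by have [_ _ _ _ cc] := comp_act mc; apply: valid_cat.
right; exists (tail d f), (tail d g); rewrite tail_compc_lt //; split=> //.
exact: mcomp_tail.
Qed.

Lemma bdc_compc_lt c i m d f g : d <= i -> i < m -> mcomp m d f g ->
  bdc c i d (compc m d f g) = bdc c i d f.
Proof.
pose E d h k := h = k \/ exists f g,
  [/\ h = bdc c i d (compc m d f g), k = bdc c i d f, d <= i & mcomp m d f g].
move=> di im mc; apply: (@cyl_bisim C E _ d); last by right; exists f, g.
move=> {f g di mc}d h k [->|[f [g [-> -> di mc]]]]; first by split=> //; left.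
have [vf vg _] := mc; have dm := leq_ltn_trans di im.
have hf := valid_head vf; have hc := head_compc (ltnW dm) mc.
have mt := mcomp_top mc; have mb := mcomp_bot mc.
have l0 := lev0_compc_lt f g dm.
have es : side c (compc m d f g) = side c f by rewrite /side /lo /hi l0.
move: di; rewrite leq_eqVlt => /orP[/eqP ?|lt].
  subst i; split; try exact: bd_cmp_lt; first by rewrite !lev0_bdc_eq es.
  by left; rewrite !tail_bdc_eq // es.
split; try exact: bd_cmp_lt; first by rewrite !lev0_bdc_lt.
right; exists (tail d f), (tail d g); rewrite !tail_bdc_lt // tail_compc_lt //.
by split=> //; apply: mcomp_tail.
Qed.

Lemma bdc_compc_eq c m d f g : d <= m -> mcomp m d f g ->
  bdc c m d (compc m d f g) = if c then bdc true m d g else bdc false m d f.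
Proof.
pose E d h k := h = k \/ exists f g, [/\ h = bdc c m d (compc m d f g),
  k = (if c then bdc true m d g else bdc false m d f), d <= m & mcomp m d f g].
move=> le mc; apply: (@cyl_bisim C E _ d); last by right; exists f, g.
move=> {f g le mc}d h k [->|[f [g [-> -> le mc]]]]; first by split=> //; left.
have [vf vg _] := mc.
have hf := valid_head vf; have hg := valid_head vg; have hc := head_compc le mc.
have mt := mcomp_top mc; have mb := mcomp_bot mc.
have et : top (bdc c m d (compc m d f g)) = top (if c then bdc true m d g else bdc false m d f).
  by case: (c); [exact: tgt_cmp | exact: src_cmp].
have eb : bot (bdc c m d (compc m d f g)) = bot (if c then bdc true m d g else bdc false m d f).
  by case: (c); [exact: tgt_cmp | exact: src_cmp].
move: le; rewrite leq_eqVlt => /orP[/eqP ?|lt].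
  subst m.
  have es : side c (compc d d f g) = if c then hi g else lo f.
    by rewrite /side /lo /hi lev0_compc_eq; case: (c).
  split=> //; first by rewrite lev0_bdc_eq es; case: (c); rewrite lev0_bdc_eq.
  left; rewrite tail_bdc_eq // es; case: (c); by rewrite tail_bdc_eq.
split=> //.
  by rewrite lev0_bdc_lt // lev0_compc_lt //; case: (c); rewrite lev0_bdc_lt // (mcomp_lev0 lt mc).
right; exists (tail d f), (tail d g); rewrite tail_bdc_lt // tail_compc_lt //.
split=> //; last exact: mcomp_tail.
by case: (c); rewrite tail_bdc_lt.
Qed.

Lemma mcomp_bdc c i m d f g : d <= m -> m < i -> mcomp m d f g ->
  mcomp m d (bdc c i d f) (bdc c i d g).
Proof.
move=> dm mi [vf vg e]; have di := leq_trans dm (ltnW mi).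
by split; [exact: valid_bdc..|rewrite !bdc_bdc_lt].
Qed.

Lemma bdc_compc_gt c i m d f g : d <= m -> m < i -> mcomp m d f g ->
  bdc c i d (compc m d f g) = compc m d (bdc c i d f) (bdc c i d g).
Proof.
pose E d h k := h = k \/ exists f g, [/\ h = bdc c i d (compc m d f g),
  k = compc m d (bdc c i d f) (bdc c i d g), d <= m & mcomp m d f g].
move=> le mi mc; apply: (@cyl_bisim C E _ d); last by right; exists f, g.
move=> {f g le mc}d h k [->|[f [g [-> -> le mc]]]]; first by split=> //; left.
have [vf vg _] := mc; have di := leq_ltn_trans le mi.
have hf := valid_head vf; have hg := valid_head vg; have hc := head_compc le mc.
have mt := mcomp_top mc; have mb := mcomp_bot mc; have mbd := mcomp_bdc c le mi mc.
move: le; rewrite leq_eqVlt => /orP[/eqP ?|lt].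
  subst m; split; try exact: bd_cmp_gt.
    by rewrite lev0_bdc_lt // !lev0_compc_eq /lo /hi !lev0_bdc_lt.
  left; rewrite tail_bdc_lt // !tail_compc_eq //.
  have [v1 v2 s1 s2 cc] := comp_act mc.
  rewrite bdc_cat //; congr cat.
    rewrite (bdc_star _ _ _ _ _ s1) //; first [exact: valid_idc|exact: valid_tail|idtac].
    by rewrite bdc_idc // -tail_bdc_lt.
  rewrite (bdc_star _ _ _ _ _ s2) //; first [exact: valid_idc|exact: valid_tail|idtac].
  by rewrite bdc_idc // -tail_bdc_lt.
split; try exact: bd_cmp_gt.
  by rewrite lev0_bdc_lt // !lev0_compc_lt // lev0_bdc_lt.
right; exists (tail d f), (tail d g); rewrite tail_bdc_lt // !tail_compc_lt //.
split=> //; last exact: mcomp_tail.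
by rewrite !tail_bdc_lt.
Qed.

Lemma mcomp_idc m d x y : d <= m -> bd true m x = bd false m y ->
  mcomp m d (idc d x) (idc d y).
Proof. by move=> le e; split; [exact: valid_idc..|rewrite !bdc_idc // e]. Qed.

Lemma compc_idc m d x y : d <= m -> bd true m x = bd false m y ->
  compc m d (idc d x) (idc d y) = idc d (cmp m x y).
Proof.
pose E d h k := h = k \/ d <= m /\ h = compc m d (idc d x) (idc d y) /\ k = idc d (cmp m x y).
move=> le e; apply: (@cyl_bisim C E _ d); last by right.
move=> {le}d h k [->|[le [-> ->]]]; first by split=> //; left.
have mc := mcomp_idc le e.
move: le; rewrite leq_eqVlt => /orP[/eqP ?|lt].
  subst m; split=> //.
    by rewrite lev0_compc_eq /lo /hi /= !addn0 src_cmp // tgt_cmp.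
  left; rewrite tail_compc_eq // /act_top /act_bot !tail_idc !star_idc ?cat_idc //.
split=> //; first by rewrite lev0_compc_lt //= !addn0 !bd_cmp_lt.
by right; rewrite tail_compc_lt // !tail_idc.
Qed.

Lemma mcomp_star m d e f f' g g' : e < d -> d <= m -> mcomp m d f f' -> mcomp m d g g' ->
  scomp e f g -> scomp e f' g' /\ mcomp m d (star e f g) (star e f' g').
Proof.
move=> ed dm m1 m2 s; have [vf vf' e1] := m1; have [vg vg' e2] := m2.
have em := leq_trans ed dm.
have s' : scomp e f' g' by rewrite /scomp -(mcomp_below _ m1 em) -(mcomp_below _ m2 em).
by split=> //; split; [exact: valid_star..|rewrite !(@bdc_star _ _ _ d) // e1 e2].
Qed.

Lemma compc_star m d e f f' g g' : e < d -> d <= m -> mcomp m d f f' -> mcomp m d g g' ->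
  scomp e f g ->
  compc m d (star e f g) (star e f' g') = star e (compc m d f f') (compc m d g g').
Proof.
pose E d h k := h = k \/ exists f f' g g', [/\ h = compc m d (star e f g) (star e f' g'),
  k = star e (compc m d f f') (compc m d g g'), e < d /\ d <= m,
  mcomp m d f f' /\ mcomp m d g g' & scomp e f g].
move=> ed le m1 m2 s; apply: (@cyl_bisim C E _ d); last by right; exists f, f', g, g'.
move=> {f f' g g' ed le m1 m2 s}d h k
  [->|[f [f' [g [g' [-> -> [ed le] [m1 m2] s]]]]]]; first by split=> //; left.
have [vf vf' _] := m1; have [vg vg' _] := m2.
have em := leq_trans ed le.
have [s' ms] := mcomp_star ed le m1 m2 s.
have et : top (compc m d (star e f g) (star e f' g')) =
    top (star e (compc m d f f') (compc m d g g')).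
  by symmetry; apply: cmp_interchange => //; [exact: mcomp_top m1|exact: mcomp_top m2].
have eb : bot (compc m d (star e f g) (star e f' g')) =
    bot (star e (compc m d f f') (compc m d g g')).
  symmetry; apply: cmp_interchange => //; [exact: mcomp_bot m1|exact: mcomp_bot m2|].
  exact: scomp_bot s.
have sc : scomp e (compc m d f f') (compc m d g g').
  by rewrite /scomp /= !bd_cmp_lt // ?(mcomp_top m1) ?(mcomp_top m2).
have v1 := valid_compc le m1; have v2 := valid_compc le m2.
move: le; rewrite leq_eqVlt => /orP[/eqP ?|lt].
  subst m; split=> //; first by rewrite /= !eqxx.
  left; rewrite tail_compc_eq // (tail_star v1 v2) // !tail_compc_eq //.
  have [w1 w2 t1 t2 cc] := comp_act m1; have [w1' w2' t1' t2' cc'] := comp_act m2.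
  have tf : scomp e (tail d f) (tail d g) by apply: scomp_tail vf vg ed s.
  rewrite -cat_star //; last first.
  - exact: etrans (bd_cmp_lt _ t1 ed) (etrans s (esym (bd_cmp_lt _ t1' ed))).
  - exact: leqW.
  rewrite {1}/act_top {1}/act_bot !(@tail_star _ d) //.
  rewrite -(@star_idc _ d.+1 e (top f)) //; last exact: leqW.
  rewrite -(@star_idc _ d.+1 e (bot f')) //; [|exact: leqW|exact: scomp_bot s'].
  congr cat.
    by rewrite -(@star_interchange _ d.+1) //; first [exact: valid_idc|exact: valid_tail].
  by rewrite -(@star_interchange _ d.+1) //; first [exact: valid_idc|exact: valid_tail].
split=> //; first by rewrite /= ltn_eqF.
right; exists (tail d f), (tail d f'), (tail d g), (tail d g').
rewrite tail_compc_lt // (tail_star v1 v2) // !tail_compc_lt // !(@tail_star _ d) //.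
split=> //; first by split=> //; apply: leqW.
  by split; apply: mcomp_tail.
exact: scomp_tail vf vg ed s.
Qed.

Lemma mcomp_cat m d f f' g g' : d <= m -> mcomp m d f f' -> mcomp m d g g' ->
  ccomp d f g -> ccomp d f' g' -> mcomp m d (cat d f g) (cat d f' g').
Proof.
move=> le [vf vf' e1] [vg vg' e2] c1 c2; split; [exact: valid_cat..|].
by rewrite !bdc_cat // e1 e2.
Qed.

Lemma cat_middle d f g h k : ccomp d f g -> ccomp d h k -> bot g = top h ->
  cat d (cat d f g) (cat d h k) = cat d f (cat d (cat d g h) k).
Proof.
move=> c1 c2 b; have [_ vg _] := c1; have [vh _ _] := c2.
have c : ccomp d g h by [].
by rewrite cat_assoc ?(cat_assoc c c2) //; apply: ccomp_catr.
Qed.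

(** At depth [m] both tails become fourfold concatenations with the same outer terms [P1] and [Q2].
    The middle pairs are the two ways round the square formed by the tail of [f] and the tail of
    [g'], so both concatenate to the [star] of these tails. *)
Lemma compc_cat m d f f' g g' : d <= m -> mcomp m d f f' -> mcomp m d g g' ->
  ccomp d f g -> ccomp d f' g' ->
  compc m d (cat d f g) (cat d f' g') = cat d (compc m d f f') (compc m d g g').
Proof.
pose E d h k := h = k \/ exists f f' g g', [/\ h = compc m d (cat d f g) (cat d f' g'),
  k = cat d (compc m d f f') (compc m d g g'), d <= m,
  mcomp m d f f' /\ mcomp m d g g' & ccomp d f g /\ ccomp d f' g'].
move=> le m1 m2 c1 c2; apply: (@cyl_bisim C E _ d); last by right; exists f, f', g, g'.
move=> {f f' g g' le m1 m2 c1 c2}d h k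
  [->|[f [f' [g [g' [-> -> le [m1 m2] [c1 c2]]]]]]]; first by split=> //; left.
have [vf vf' _] := m1; have [vg vg' _] := m2.
have mc := mcomp_cat le m1 m2 c1 c2.
have v1 := valid_compc le m1; have v2 := valid_compc le m2.
have cc : ccomp d (compc m d f f') (compc m d g g').
  by split=> //=; have [_ _ ->] := c1; have [_ _ ->] := c2.
have [va sa] := ccomp_left c1; have [vb sb] := ccomp_right c1.
have [va' sa'] := ccomp_left c2; have [vb' sb'] := ccomp_right c2.
have ct := ccomp_tail c1; have ct' := ccomp_tail c2.
move: le; rewrite leq_eqVlt => /orP[/eqP ?|lt]; last first.
  have e0 := mcomp_lev0 lt m1; have e0' := mcomp_lev0 lt m2.
  split=> //; first by rewrite /= ltn_eqF //= /lo /hi /= ltn_eqF.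
  right; exists (whisk_hi d f g), (whisk_hi d f' g'), (whisk_lo d f g), (whisk_lo d f' g').
  have el : lo f' = lo f by rewrite /lo e0.
  have eh : hi g' = hi g by rewrite /hi e0'.
  have [[r1 _ _ _] [_ r2 _ _]] := (valid_head vf, valid_head vg).
  have cl1 := closed_cell (rev_closedP C) r1; have cl2 := closed_cell (rev_closedP C) r2.
  have E1 c := is_cellE c cl1 lt; have E2 c := is_cellE c cl2 lt.
  have mh : mcomp m d.+1 (idc d.+1 (hi g)) (idc d.+1 (hi g')).
    by apply: mcomp_idc => //; rewrite eh !E2.
  have ml : mcomp m d.+1 (idc d.+1 (lo f)) (idc d.+1 (lo f')).
    by apply: mcomp_idc => //; rewrite el !E1.
  have mt1 := mcomp_tail lt m1; have mt2 := mcomp_tail lt m2.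
  rewrite tail_compc_lt // !tail_cat //; split=> //.
  - have I1 : cmp m (lo f) (lo f) = lo f by rewrite -{1}(E1 false) cmp1l.
    have I2 : cmp m (hi g) (hi g) = hi g by rewrite -{1}(E2 false) cmp1l.
    have eH : idc d.+1 (hi (compc m d g g')) = compc m d.+1 (idc d.+1 (hi g)) (idc d.+1 (hi g')).
      rewrite compc_idc //; last by rewrite eh !E2.
      by rewrite {1}/hi lev0_compc_lt // eh I2.
    have eL : idc d.+1 (lo (compc m d f f')) = compc m d.+1 (idc d.+1 (lo f)) (idc d.+1 (lo f')).
      rewrite compc_idc //; last by rewrite el !E1.
      by rewrite {1}/lo lev0_compc_lt // el I1.
    rewrite {1}/whisk_hi {1}/whisk_lo eH eL !tail_compc_lt //.
    by rewrite -!(@compc_star _ d.+1).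
  - split; first by have [] := mcomp_star (ltnSn d) lt mt1 mh sa.
    by have [] := mcomp_star (ltnSn d) lt ml mt2 sb.
subst m; split=> //; first by rewrite /= eqxx /= /lo /hi /= eqxx.
left; rewrite tail_compc_eq // tail_cat //.
have [w1 w2 t1 t2 tc] := comp_act m1; have [w1' w2' t1' t2' tc'] := comp_act m2.
have [z1 z2 q1 q2 qc] := comp_act mc.
have lt : d < d.+1 by [].
have hsf := mcomp_side m1; have hsg := mcomp_side m2.
have [_ _ bfg] := c1; have [_ _ bfg'] := c2.
have eh0 : hi (compc d d g g') = hi g' by rewrite {1}/hi lev0_compc_eq.
have el0 : lo (compc d d f f') = lo f by rewrite {1}/lo lev0_compc_eq.
have VT l : valid d l -> valid d.+1 (tail d l) by apply: valid_tail.
have VI w : valid d.+1 (idc d.+1 w) by apply: valid_idc.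
have x1 : bd true d (top f) = bd false d (top (whisk_hi d f' g')).
  by rewrite (src_cmp sa') tail_top_src //; exact: mcomp_top m1.
have y1 : bd true d (top (whisk_hi d f g)) = bd false d (bot g').
  rewrite (tgt_cmp sa) -(mcomp_bot m2).
  by have [_ _ _ []] := valid_head vg.
have sTT : scomp d (tail d f) (tail d g').
  by rewrite /scomp tail_top_tgt // tail_top_src // bfg; exact: mcomp_top m2.
have x2 : bd true d (top f) = bd false d (lo f').
  by rewrite (mcomp_top m1); have [_ _ []] := valid_head vf'.
have x3 : bd true d (bot f') = bd false d (hi g').
  by rewrite bfg'; apply: head_top_hi (valid_head vg').
have x4 : bd true d (lo f) = bd false d (top g).
  by rewrite (head_lo_bot (valid_head vf)) bfg.
have x5 : bd true d (hi g) = bd false d (bot g').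
  by rewrite -(mcomp_bot m2); have [_ _ _ []] := valid_head vg.
set P1 := star d (idc d.+1 (top f)) (whisk_hi d f' g').
set Q2 := star d (whisk_lo d f g) (idc d.+1 (bot g')).
pose TT := tail d f; pose TT' := tail d g'.
have EA : star d (idc d.+1 (top f)) (whisk_lo d f' g') = star d (idc d.+1 (top TT)) TT'.
  rewrite /whisk_lo -(@star_assoc _ d.+1) ?star_idc //; try by auto.
  by rewrite /TT /= (mcomp_side m1).
have EB : star d (whisk_hi d f g) (idc d.+1 (bot g')) = star d TT (idc d.+1 (bot TT')).
  rewrite /whisk_hi (@star_assoc _ d.+1) ?star_idc //; try by auto.
  by rewrite /TT' /= (mcomp_side m2).
have EP : star d (act_top d f f') (idc d.+1 (hi g')) = P1.
  by rewrite /act_top (@star_assoc _ d.+1) //; auto.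
have EA' : star d (act_bot d f f') (idc d.+1 (hi g')) = star d TT (idc d.+1 (top TT')).
  rewrite /act_bot (@star_assoc _ d.+1) ?star_idc //; try by auto.
  by rewrite bfg'.
have EB' : star d (idc d.+1 (lo f)) (act_top d g g') = star d (idc d.+1 (bot TT)) TT'.
  rewrite /act_top -(@star_assoc _ d.+1) ?star_idc //; try by auto.
  by rewrite -bfg.
have EQ : star d (idc d.+1 (lo f)) (act_bot d g g') = Q2.
  by rewrite /act_bot -(@star_assoc _ d.+1) //; auto.
have y2 : bd true d (top (act_top d f f')) = bd false d (hi g').
  rewrite (tgt_cmp t1) tail_top_tgt // bfg'; exact: head_top_hi (valid_head vg').
have y3 : bd true d (lo f) = bd false d (top (act_top d g g')).
  by rewrite (src_cmp t1') (head_lo_bot (valid_head vf)) bfg.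
have cPA := ccomp_star_idl lt ct' x1 (erefl (idc d.+1 (top f))); rewrite EA -/P1 in cPA.
have cBQ := ccomp_star_idr lt ct y1 (erefl (idc d.+1 (bot g'))); rewrite EB -/Q2 in cBQ.
have cPA' := ccomp_star_idr lt tc y2 (erefl (idc d.+1 (hi g'))); rewrite EP EA' in cPA'.
have cBQ' := ccomp_star_idl lt tc' y3 (erefl (idc d.+1 (lo f))); rewrite EB' EQ in cBQ'.
have qc' := ccomp_tail cc.
have E1 : act_top d (cat d f g) (cat d f' g') = cat d.+1 P1 (star d (idc d.+1 (top TT)) TT').
  by rewrite /act_top tail_cat // (star_cat_idl (x := top f)) // EA.
have E2 : act_bot d (cat d f g) (cat d f' g') = cat d.+1 (star d TT (idc d.+1 (bot TT'))) Q2.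
  by rewrite /act_bot tail_cat // (star_cat_idr (x := bot g')) // EB.
have E3 : whisk_hi d (compc d d f f') (compc d d g g') = cat d.+1 P1 (star d TT (idc d.+1 (top TT'))).
  by rewrite /whisk_hi eh0 tail_compc_eq // (star_cat_idr (x := hi g')) // EP EA'.
have E4 : whisk_lo d (compc d d f f') (compc d d g g') = cat d.+1 (star d (idc d.+1 (bot TT)) TT') Q2.
  by rewrite /whisk_lo el0 tail_compc_eq // (star_cat_idl (x := lo f)) // EB' EQ.
rewrite E1 E2 in qc *; rewrite E3 E4 in qc' *.
have [_ _ b] := qc; have [_ _ b'] := qc'.
have vT := valid_tail vf; have vT' := valid_tail vg'.
rewrite !cat_middle //; congr cat; congr cat.
by rewrite star_split_lo // star_split_hi.
Qed.

Lemma mcomp_interchange l m d f g h k : d <= l -> l < m ->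
  mcomp m d f g -> mcomp m d h k -> mcomp l d f h ->
  [/\ mcomp l d g k, mcomp l d (compc m d f g) (compc m d h k)
    & mcomp m d (compc l d f h) (compc l d g k)].
Proof.
move=> dl lm m1 m2 ml; have dm := leq_trans dl (ltnW lm).
have [vf vg e1] := m1; have [vh vk e2] := m2; have [_ _ e3] := ml.
have ml' : mcomp l d g k.
  split=> //; rewrite -(bdc_bdc_lt true false g dl lm) -e1 bdc_bdc_lt // e3.
  by rewrite -(bdc_bdc_lt false true h dl lm) e2 bdc_bdc_lt.
split=> //; split; try exact: valid_compc.
  by rewrite !bdc_compc_lt.
by rewrite !bdc_compc_gt // e1 e2.
Qed.

(** At depth [l] composition along [l] unfolds to a concatenation of two whiskerings; [compc_star]
    carries the [m]-composition through the whiskerings and [compc_cat] through the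
    concatenation. *)
Lemma compc_interchange l m d f g h k : d <= l -> l < m ->
  mcomp m d f g -> mcomp m d h k -> mcomp l d f h ->
  compc l d (compc m d f g) (compc m d h k) = compc m d (compc l d f h) (compc l d g k).
Proof.
pose E d p q := p = q \/ exists f g h k, [/\ p = compc l d (compc m d f g) (compc m d h k),
  q = compc m d (compc l d f h) (compc l d g k), d <= l,
  mcomp m d f g /\ mcomp m d h k & mcomp l d f h].
move=> dl lm m1 m2 ml; apply: (@cyl_bisim C E _ d); last by right; exists f, g, h, k.
move=> {f g h k dl m1 m2 ml}d p q
  [->|[f [g [h [k [-> -> dl [m1 m2] ml]]]]]]; first by split=> //; left.
have [ml' n1 n2] := mcomp_interchange dl lm m1 m2 ml.
have [vf vg _] := m1; have [vh vk _] := m2.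
have dm := leq_ltn_trans dl lm; have dm' := ltnW dm.
have et : cmp l (cmp m (top f) (top g)) (cmp m (top h) (top k)) =
    cmp m (cmp l (top f) (top h)) (cmp l (top g) (top k)).
  by apply: cmp_interchange => //; [exact: mcomp_top m1|exact: mcomp_top m2|exact: mcomp_top ml].
have eb : cmp l (cmp m (bot f) (bot g)) (cmp m (bot h) (bot k)) =
    cmp m (cmp l (bot f) (bot h)) (cmp l (bot g) (bot k)).
  by apply: cmp_interchange => //; [exact: mcomp_bot m1|exact: mcomp_bot m2|exact: mcomp_bot ml].
move: dl; rewrite leq_eqVlt => /orP[/eqP ?|lt]; last first.
  split=> //.
    by rewrite lev0_compc_lt // !lev0_compc_lt // lev0_compc_lt.
  right; exists (tail d f), (tail d g), (tail d h), (tail d k).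
  rewrite !tail_compc_lt //; split=> //; last exact: mcomp_tail.
  by split; apply: mcomp_tail.
subst l; split=> //.
  by rewrite lev0_compc_eq lev0_compc_lt // lev0_compc_eq /lo /hi !lev0_compc_lt //.
left; rewrite tail_compc_eq // tail_compc_lt // !tail_compc_eq //.
have [w1 w2 t1 t2 tc] := comp_act ml; have [w1' w2' t1' t2' tc'] := comp_act ml'.
have mT1 := mcomp_tail dm m1; have mT2 := mcomp_tail dm m2.
have mi1 : mcomp m d.+1 (idc d.+1 (top f)) (idc d.+1 (top g)).
  by apply: mcomp_idc => //; exact: mcomp_top m1.
have mi2 : mcomp m d.+1 (idc d.+1 (bot h)) (idc d.+1 (bot k)).
  by apply: mcomp_idc => //; exact: mcomp_bot m2.
rewrite {1}/act_top {1}/act_bot !tail_compc_lt //.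
rewrite -(@compc_idc m d.+1 (top f) (top g)) //; last exact: mcomp_top m1.
rewrite -(@compc_idc m d.+1 (bot h) (bot k)) //; last exact: mcomp_bot m2.
rewrite -!(@compc_star _ d.+1) //.
have [_ q1] := mcomp_star (ltnSn d) dm mi1 mT2 t1.
have [_ q2] := mcomp_star (ltnSn d) dm mT1 mi2 t2.
by rewrite -compc_cat.
Qed.

Lemma mcomp_assoc m d f g h : d <= m -> mcomp m d f g -> mcomp m d g h ->
  mcomp m d (compc m d f g) h /\ mcomp m d f (compc m d g h).
Proof.
move=> le m1 m2; have [vf vg e1] := m1; have [_ vh e2] := m2.
by split; split=> //; try exact: valid_compc; rewrite bdc_compc_eq.
Qed.

Lemma compc_assoc m d f g h : d <= m -> mcomp m d f g -> mcomp m d g h ->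
  compc m d (compc m d f g) h = compc m d f (compc m d g h).
Proof.
pose E d p q := p = q \/ exists f g h, [/\ p = compc m d (compc m d f g) h,
  q = compc m d f (compc m d g h), d <= m, mcomp m d f g & mcomp m d g h].
move=> le m1 m2; apply: (@cyl_bisim C E _ d); last by right; exists f, g, h.
move=> {f g h le m1 m2}d p q [->|[f [g [h [-> -> le m1 m2]]]]]; first by split=> //; left.
have [n1 n2] := mcomp_assoc le m1 m2.
have [vf vg _] := m1; have [_ vh _] := m2.
have et : cmp m (cmp m (top f) (top g)) (top h) = cmp m (top f) (cmp m (top g) (top h)).
  by apply: cmpA; [exact: mcomp_top m1|exact: mcomp_top m2].
have eb : cmp m (cmp m (bot f) (bot g)) (bot h) = cmp m (bot f) (cmp m (bot g) (bot h)).
  by apply: cmpA; [exact: mcomp_bot m1|exact: mcomp_bot m2].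
move: le; rewrite leq_eqVlt => /orP[/eqP ?|lt]; last first.
  split=> //; first by rewrite !lev0_compc_lt.
  right; exists (tail d f), (tail d g), (tail d h).
  by rewrite !tail_compc_lt //; split=> //; apply: mcomp_tail.
subst m; split=> //.
  by rewrite !lev0_compc_eq /lo /hi !lev0_compc_eq.
left; rewrite !tail_compc_eq //.
have [w1 w2 t1 t2 tc] := comp_act m1; have [w1' w2' t1' t2' tc'] := comp_act m2.
have lt : d < d.+1 by [].
have VT l : valid d l -> valid d.+1 (tail d l) by apply: valid_tail.
have VI w : valid d.+1 (idc d.+1 w) by apply: valid_idc.
have x1 : bd true d (top f) = bd false d (top (act_top d g h)).
  by rewrite (src_cmp t1'); exact: mcomp_top m1.
have y1 : bd true d (top (act_top d f g)) = bd false d (bot h).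
  by rewrite (tgt_cmp t1) tail_top_tgt // (mcomp_bot m2).
have x2 := mcomp_top m1; have y2 := mcomp_bot m2.
have c1 := ccomp_star_idl lt tc' x1 (erefl (idc d.+1 (top f))).
have c2 := ccomp_star_idr lt tc y1 (erefl (idc d.+1 (bot h))).
(* Both tails concatenate [top f * top g * tail h], [top f * tail g * bot h] and
   [tail f * bot g * bot h]; [EA] concerns the middle one. *)
have EA : star d (act_top d f g) (idc d.+1 (bot h)) = star d (idc d.+1 (top f)) (act_bot d g h).
  by rewrite /act_top (@star_assoc _ d.+1) //; auto.
have E1 : act_top d (compc d d f g) h = star d (idc d.+1 (top f)) (act_top d g h).
  by rewrite {2}/act_top -(@star_assoc _ d.+1) ?star_idc //; auto.
have E2 : act_bot d (compc d d f g) h = cat d.+1 (star d (idc d.+1 (top f)) (act_bot d g h))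
    (star d (act_bot d f g) (idc d.+1 (bot h))).
  by rewrite {1}/act_bot tail_compc_eq // (star_cat_idr (x := bot h)) // EA.
have E3 : act_top d f (compc d d g h) = cat d.+1 (star d (idc d.+1 (top f)) (act_top d g h))
    (star d (idc d.+1 (top f)) (act_bot d g h)).
  by rewrite {1}/act_top tail_compc_eq // (star_cat_idl (x := top f)).
have E4 : act_bot d f (compc d d g h) = star d (act_bot d f g) (idc d.+1 (bot h)).
  by rewrite {2}/act_bot (@star_assoc _ d.+1) ?star_idc //; auto.
rewrite EA in c2; rewrite E1 E2 E3 E4 cat_assoc //.
Qed.

Lemma mcomp_unitl m d f : d <= m -> valid d f -> mcomp m d (bdc false m d f) f.
Proof. by move=> le vf; split; [exact: valid_bdc| |rewrite bdc_bdc_ge]. Qed.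

Lemma mcomp_unitr m d f : d <= m -> valid d f -> mcomp m d f (bdc true m d f).
Proof. by move=> le vf; split; [|exact: valid_bdc|rewrite bdc_bdc_ge]. Qed.

Lemma compc_unitl m d f : d <= m -> valid d f -> compc m d (bdc false m d f) f = f.
Proof.
pose E d p q := p = q \/ [/\ p = compc m d (bdc false m d q) q, d <= m & valid d q].
move=> le vf; apply: (@cyl_bisim C E _ d); last by right.
move=> {f le vf}d p f [->|[-> le vf]]; first by split=> //; left.
have mc := mcomp_unitl le vf; have hf := valid_head vf.
have [_ _ [e1 e2] [e3 e4]] := hf.
move: le; rewrite leq_eqVlt => /orP[/eqP ?|lt]; last first.
  split; try exact: cmp1l; first by rewrite lev0_compc_lt // lev0_bdc_lt.
  by right; rewrite tail_compc_lt // tail_bdc_lt //; split=> //; apply: valid_tail.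
subst m; split; try exact: cmp1l.
  by rewrite lev0_compc_eq {1}/lo lev0_bdc_eq /= /lo /hi; case: (lev f 0).
left; rewrite tail_compc_eq // /act_top /act_bot tail_bdc_eq //= star_idc //.
rewrite star1l //; [|exact: valid_tail|by rewrite tail_top_src].
by rewrite cat_idr //; apply: valid_tail.
Qed.

Lemma compc_unitr m d f : d <= m -> valid d f -> compc m d f (bdc true m d f) = f.
Proof.
pose E d p q := p = q \/ [/\ p = compc m d q (bdc true m d q), d <= m & valid d q].
move=> le vf; apply: (@cyl_bisim C E _ d); last by right.
move=> {f le vf}d p f [->|[-> le vf]]; first by split=> //; left.
have mc := mcomp_unitr le vf; have hf := valid_head vf.
have [_ _ [e1 e2] [e3 e4]] := hf.
move: le; rewrite leq_eqVlt => /orP[/eqP ?|lt]; last first.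
  split; try exact: cmp1r; first by rewrite lev0_compc_lt.
  by right; rewrite tail_compc_lt // tail_bdc_lt //; split=> //; apply: valid_tail.
subst m; split; try exact: cmp1r.
  by rewrite lev0_compc_eq {1}/hi lev0_bdc_eq /= /lo /hi; case: (lev f 0).
left; rewrite tail_compc_eq // /act_top /act_bot tail_bdc_eq //= star_idc //.
rewrite star1r //; [|exact: valid_tail|by rewrite tail_top_tgt].
by rewrite cat_idl //; apply: valid_tail.
Qed.

End CylinderComp.

(** * Omega-functors and maps of one-sorted omega-categories *)

Definition id_functor (X : omegaCat) : omegaFunctor X X.
Proof.
refine (@OmegaFunctor X X (@GlobMap X X (fun n x => x) (fun _ _ => erefl) (fun _ _ => erefl)) _ _).
- by [].
- by move=> m n h x y e e'; rewrite (proof_irrelevance _ e e').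
Defined.

Lemma gmap_src_at (G H : globSet) (f : globMap G H) m n (h : dlt m n) (x : cell G n) :
  gmap f (src_at h x) = src_at h (gmap f x).
Proof. by elim: h x => /= [|n' h IH] x; rewrite ?IH gmap_src. Qed.

Lemma gmap_tgt_at (G H : globSet) (f : globMap G H) m n (h : dlt m n) (x : cell G n) :
  gmap f (tgt_at h x) = tgt_at h (gmap f x).
Proof. by elim: h x => /= [|n' h IH] x; rewrite ?IH gmap_tgt. Qed.

Lemma gmap_composable (G H : globSet) (f : globMap G H) m n (h : dlt m n) (x y : cell G n) :
  tgt_at h x = src_at h y -> tgt_at h (gmap f x) = src_at h (gmap f y).
Proof. by move=> e; rewrite -gmap_src_at -gmap_tgt_at e. Qed.

Definition comp_functor (X Y Z : omegaCat) (f : omegaFunctor X Y) (g : omegaFunctor Y Z) :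
  omegaFunctor X Z.
Proof.
refine (@OmegaFunctor X Z (@GlobMap X Z (fun n x => gmap g (gmap f x))
    (fun n x => etrans (congr1 _ (gmap_src f x)) (gmap_src g _))
    (fun n x => etrans (congr1 _ (gmap_tgt f x)) (gmap_tgt g _))) _ _) => /=.
- by move=> n x; rewrite !fmap_unit.
- move=> m n h x y e e'.
  by rewrite (fmap_comp e (gmap_composable f e)) (fmap_comp (gmap_composable f e) e').
Defined.

Record os_map (C D : osCat) := OsMap {
  os_fun :> C -> D;
  os_bd : forall c m x, os_fun (bd c m x) = bd c m (os_fun x);
  os_cmp : forall m x y, bd true m x = bd false m y ->
    os_fun (cmp m x y) = cmp m (os_fun x) (os_fun y) }.

Lemma os_is_cell (C D : osCat) (f : os_map C D) n x : is_cell n x -> is_cell n (f x).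
Proof. by rewrite /is_cell -os_bd => ->. Qed.

Definition typed_glob_map (C D : osCat) (f : os_map C D) : globMap (typed_glob C) (typed_glob D).
Proof.
refine (@GlobMap (typed_glob C) (typed_glob D)
  (fun n x => exist _ (f (sval x)) (os_is_cell f (proj2_sig x))) _ _).
- by move=> n x; apply: sig_eq; apply: os_bd.
- by move=> n x; apply: sig_eq; apply: os_bd.
Defined.

Definition typed_map (C D : osCat) (f : os_map C D) : omegaFunctor (typed C) (typed D).
Proof.
refine (@OmegaFunctor (typed C) (typed D) (typed_glob_map f) _ _).
- by move=> n x; apply: sig_eq.
- by move=> m n h x y e e'; apply: sig_eq; apply: os_cmp; apply: typed_composable e.
Defined.

(** * Comparison of the two presentations *)

Section Eval.
Variable X : omegaCat.
Implicit Types F G : one_sorted X.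

Lemma one_sorted_eq F G : (forall k b, sval F k b = sval G k b) -> F = G.
Proof. by move=> e; apply: sig_eq; apply: fam_eq. Qed.

Lemma sval_bd c m F : sval (bd c m F) = fam_bd c m (sval F).
Proof. by []. Qed.

Lemma sval_cmp m F G : bd true m F = bd false m G -> sval (cmp m F G) = fam_cmp m (sval F) (sval G).
Proof. move=> e; exact: sub_cmpE e. Qed.

Lemma sval_src F k b : src (sval F k.+1 b) = sval F k false.
Proof. by case: (proj2_sig F k b). Qed.

Lemma sval_tgt F k b : tgt (sval F k.+1 b) = sval F k true.
Proof. by case: (proj2_sig F k b). Qed.

(** The component in dimension [n] determines the others: lower ones are its iterated sources and
    targets, and higher ones are units on it because the family is an [n]-cell. *)
Lemma one_sorted_cell_eq n F G : is_cell n F -> is_cell n G ->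
  sval F n false = sval G n false -> F = G.
Proof.
have src_eq k : forall b b', sval F k b = sval G k b' -> forall j c, j < k -> sval F j c = sval G j c.
  elim: k => // k IH b b' e j c; rewrite ltnS leq_eqVlt => /orP[/eqP ->|lt].
    by case: c; rewrite -?(sval_src F k b) -?(sval_tgt F k b) -?(sval_src G k b') -?(sval_tgt G k b') e.
  by apply: (IH false false) => //; rewrite -(sval_src F k b) -(sval_src G k b') e.
move=> cF cG e; apply: one_sorted_eq => k b.
rewrite -cF -cG !sval_bd; case: (ltngtP k n) => [lt|gt|->].
- by rewrite !fam_bd_lt //; apply: src_eq e _ _ lt.
- by rewrite !(fam_bdE _ _ _ (lt_dlt gt)) e.
- by rewrite !fam_bd_eq.
Qed.

Lemma sval_unit n F : is_cell n F -> sval F n.+1 false = unit1 (sval F n false).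
Proof. by move=> cF; rewrite -{1}cF sval_bd (fam_bdE _ _ _ dltS). Qed.

Definition eval_glob : globMap (typed (one_sorted X)) X.
Proof.
refine (@GlobMap (typed (one_sorted X)) X (fun n x => sval (sval x) n false) _ _).
- by move=> n [F cF]; rewrite sval_src; apply: fam_bd_eq.
- by move=> n [F cF]; rewrite sval_tgt; apply: fam_bd_eq.
Defined.

Definition eval : omegaFunctor (typed (one_sorted X)) X.
Proof.
refine (@OmegaFunctor (typed (one_sorted X)) X eval_glob _ _).
- by move=> n [F cF]; apply: sval_unit.
- move=> m n h x y e e'; have e1 := typed_composable e.
  by rewrite [LHS](congr1 (fun K => K n false) (sval_cmp e1)) (fam_cmpE _ _ _ h) (comp_or_leftE e').
Defined.

Lemma src_at_tgt_at l m n (h : dlt l m) (k : dlt m n) (x : cell X n) :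
  src_at h (tgt_at k x) = src_at (dlt_trans h k) x.
Proof.
elim: k x => [|n' k IH] x /=; first by rewrite src_at_dltW.
by rewrite tgt_at_dltW IH.
Qed.

Lemma tgt_at_src_at l m n (h : dlt l m) (k : dlt m n) (x : cell X n) :
  tgt_at h (src_at k x) = tgt_at (dlt_trans h k) x.
Proof.
elim: k x => [|n' k IH] x /=; first by rewrite tgt_at_dltW.
by rewrite -src_at_dltW IH.
Qed.

(** Comparing [k] and [n] both ways isolates the case [k = n], the only one with a transport;
    [globe_eq] removes it, equality proofs between naturals being unique. *)
Definition globe n (x : cell X n) : family X := fun k b =>
  match dlt_or_ge k n, dlt_or_ge n k with
  | inl h, _ => if b then tgt_at h x else src_at h x
  | inr _, inl h => unit_at (@unit1 X) h x
  | inr le, inr ge => ecast m (cell X m) (anti_leq (introT andP (conj le ge))) x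
  end.

Lemma globe_lt n (x : cell X n) k b (h : dlt k n) :
  globe x k b = if b then tgt_at h x else src_at h x.
Proof.
rewrite /globe; case: dlt_or_ge => [h'|le]; first by rewrite (dlt_irr h' h).
by have := dlt_lt h; lia.
Qed.

Lemma globe_gt n (x : cell X n) k b (h : dlt n k) : globe x k b = unit_at (@unit1 X) h x.
Proof.
rewrite /globe; case: dlt_or_ge => [h'|le].
  by have := dlt_lt h; have := dlt_lt h'; lia.
case: dlt_or_ge => [h'|ge]; first by rewrite (dlt_irr h' h).
by have := dlt_lt h; lia.
Qed.

Lemma globe_eq n (x : cell X n) b : globe x n b = x.
Proof.
rewrite /globe; case: dlt_or_ge => [h|le]; first by have := dlt_lt h; lia.
by rewrite (eq_irrelevance (anti_leq _) (erefl n)).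
Qed.

Lemma globe_globular n (x : cell X n) : globular (globe x).
Proof.
move=> k b; case: (ltngtP k.+1 n) => [lt|gt|e].
- have h := lt_dlt lt; rewrite (globe_lt _ _ h) !(globe_lt _ _ (dlt_trans dltS h)).
  rewrite -[src _]/(src_at dltS _) -[tgt _]/(tgt_at dltS _).
  by case: b; rewrite ?src_at_tgt_at ?tgt_at_src_at ?src_at_trans ?tgt_at_trans.
- move: gt; rewrite ltnS leq_eqVlt => /orP[/eqP ?|lt].
    by subst n; rewrite (globe_gt _ _ dltS) !globe_eq /= src_unit tgt_unit.
  by rewrite (globe_gt _ _ (dltW (lt_dlt lt))) !(globe_gt _ _ (lt_dlt lt)) /= src_unit tgt_unit.
- by subst n; rewrite globe_eq !(globe_lt _ _ dltS).
Qed.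

Definition emb n (x : cell X n) : one_sorted X := exist _ (globe x) (globe_globular x).

Lemma emb_is_cell n (x : cell X n) : is_cell n (emb x).
Proof.
apply: one_sorted_eq => k b; rewrite sval_bd /=; case: (ltngtP k n) => [lt|gt|->].
- by rewrite fam_bd_lt.
- by rewrite (fam_bdE _ _ _ (lt_dlt gt)) (globe_gt _ _ (lt_dlt gt)) globe_eq.
- by rewrite fam_bd_eq !globe_eq.
Qed.

Lemma emb_eval n F : is_cell n F -> emb (sval F n false) = F.
Proof.
by move=> cF; apply: one_sorted_cell_eq cF _; [exact: emb_is_cell|rewrite /= globe_eq].
Qed.

Lemma emb_side n c (x : cell X n.+1) : bd c n (emb x) = emb (if c then tgt x else src x).
Proof.
apply: (@one_sorted_cell_eq n); [exact: is_cell_bd|exact: emb_is_cell|].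
by rewrite sval_bd fam_bd_eq /= globe_eq (globe_lt _ _ dltS).
Qed.

Lemma emb_unit n (x : cell X n) : emb (unit1 x) = emb x.
Proof.
apply: (@one_sorted_cell_eq n.+1); first exact: emb_is_cell.
  exact: is_cell_le (emb_is_cell x) _.
by rewrite /= globe_eq (globe_gt _ _ dltS).
Qed.

Lemma emb_composable m n (h : dlt m n) (x y : cell X n) : tgt_at h x = src_at h y ->
  bd true m (emb x) = bd false m (emb y).
Proof.
move=> e; apply: (@one_sorted_cell_eq m); [exact: is_cell_bd..|].
by rewrite !sval_bd !fam_bd_eq /= !(globe_lt _ _ h).
Qed.

Lemma emb_comp m n (h : dlt m n) (x y : cell X n) (e : tgt_at h x = src_at h y) :
  emb (comp h x y e) = cmp m (emb x) (emb y).
Proof.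
have e' := emb_composable e.
apply: (@one_sorted_cell_eq n); first exact: emb_is_cell.
  by apply: is_cell_cmp => //; [exact: dlt_lt h|exact: emb_is_cell..].
by rewrite sval_cmp // (fam_cmpE _ _ _ h) /= !globe_eq comp_or_leftE.
Qed.

Definition embed_glob : globMap X (typed (one_sorted X)).
Proof.
refine (@GlobMap X (typed (one_sorted X)) (fun n x => exist _ (emb x) (emb_is_cell x)) _ _).
- by move=> n x; apply: sig_eq; apply: esym (emb_side false x).
- by move=> n x; apply: sig_eq; apply: esym (emb_side true x).
Defined.

Definition embed : omegaFunctor X (typed (one_sorted X)).
Proof.
refine (@OmegaFunctor X (typed (one_sorted X)) embed_glob _ _).
- by move=> n x; apply: sig_eq; apply: emb_unit.
- by move=> m n h x y e e'; apply: sig_eq; apply: emb_comp.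
Defined.

Lemma eval_embed n (x : cell X n) : gmap eval (gmap embed x) = x.
Proof. exact: globe_eq. Qed.

(** If [v] is an inverse of [u], then [emb v] is one of [emb u]: [emb] turns composites into [cmp]
    and absorbs units, so links go to links. This carries the data of a weak equivalence to the
    one-sorted side. *)
Lemma reversible_emb n (u : cell X n.+1) : reversible u -> rev n (emb u).
Proof.
pose Q k (U : one_sorted X) := exists u : cell X k.+1, U = emb u /\ reversible u.
move=> ru; have : Q n (emb u) by exists u.
apply: rev_coind => {n u ru}k _ [u [-> ru]]; split; first exact: emb_is_cell.
case: ru => v euv evu [a [sa ta ra]] [b [sb tb rb]].
exists (emb v); split; first exact: emb_is_cell.
- by rewrite !emb_side euv.
- by rewrite !emb_side evu.
- exists (emb a); split; [by exists a| |].
    by rewrite emb_side sa emb_comp.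
  by rewrite !emb_side ta emb_unit.
- exists (emb b); split; [by exists b| |].
    by rewrite emb_side sb emb_comp.
  by rewrite !emb_side tb emb_unit.
Qed.

Lemma omega_equiv_emb n (x y : cell X n) : omega_equiv x y -> equiv n (emb x) (emb y).
Proof.
by move=> [u [<- <- ru]]; exists (emb u); rewrite !emb_side; split=> //; apply: reversible_emb.
Qed.

End Eval.

(** * Functoriality of the one-sorted omega-category *)

Section OneSortedMap.
Variables (X Y : omegaCat) (f : omegaFunctor X Y).

Lemma map_globular (F : family X) : globular F -> globular (fun k b => gmap f (F k b)).
Proof. by move=> g k b; rewrite -gmap_src -gmap_tgt; case: (g k b) => -> ->. Qed.

Lemma gmap_unit_at m n (h : dlt m n) (x : cell X m) :
  gmap f (unit_at (@unit1 X) h x) = unit_at (@unit1 Y) h (gmap f x).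
Proof. by elim: h => /= [|n' h IH]; rewrite fmap_unit ?IH. Qed.

Definition map_fun (F : one_sorted X) : one_sorted Y := exist _ _ (map_globular (proj2_sig F)).

Lemma map_bd c m F : map_fun (bd c m F) = bd c m (map_fun F).
Proof.
apply: one_sorted_eq => k b; rewrite /= /fam_bd /=.
by case: dlt_or_ge => h; [rewrite gmap_unit_at | case: ifP].
Qed.

Lemma map_cmp m F G : bd true m F = bd false m G ->
  map_fun (cmp m F G) = cmp m (map_fun F) (map_fun G).
Proof.
move=> e; have e' : bd true m (map_fun F) = bd false m (map_fun G) by rewrite -!map_bd e.
apply: one_sorted_eq => k b.
rewrite (sval_cmp e') -[LHS]/(gmap f (sval (cmp m F G) k b)) (sval_cmp e) /fam_cmp /=.
case: dlt_or_ge => [h|_]; last by case: b.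
have eh : tgt_at h (sval F k b) = src_at h (sval G k b).
  apply: (fam_composable_at b b h (proj2_sig F) (proj2_sig G)); exact: (congr1 (fun H => sval H) e).
by rewrite (comp_or_leftE eh) (comp_or_leftE (gmap_composable f eh)) (fmap_comp eh (gmap_composable f eh)).
Qed.

Definition one_sorted_map : os_map (one_sorted X) (one_sorted Y) := OsMap map_bd map_cmp.

Lemma map_emb n (x : cell X n) : one_sorted_map (emb x) = emb (gmap f x).
Proof.
apply: (@one_sorted_cell_eq _ n); [exact/os_is_cell/emb_is_cell|exact: emb_is_cell|].
by rewrite /= !globe_eq.
Qed.

End OneSortedMap.

(** * The path object *)

Section Lifting.
Variable C : osCat.
Implicit Types (x y z : C) (f g : cyl C).

Lemma idc_cell d x : is_cell d x -> idc d x = Cyl x x (fun _ => (x, x)).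
Proof. by move=> cx; apply: cyl_eq => //= j; rewrite !(is_cellE _ cx) //; lia. Qed.

(** With ends of dimension [d] the tail is the identity cylinder on [u]. At depth 0 this turns an
    equivalence of objects into a cylinder, and in [lift_cyl] it supplies the last side of a
    filler. *)
Lemma valid_const d x y u : is_cell d x -> is_cell d y -> rev d u ->
  bd false d u = x -> bd true d u = y -> valid d (Cyl x y (fun _ => (u, u))).
Proof.
move=> cx cy ru su tu; have cu := closed_cell (rev_closedP C) ru.
pose Q e f := e = d /\ f = Cyl x y (fun _ => (u, u)) \/ valid e f.
apply: (@valid_coind C Q); last by left.
move=> e f [[-> ->]|vf]; last by split; [exact: valid_head | right; exact: valid_tail].
split; first by split; rewrite /lo /hi /= ?(is_cellE _ cx) ?(is_cellE _ cy).
right; have -> : tail d (Cyl x y (fun _ => (u, u))) = idc d.+1 u.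
  by rewrite idc_cell // /tail /lo /hi /= -{1}su -tu cmp1l cmp1r.
exact: valid_idc.
Qed.

Lemma cell_cyl_lev d f j : bdc false d d f = f -> lev f j = (lo f, lo f).
Proof. by move=> e; rewrite -{1}e /= bd_lev_eq. Qed.

(** [S] stands for the cells that the top of the filler may take: it is the image
    of the weak equivalence at depth 0 and is whiskered by [hi f] at each step. *)
Lemma lift_cyl p d (S : C -> Prop) f f' v : let n := p + d in
  valid d f -> valid d f' -> bdc false n d f = f -> bdc false n d f' = f' ->
  (forall c m, m < n -> bd c m (top f) = bd c m (top f')) ->
  (forall c m, d <= m -> m < n -> bdc c m d f = bdc c m d f') ->
  is_cell n.+1 v -> bd false n v = bot f -> bd true n v = bot f' ->
  (forall w, is_cell n.+1 w -> bd false n w = top f -> bd true n w = top f' ->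
     exists z, [/\ S z, is_cell n.+1 z, bd false n z = top f, bd true n z = top f'
               & equiv n.+1 z w]) ->
  exists g, [/\ S (top g), bot g = v, valid d g,
    bdc false n d g = f /\ bdc true n d g = f' & bdc false n.+1 d g = g].
Proof.
elim: p d S f f' v => [|p IH] d S f f' v n vf vf' cf cf' ptop par cv sv tv full.
  rewrite {}/n add0n in cf cf' ptop par cv sv tv full *.
  have hf := valid_head vf; have hf' := valid_head vf'.
  have [r _ [e1 e2] _] := hf; have [r' _ [e1' e2'] _] := hf'.
  have cx : is_cell d (top f) by rewrite -cf; apply: is_cell_bd.
  have cy : is_cell d (bot f) by rewrite -cf; apply: is_cell_bd.
  have cx' : is_cell d (top f') by rewrite -cf'; apply: is_cell_bd.
  have cy' : is_cell d (bot f') by rewrite -cf'; apply: is_cell_bd.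
  rewrite (is_cellE _ cx) // (is_cellE _ cy) // in e1 e2.
  rewrite (is_cellE _ cx') // (is_cellE _ cy') // in e1' e2'.
  have cu := closed_cell (rev_closedP C) r; have cu' := closed_cell (rev_closedP C) r'.
  have [t [rt ut tu _ eq]] := rev_inv r'; have ct := closed_cell (rev_closedP C) rt.
  have uv : bd true d (lo f) = bd false d v by rewrite e2 sv.
  have vt : bd true d v = bd false d t by rewrite tv -ut.
  have cuv : is_cell d.+1 (cmp d (lo f) v) by apply: is_cell_cmp.
  have uvt : bd true d (cmp d (lo f) v) = bd false d t by rewrite tgt_cmp.
  have cw := is_cell_cmp uvt (ltnSn d) cuv ct.
  (* Up to equivalence the top must go along [lo f], then [v], then back along an inverse [t] of
     [lo f']. *)
  have [||z [Sz cz sz tz zw]] := full (cmp d (cmp d (lo f) v) t) cw.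
  - by rewrite !src_cmp.
  - by rewrite tgt_cmp // tu.
  have zu : bd true d z = bd false d (lo f') by rewrite tz e1'.
  have czu : is_cell d.+1 (cmp d z (lo f')) by apply: is_cell_cmp.
  (* The reversible [U] absorbs the error made by replacing that composite with [z]; it becomes the
     side of dimension [d.+2], so the bottom stays exactly [v]. *)
  have [U [rU sU tU]] : equiv d.+1 (cmp d z (lo f')) (cmp d (lo f) v).
    apply: (@equiv_trans _ _ _ (cmp d (cmp d (cmp d (lo f) v) t) (lo f'))).
      by apply: equiv_cmp => //; apply: equiv_refl.
    rewrite cmpA // -[X in equiv _ _ X](cmp1r d) (tgt_cmp uv) tv -e2'.
    apply: equiv_cmp => //; last exact: equiv_refl.
    by rewrite src_cmp.
  exists (Cyl z v (fun j => if j is _.+1 then (U, U) else (lo f, lo f'))); split=> //=.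
  - pose Q e g := (e = d /\ g = Cyl z v (fun j => if j is _.+1 then (U, U) else (lo f, lo f'))) \/
      valid e g.
    apply: (@valid_coind C Q); last by left.
    move=> e g [[-> ->]|vg]; last by split; [exact: valid_head | right; exact: valid_tail].
    split; last by right; apply: valid_const.
    by split; rewrite /lo /hi //= ?sz ?tz ?sv ?tv.
  - split; apply: cyl_eq => // j; rewrite /= bd_lev_eq.
      by rewrite (cell_cyl_lev j cf).
    by rewrite (cell_cyl_lev j cf').
  - apply: cyl_eq => [||j]; [exact: is_cellE cz _|exact: is_cellE cv _|].
    by rewrite /= bd_lev_lt //; case: j => // j; rewrite bd_lev_eq.
have dn : d < n by rewrite /n; lia.
have hf := valid_head vf; have hf' := valid_head vf'.
have [r1 r2 [e1 e2] [e3 e4]] := hf; have [r1' r2' [e1' e2'] [e3' e4']] := hf'.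
(* As [d < n], parallelism forces [f] and [f'] to share both sides of dimension [d.+1], and these
   are then the sides of the filler. *)
have side_eq c : side c f = side c f'.
  by have := congr1 (fun g => lo g) (par c d (leqnn d) dn); rewrite /lo !lev0_bdc_eq.
have el : lo f = lo f' := side_eq false.
have eh : hi f = hi f' := side_eq true.
have cl := closed_cell (rev_closedP C) r1; have ch := closed_cell (rev_closedP C) r2.
have cx : is_cell n (top f) by rewrite -cf; apply: is_cell_bd.
have cx' : is_cell n (top f') by rewrite -cf'; apply: is_cell_bd.
have xh := head_top_hi hf; have xh' := head_top_hi hf'; rewrite -eh in xh'.
have ly := head_lo_bot hf; have ly' := head_lo_bot hf'; rewrite -el in ly'.
have lv : bd true d (lo f) = bd false d v.
  by rewrite ly -sv bd_lt.
have E : n = p + d.+1 by rewrite /n addSnnS.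
have Lc c i : d < i -> bd c i (lo f) = lo f by move=> lt; apply: is_cellE cl lt.
have Hc c i : d < i -> bd c i (hi f) = hi f by move=> lt; apply: is_cellE ch lt.
(* A filler of the tails comes from a cylinder at depth [d] only if its top factors through [hi f];
   [S1] remembers the factor [z]. *)
pose S1 z1 := exists z, [/\ S z, is_cell n.+1 z, bd false n z = top f, bd true n z = top f'
  & z1 = cmp d z (hi f)].
have [||||||||||g [[z [Sz cz sz tz zE]] gv vg [sg tg] cg]] :=
  IH d.+1 S1 (tail d f) (tail d f') (cmp d (lo f) v).
- exact: valid_tail.
- exact: valid_tail.
- by rewrite -E -tail_bdc_lt // cf.
- by rewrite -E -tail_bdc_lt // cf'.
- move=> c m; rewrite -E => lt /=; rewrite -eh; case: (ltngtP m d) => [md|md|->].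
  + by rewrite !bd_cmp_lt // ptop.
  + by rewrite !bd_cmp_gt // ptop.
  + by case: c; rewrite ?tgt_cmp // ?src_cmp // ptop.
- by move=> c m dm; rewrite -E => mn; rewrite -!tail_bdc_lt // par // ltnW.
- by rewrite -E; apply: is_cell_cmp => //; [exact: ltnW|apply: is_cell_le cl _; exact: ltnW].
- by rewrite -E bd_cmp_gt // Lc // sv.
- by rewrite -E bd_cmp_gt // Lc // tv /= -el.
(* Fullness for [S1]: divide [w] by [hi f], approximate the quotient by a cell of [S], and whisker
   back; both steps are exact up to equivalence. *)
- rewrite -E => w cw sw tw.
  have [|||||w0 [cw0 sw0 tw0 ew0]] := @divide_right p C d (hi f) (top f) (top f') w r2 cx cx'.
  + by move=> c; apply: ptop.
  + exact: xh.
  + exact: cw.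
  + exact: sw.
  + by rewrite tw /= -eh.
  have [z [Sz cz sz tz zw]] := full w0 cw0 sw0 tw0.
  have zh : bd true d z = bd false d (hi f) by rewrite -xh' -tz bd_lt.
  exists (cmp d z (hi f)); split.
  + by exists z.
  + by apply: is_cell_cmp => //; [exact: ltnW|apply: is_cell_le ch _; exact: ltnW].
  + by rewrite bd_cmp_gt // Hc // sz.
  + by rewrite bd_cmp_gt // Hc // tz /= -eh.
  + apply: equiv_trans ew0; apply: equiv_cmp => //; first exact: ltnW.
    by apply: equiv_refl; apply: is_cell_le ch _; exact: ltnW.
rewrite -E in sg tg cg.
pose h := Cyl z v (fun j => if j is i.+1 then lev g i else lev f 0).
have th : tail d h = g by apply: cyl_eq => /=; rewrite ?zE ?gv.
have l0 : lev f 0 = lev f' 0.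
  by rewrite [LHS]surjective_pairing [RHS]surjective_pairing -/(lo f) -/(hi f) -/(lo f') -/(hi f') el eh.
exists h; split=> //.
- pose Q e k := (e = d /\ k = h) \/ valid e k.
  apply: (@valid_coind C Q); last by left.
  move=> e k [[-> ->]|vk]; last by split; [exact: valid_head | right; exact: valid_tail].
  split; last by right; rewrite th.
  have S0 c : bd c d z = bd c d (if c then top f' else top f).
    by case: c; rewrite -?sz -?tz bd_lt.
  have V0 c : bd c d v = bd c d (if c then bot f' else bot f).
    by case: c; rewrite -?sv -?tv bd_lt.
  split=> //=; rewrite !S0 !V0 /lo /hi /= -/(lo f) -/(hi f) //.
  by rewrite eh.
- split.
  + apply: cyl_eq => // j; rewrite /= bd_lev_lt //; case: j => // j.
    by have := congr1 (fun k => lev k j) sg.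
  + apply: cyl_eq => // j; rewrite /= bd_lev_lt //; case: j => // j.
    by have := congr1 (fun k => lev k j) tg.
- apply: cyl_eq => [||j]; [exact: is_cellE cz _|exact: is_cellE cv _|].
  rewrite /= bd_lev_lt; last exact: ltnW.
  by case: j => // j; have := congr1 (fun k => lev k j) cg.
Qed.

End Lifting.

(** * Pairs of a cell and a cylinder over it, with their projections *)

Section Path.
Variables (A B : osCat) (i : os_map A B).
Implicit Types z w : A * cyl B.

Definition path_ok z := top z.2 = i z.1 /\ valid 0 z.2.
Definition path_bd c m z := (bd c m z.1, bdc c m 0 z.2).
Definition path_cmp m z w := (cmp m z.1 w.1, compc m 0 z.2 w.2).

Lemma path_comp m z w : path_ok z -> path_ok w -> path_bd true m z = path_bd false m w ->
  bd true m z.1 = bd false m w.1 /\ mcomp m 0 z.2 w.2.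
Proof. by move=> [_ vz] [_ vw] [e1 e2 e3 e4]; split=> //; split=> //; apply: cyl_eq => //= j; rewrite e4. Qed.

Definition path : osCat.
Proof.
refine (@sub_os (A * cyl B) path_ok path_bd path_cmp _ _ _ _ _ _ _ _ _ _ _ _).
- move=> c m z [e v]; split; first by rewrite /= e os_bd.
  exact: valid_bdc.
- move=> m z w oz ow /(path_comp oz ow)[e mc]; case: oz ow => [ez _] [ew _].
  by split; [rewrite /= ez ew os_cmp | exact: valid_compc].
- by move=> c c' m n z _ lt; congr pair; [exact: bd_lt | exact: bdc_bdc_lt].
- by move=> c c' m n z _ le; congr pair; [exact: bd_ge | exact: bdc_bdc_ge].
- move=> c n m z w oz ow /(path_comp oz ow)[e mc] lt.
  by congr pair; [exact: bd_cmp_lt | exact: bdc_compc_lt].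
- move=> m z w oz ow /(path_comp oz ow)[e mc].
  by congr pair; [exact: src_cmp | exact: bdc_compc_eq].
- move=> m z w oz ow /(path_comp oz ow)[e mc].
  by congr pair; [exact: tgt_cmp | exact: bdc_compc_eq].
- move=> c n m z w oz ow /(path_comp oz ow)[e mc] lt.
  by congr pair; [exact: bd_cmp_gt | exact: bdc_compc_gt].
- move=> m x y z ox oy oz /(path_comp ox oy)[e mc] /(path_comp oy oz)[e' mc'].
  by congr pair; [exact: cmpA | exact: compc_assoc].
- move=> m [a f] [e v]; congr pair; [exact: cmp1l | exact: compc_unitl].
- move=> m [a f] [e v]; congr pair; [exact: cmp1r | exact: compc_unitr].
- move=> l m x y z w ox oy oz ow lt /(path_comp ox oy)[e mc] /(path_comp oz ow)[e' mc']
    /(path_comp ox oz)[e'' mc''].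
  by congr pair; [exact: cmp_interchange | exact: compc_interchange].
Defined.

Lemma path_cmpE m (z w : path) : bd true m z = bd false m w ->
  sval (cmp m z w) = path_cmp m (sval z) (sval w).
Proof. move=> e; exact: sub_cmpE e. Qed.

Definition path_start : os_map path A.
Proof.
refine (@OsMap path A (fun z : path => (sval z).1) _ _); first by [].
by move=> m x y e; rewrite path_cmpE.
Defined.

Definition path_end : os_map path B.
Proof.
refine (@OsMap path B (fun z : path => bot (sval z).2) _ _); first by [].
by move=> m x y e; rewrite path_cmpE.
Defined.

Lemma path_const_ok (a : A) : path_ok (a, idc 0 (i a)).
Proof. by split=> //; apply: valid_idc. Qed.

Definition path_const : os_map A path.
Proof.
refine (@OsMap A path (fun a => exist _ _ (path_const_ok a)) _ _).
- by move=> c m a; apply: sig_eq; congr pair; rewrite /= os_bd bdc_idc.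
- move=> m a a' e.
  have e' : bd true m (i a) = bd false m (i a') by rewrite -!os_bd e.
  apply: sig_eq; rewrite path_cmpE; last first.
    by apply: sig_eq; congr pair => //; rewrite /= !bdc_idc // e'.
  by congr pair; rewrite /= os_cmp // compc_idc.
Defined.

Hypothesis ess_surj : forall y : B, is_cell 0 y -> exists x : A, is_cell 0 x /\ equiv 0 (i x) y.

Hypothesis weak_full : forall n (x x' : A) (v : B), is_cell n x -> is_cell n x' ->
  (forall c m, m < n -> bd c m x = bd c m x') ->
  is_cell n.+1 v -> bd false n v = i x -> bd true n v = i x' ->
  exists u, [/\ is_cell n.+1 u, bd false n u = x, bd true n u = x' & equiv n.+1 (i u) v].

Lemma path_end_surj (y : B) : is_cell 0 y ->
  exists z : path, is_cell 0 z /\ path_end z = y.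
Proof.
move=> cy; have [x [cx [u [ru su tu]]]] := ess_surj cy.
have v : valid 0 (Cyl (i x) y (fun _ => (u, u))).
  by apply: valid_const => //; apply: os_is_cell.
exists (exist path_ok (x, Cyl (i x) y (fun _ => (u, u))) (conj erefl v)); split=> //.
apply: sig_eq; congr pair => //; apply: cyl_eq => //= [|j]; last exact: bd_lev_eq.
exact: os_is_cell.
Qed.

(** This is [lift_cyl] at depth 0, with [S] the image of the cells from [a] to [a']: weak fullness
    finds the top up to equivalence, while the bottom is [v] on the nose. *)
Lemma path_end_full n (z z' : path) (v : B) : is_cell n z -> is_cell n z' ->
  (forall c m, m < n -> bd c m z = bd c m z') ->
  is_cell n.+1 v -> bd false n v = path_end z -> bd true n v = path_end z' ->
  exists w : path, [/\ is_cell n.+1 w, bd false n w = z, bd true n w = z' & path_end w = v].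
Proof.
case: z z' => [[a f] [/= tf vf]] [[a' f'] [/= tf' vf']] cz cz' par cv sv tv.
have [ca cf] : is_cell n a /\ bdc false n 0 f = f.
  by have e := congr1 (fun z : path => sval z) cz; split; [exact: (congr1 fst e) | exact: (congr1 snd e)].
have [ca' cf'] : is_cell n a' /\ bdc false n 0 f' = f'.
  by have e := congr1 (fun z : path => sval z) cz'; split; [exact: (congr1 fst e) | exact: (congr1 snd e)].
have para c m : m < n -> bd c m a = bd c m a'.
  by move=> lt; have e := congr1 (fun z : path => sval z) (par c m lt); exact: (congr1 fst e).
have parf c m : m < n -> bdc c m 0 f = bdc c m 0 f'.
  by move=> lt; have e := congr1 (fun z : path => sval z) (par c m lt); exact: (congr1 snd e).
pose S x := exists u, [/\ is_cell n.+1 u, bd false n u = a, bd true n u = a' & x = i u].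
have n0 : n + 0 = n by rewrite addn0.
have [||||||||g [[u [cu su tu gu]] gv vg [sg tg] cg]] := @lift_cyl B n 0 S f f' v vf vf';
  rewrite ?n0 //.
- by move=> c m lt; rewrite tf tf' -!os_bd para.
- by move=> c m _; apply: parf.
- move=> w cw; rewrite tf tf' => sw tw.
  have [u [cu su tu e]] := weak_full ca ca' para cw sw tw.
  exists (i u); split=> //.
  + by exists u.
  + exact: os_is_cell.
  + by rewrite -os_bd su.
  + by rewrite -os_bd tu.
rewrite n0 in sg tg cg.
exists (exist path_ok (u, g) (conj gu vg)); split=> //; apply: sig_eq; congr pair => //.
Qed.

End Path.

(** * Strict sphere filling and the right lifting property *)

Section TrivialFibrations.
Variables (X Y : omegaCat) (p : omegaFunctor X Y).
Hypothesis surj0 : forall y : cell Y 0, exists x : cell X 0, gmap p x = y.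
Hypothesis full : forall n (x x' : cell X n), parallel x x' ->
  forall v : cell Y n.+1, src v = gmap p x -> tgt v = gmap p x' ->
  exists u : cell X n.+1, [/\ src u = x, tgt u = x' & gmap p u = v].

Lemma extend_sphere n (s : globMap (sphere_glob n) X) (z : cell X n) :
  (forall k (e : k.+1 = n), src (ecast m (cell X m) (esym e) z) = gmap s (false, eq_ltn e)) ->
  (forall k (e : k.+1 = n), tgt (ecast m (cell X m) (esym e) z) = gmap s (true, eq_ltn e)) ->
  exists r : globMap (globe_glob n) X,
    (forall k (c : sphere_cell n k), gmap r (gmap (sphere_incl n) c) = gmap s c) /\
    forall k (e : k = n), gmap r (inr e : cell (globe_glob n) k) = ecast m (cell X m) (esym e) z.
Proof.
move=> sz tz.
pose r k (c : globe_cell n k) := match c with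
  | inl d => gmap s (d : cell (sphere_glob n) k)
  | inr e => ecast m (cell X m) (esym e) z end.
have rs k (c : cell (globe_glob n) k.+1) : r _ (src c) = src (r _ c).
  by case: c => [d|e] /=; [exact: (gmap_src s d) | rewrite sz].
have rt k (c : cell (globe_glob n) k.+1) : r _ (tgt c) = tgt (r _ c).
  by case: c => [d|e] /=; [exact: (gmap_tgt s d) | rewrite tz].
by exists (@GlobMap (globe_glob n) X r rs rt).
Qed.

Lemma fill_sphere n (s : globMap (sphere_glob n) X) (t : globMap (globe_glob n) Y) :
  (forall k (c : cell (sphere_glob n) k), gmap p (gmap s c) = gmap t (gmap (sphere_incl n) c)) ->
  exists r : globMap (globe_glob n) X,
    (forall k (c : sphere_cell n k), gmap r (gmap (sphere_incl n) c) = gmap s c) /\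
    (forall k (c : cell (globe_glob n) k), gmap p (gmap r c) = gmap t c).
Proof.
move=> ps.
(* A globular map on the globe is a map on the sphere together with one further [n]-cell, so a
   single cell has to be found. *)
suff [z [sz tz pz]] : exists z : cell X n, [/\
    forall k (e : k.+1 = n), src (ecast m (cell X m) (esym e) z) = gmap s (false, eq_ltn e),
    forall k (e : k.+1 = n), tgt (ecast m (cell X m) (esym e) z) = gmap s (true, eq_ltn e)
    & gmap p z = gmap t (inr erefl : cell (globe_glob n) n)].
  have [r [rl rr]] := extend_sphere sz tz; exists r; split=> // k [d|e].
    by rewrite (rl k d) (ps k d).
  by rewrite rr -(esymK e); move: (esym e) => {}e; case: k / e.
case: n s t ps => [|n] s t ps.
  (* For [n = 0] the sphere is empty and the boundary conditions are vacuous. *)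
  have [z pz] := surj0 (gmap t (inr erefl : cell (globe_glob 0) 0)).
  by exists z; split.
pose x := gmap s ((false, ltnSn n) : cell (sphere_glob n.+1) n).
pose x' := gmap s ((true, ltnSn n) : cell (sphere_glob n.+1) n).
have par : parallel x x'.
  rewrite /x /x'; case: n s {t ps x x'} => //= n s.
  rewrite -!gmap_src -!gmap_tgt; split; congr gmap; exact: sphere_globular.
pose v := gmap t (inr erefl : cell (globe_glob n.+1) n.+1).
have [||u [su tu pu]] := full par (v := v).
- by rewrite /v -gmap_src (ps n).
- by rewrite /v -gmap_tgt (ps n).
exists u; split=> // k e; case: (e) => ek; move: e; subst k => e.
  by rewrite (eq_irrelevance e erefl) su.
by rewrite (eq_irrelevance e erefl) tu.
Qed.

(** Freeness of the globe extends a filler on generators to an omega-functor; the two triangles hold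
    on generators, hence everywhere by uniqueness for the sphere and for the globe. *)
Lemma trivial_fibration_inj : inj genI p.
Proof.
move=> A B i [n [eta [theta [feta ftheta ie]]]] s t st.
pose sg : globMap (sphere_glob n) X := @GlobMap _ _ (fun k c => gmap s (gmap eta c))
  (fun k c => etrans (congr1 _ (gmap_src eta c)) (gmap_src s _))
  (fun k c => etrans (congr1 _ (gmap_tgt eta c)) (gmap_tgt s _)).
pose tg : globMap (globe_glob n) Y := @GlobMap _ _ (fun k c => gmap t (gmap theta c))
  (fun k c => etrans (congr1 _ (gmap_src theta c)) (gmap_src t _))
  (fun k c => etrans (congr1 _ (gmap_tgt theta c)) (gmap_tgt t _)).
have [|r [rs rt]] := @fill_sphere n sg tg; first by move=> k c; rewrite /= st ie.
have [[h hr] _] := ftheta X r; exists h; split.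
  have [_ uniq_s] := feta X sg.
  apply: (uniq_s (comp_functor i h) s) => k c.
  by rewrite /= ie hr (rs k c).
have [_ uniq_t] := ftheta Y tg.
by apply: (uniq_t (comp_functor h p) t) => k c; rewrite /= hr rt.
Qed.

End TrivialFibrations.

(** * Retractions of trivial cofibrations *)

Section Retraction.
Variables (A B : omegaCat) (i : omegaFunctor A B).
Hypothesis wi : weak_equivalence i.

Let ti := one_sorted_map i.

Lemma weq_ess_surj (y : one_sorted B) : is_cell 0 y ->
  exists x : one_sorted A, is_cell 0 x /\ equiv 0 (ti x) y.
Proof.
move=> cy; have [x /omega_equiv_emb e] := wi.1 (sval y 0 false).
by exists (emb x); split; [exact: emb_is_cell | rewrite map_emb -(emb_eval cy)].
Qed.

Lemma weq_weak_full n (x x' : one_sorted A) (v : one_sorted B) : is_cell n x -> is_cell n x' ->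
  (forall c m, m < n -> bd c m x = bd c m x') ->
  is_cell n.+1 v -> bd false n v = ti x -> bd true n v = ti x' ->
  exists u, [/\ is_cell n.+1 u, bd false n u = x, bd true n u = x' & equiv n.+1 (ti u) v].
Proof.
move=> cx cx' par cv sv tv.
have pp : parallel (sval x n false) (sval x' n false).
  case: n par {cx cx' cv sv tv} => //= n par; rewrite !sval_src !sval_tgt.
  have E c : sval x n c = sval x' n c.
    have := congr1 (fun F : one_sorted A => sval F n false) (par c n (ltnSn n)).
    by rewrite !sval_bd !fam_bd_eq.
  by split.
have vE c : sval v n c = gmap i (sval (if c then x' else x) n false).
  have <- : sval (bd c n v) n false = sval v n c by rewrite sval_bd fam_bd_eq.
  by case: c; rewrite ?sv ?tv.
have [||u [su tu /omega_equiv_emb e]] := wi.2 n _ _ pp (sval v n.+1 false).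
- by rewrite sval_src (vE false).
- by rewrite sval_tgt (vE true).
exists (emb u); rewrite !emb_side su tu !emb_eval // map_emb -(emb_eval cv).
by split=> //; apply: emb_is_cell.
Qed.

Let cocyl := typed (path ti).
Let target : omegaFunctor cocyl B := comp_functor (typed_map (path_end ti)) (eval B).
Let source : omegaFunctor cocyl A := comp_functor (typed_map (path_start ti)) (eval A).
Let const : omegaFunctor A cocyl := comp_functor (embed A) (typed_map (path_const ti)).

Lemma target_inj : inj genI target.
Proof.
apply: trivial_fibration_inj => [y|n x x' par v sv tv].
  have [z [cz zy]] := path_end_surj weq_ess_surj (emb_is_cell y).
  exists (exist _ z cz).
  exact: etrans (congr1 (fun F : one_sorted B => sval F 0 false) zy) (eval_embed y).
have parx c m : m < n -> bd c m (sval x) = bd c m (sval x').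
  case: n x x' par {v sv tv} => // n x x' [/(congr1 (fun z => sval z)) es /(congr1 (fun z => sval z)) et].
  rewrite ltnS leq_eqVlt => /orP[/eqP ->|lt]; first by case: c.
  by rewrite -(bd_lt c false _ lt) [bd false n _]es bd_lt.
have E (z : cell cocyl n) : emb (gmap target z) = path_end ti (sval z).
  by rewrite emb_eval //; apply: os_is_cell; exact: (proj2_sig z).
have [||w [cw sw tw ew]] := path_end_full weq_weak_full (proj2_sig x) (proj2_sig x') parx (emb_is_cell v).
- by rewrite emb_side sv E.
- by rewrite emb_side tv E.
exists (exist _ w cw); split; try exact: sig_eq.
exact: etrans (congr1 (fun F : one_sorted B => sval F n.+1 false) ew) (eval_embed v).
Qed.

Lemma trivial_cofibration_retract : folk_cofibration i ->
  exists r : omegaFunctor B A, forall n (a : cell A n), gmap r (gmap i a) = a.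
Proof.
move=> /(_ _ _ _ target_inj const (id_functor B))[|k [ki _]].
  (* The identity cylinder on [i a] ends in [i a], so the square commutes; [eval_embed] undoes the
     passage to one-sorted cells. *)
  move=> n a /=; rewrite -[RHS](eval_embed (gmap i a)).
  by rewrite -[RHS]/(sval (emb (gmap i a)) n false) -map_emb.
exists (comp_functor k source) => n a.
by rewrite -[RHS](eval_embed a) -[LHS]/(gmap source (gmap k (gmap i a))) ki.
Qed.

End Retraction.

Theorem proposition9 (X : omegaCat) : folk_fibration (to_terminal X).
Proof.
move=> A B i [cof_i weq_i] s t _.
have [r ri] := trivial_cofibration_retract weq_i cof_i.
exists (comp_functor r s); split=> [n a|n b]; last exact: unit_all_equal.
by rewrite /= ri.
Qed.
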